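(* Let $d$ be an odd prime, let $p$ be an odd prime with $p\neq d$, and let $q=p^r$ ($r\in\mathbb{Z}^+$) be such that $q\not\equiv 1 \pmod{d}$. Let $\lambda\in\mathbb{F}_q$ and let $X_\lambda^d$ be the Dwork hypersurface $$X_{\lambda}^d:\; x_1^d+x_2^d+\cdots+x_d^d=d\lambda\, x_1x_2\cdots x_d$$ in projective space $\mathbb{P}^{d-1}$. Then the number of $\mathbb{F}_q$-rational points on $X_\lambda^d$ is $$\#X_{\lambda}^d(\mathbb{F}_q)=\frac{q^{d-1}-1}{q-1}-{}_{d-1}G_{d-1}\left[\begin{array}{cccc}\frac{1}{d}, & \frac{2}{d}, & \ldots, & \frac{d-1}{d} \\ 0, & 0, & \ldots, & 0\end{array}\Big|\,\lambda^d\right]_q.$$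
   Context: Notation: for $x\in\mathbb{Q}$, $\lfloor x\rfloor$ is the greatest integer $\le x$ and $\langle x\rangle=x-\lfloor x\rfloor$. $\mathbb{Z}_p$ is the ring of $p$-adic integers, $\mathbb{Z}_q$ the ring of integers of the unramified extension of $\mathbb{Q}_p$ with residue field $\mathbb{F}_q$. $\omega:\mathbb{F}_q^\times\to\mathbb{Z}_q^\times$ is the Teichmüller character ($\omega(a)$ is the $(q-1)$-th root of unity congruent to $a$ mod $p$), $\overline{\omega}=\omega^{-1}$, and characters are extended by $\chi(0)=0$. $\Gamma_p$ is Morita's $p$-adic gamma function: $\Gamma_p(n)=(-1)^n\prod_{0<j<n,\,p\nmid j} j$ for $n\in\mathbb{Z}^+$, extended continuously to $\mathbb{Z}_p$ (with $\Gamma_p(0)=1$). McCarthy's function: for $t\in\mathbb{F}_q$, $n\in\mathbb{Z}^+$, and $a_i,b_i\in\mathbb{Q}\cap\mathbb{Z}_p$ ($1\le i\le n$), $${}_nG_n\left[\begin{array}{ccc}a_1,&\ldots,&a_n\\ b_1,&\ldots,&b_n\end{array}\Big|\,t\right]_q:=\frac{-1}{q-1}\sum_{j=0}^{q-2}(-1)^{jn}\,\overline{\omega}^j(t)\prod_{i=1}^n\prod_{k=0}^{r-1}(-p)^{-\lfloor\langle a_ip^k\rangle-\frac{jp^k}{q-1}\rfloor-\lfloor\langle -b_ip^k\rangle+\frac{jp^k}{q-1}\rfloor}\frac{\Gamma_p(\langle (a_i-\frac{j}{q-1})p^k\rangle)}{\Gamma_p(\langle a_ip^k\rangle)}\frac{\Gamma_p(\langle(-b_i+\frac{j}{q-1})p^k\rangle)}{\Gamma_p(\langle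 -b_ip^k\rangle)}.$$ *)

(* Defs.v *)
From HB Require Import structures.
From mathcomp Require Import all_boot all_order all_algebra.
From Stdlib Require Import ClassicalEpsilon.
Set Implicit Arguments. Unset Strict Implicit. Unset Printing Implicit Defensive.
Import Order.TTheory GRing.Theory Num.Theory.
Local Open Scope ring_scope.

(* Concrete models of F_q and of Z_q / p^(N+1) Z_q.                          *)
(* Given a monic integer polynomial f of degree r whose reduction mod p is  *)
(* irreducible, F_q = F_p[x]/(f) and Z_q = lim_N (Z/p^(N+1))[x]/(f).        *)

Definition fbar (p : nat) (f : {poly int}) : {poly 'F_p} :=
  map_poly (fun c : int => c%:~R) f.

Definition Fq (p : nat) (f : {poly int}) := {poly %/ fbar p f}.

Definition fN (p : nat) (f : {poly int}) (N : nat) : {poly 'Z_(p ^ N.+1)} :=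
  map_poly (fun c : int => c%:~R) f.

Definition GR (p : nat) (f : {poly int}) (N : nat) := {poly %/ fN p f N}.

Definition red (p : nat) (f : {poly int}) (N : nat) (x : GR p f N) : Fq p f :=
  in_qpoly (fbar p f)
    (map_poly (fun c : 'Z_(p ^ N.+1) => (nat_of_ord c)%:R : 'F_p) (x : {poly _})).

Definition teich (p r : nat) (f : {poly int}) (N : nat) (t : Fq p f) : GR p f N :=
  if t == 0 then 0 else
  odflt 0 [pick y : GR p f N | (y ^+ (p ^ r).-1 == 1) && (red y == t)].

Definition teichbar (p r : nat) (f : {poly int}) (N : nat) (t : Fq p f) : GR p f N :=
  if t == 0 then 0 else
  odflt 0 [pick y : GR p f N | y * teich r N t == 1].

(* the character overline(omega)^j evaluated at t, with chi(0) = 0 for all j *)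
Definition teichbar_pow (p r : nat) (f : {poly int}) (N : nat) (j : nat)
    (t : Fq p f) : GR p f N :=
  if t == 0 then 0 else teichbar r N t ^+ j.

Definition fracq (x : rat) : rat := x - (Num.floor x)%:~R.

Definition gammap_nat (p n : nat) : int :=
  (-1) ^+ n * \prod_(1 <= j < n | ~~ (p %| j)%N) (j%:Z).

(* Morita's p-adic Gamma function at x in Q (p-integral), modulo p^(N+1),   *)
(* defined as the continuous extension: the residue y such that             *)
(* Gamma_p(n) = y mod p^(N+1) for all positive integers n close enough to x.*)
Definition gammap (p N : nat) (x : rat) : 'Z_(p ^ N.+1) :=
  epsilon (inhabits 0) (fun y : 'Z_(p ^ N.+1) =>
    exists M : nat, forall n : nat, (0 < n)%N ->
      ((p ^ M)%:Z %| (n%:Z * denq x - numq x))%Z ->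
      (gammap_nat p n)%:~R = y).

(* One factor of McCarthy's function, for fixed i, k and j, multiplied by p *)
(* (the exponent e below always satisfies e >= -1).                         *)
Definition mc_factor (p r N : nat) (ai bi : rat) (j k : nat) : 'Z_(p ^ N.+1) :=
  let q := (p ^ r)%N in
  let pk : rat := (p ^ k)%:R in
  let x : rat := j%:R * pk / (q.-1)%:R in
  let e : int := - Num.floor (fracq (ai * pk) - x) - Num.floor (fracq (- bi * pk) + x) in
  exprz (-1 : 'Z_(p ^ N.+1)) e * (p%:R) ^+ absz (e + 1) *
  (gammap p N (fracq ((ai - j%:R / (q.-1)%:R) * pk)) / gammap p N (fracq (ai * pk))) *
  (gammap p N (fracq ((- bi + j%:R / (q.-1)%:R) * pk)) / gammap p N (fracq (- bi * pk))).

(* p^(n r) * nG_n[a; b | t]_q   computed modulo p^(N+1) in Z_q *)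
Definition mcG_scaled (p r : nat) (f : {poly int}) (n : nat) (a b : 'I_n -> rat)
    (N : nat) (t : Fq p f) : GR p f N :=
  let q := (p ^ r)%N in
  \sum_(j < q.-1)
    ((- ((q.-1)%:R : 'Z_(p ^ N.+1))^-1) * (-1) ^+ (j * n) *
       \prod_(i < n) \prod_(k < r) mc_factor p r N (a i) (b i) j k)
    *: teichbar_pow r N j t.

(* "nG_n[a; b | t]_q = z" (an equality in Q_q, z an integer): equivalently  *)
(* p^(n r) G = p^(n r) z in Z_q, i.e. modulo p^(N+1) for every N.           *)
Definition mcG_eq (p r : nat) (f : {poly int}) (n : nat) (a b : 'I_n -> rat)
    (t : Fq p f) (z : int) : Prop :=
  forall N : nat, mcG_scaled r a b N t = ((p ^ (n * r))%:Z * z)%:~R.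

Definition dwork_affine (p : nat) (f : {poly int}) (d : nat) (lam : Fq p f) :
    {set {ffun 'I_d -> Fq p f}} :=
  [set x : {ffun 'I_d -> Fq p f} | (x != 0) &&
     (\sum_(i < d) x i ^+ d == d%:R * lam * \prod_(i < d) x i)].

Definition dwork_points (p : nat) (f : {poly int}) (d : nat) (lam : Fq p f) :
    {set {set {ffun 'I_d -> Fq p f}}} :=
  [set [set ([ffun i => c * x i] : {ffun 'I_d -> Fq p f}) | c : Fq p f in [set c : Fq p f | c != 0]]
     | x : {ffun 'I_d -> Fq p f} in dwork_affine d lam].

(* Main.v *)
(** Sending x_i to y_i = x_i^d is a bijection of F_q since d is prime to q - 1,
so the affine cone becomes (sum y)^d = d^d lam^d prod y. Expanding the last
condition in the powers of the Teichmueller character expresses the point count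
through the Jacobi sums J_j of d equal characters, and it suffices to identify
each p^((d-1)r) J_j with the j-th coefficient of McCarthy's function modulo
every power of p.

That is a Gross-Koblitz type formula. Adjoin pi with pi^(p-1) = - p; then
exp(pi (x - x^q)), evaluated at Teichmueller points, is an additive character
with values in a finite quotient of the ring of integers, so J_j is a quotient
of the Gauss sums g_j^d / g_(dj). Summing over x turns g_a into a sum of every
(q-1)-st coefficient of this series. With eta = a + (q - 1) M = a q^k, an exact
rational identity equates that sum to M! varpi^M / (q M + a)! up to terms that
vanish p-adically as k grows, thanks to Dwork's estimate on the coefficients.
The factorial ratio is a product of values of Gamma_p, and the reflection and
multiplication formulas for Gamma_p recover McCarthy's factors. *)

Require Import Defs.
From Stdlib Require Import ClassicalEpsilon.
From HB Require Import structures.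
From mathcomp Require Import all_boot all_order all_algebra.
From mathcomp Require Import finfield qfpoly.
From mathcomp Require Import zify ring lra.
Set Implicit Arguments. Unset Strict Implicit. Unset Printing Implicit Defensive.
Import Order.TTheory GRing.Theory Num.Theory.
Local Open Scope ring_scope.

(** * Formal power series as coefficient sequences *)

(** [mcG_eq] is a family of congruences, so N is fixed and all character sums live in rings where p
    is nilpotent. There neither p, nor pi, nor a Gauss sum can be cancelled. Hence series
    coefficients stay rational numbers and are reduced only once p-integral ([zmodp], [ev]), Jacobi
    sums enter through a product formula, and the scaling p^((d-1) r) supplies powers of p where the
    classical argument divides.

    The rational identity is Dwork cohomology in coordinates: the operator with matrix [phi]
    commutes up to a factor q with a first-order differential operator whose cokernel is spanned by
    one class, so (1 - q) times its trace is its eigenvalue on that class. Exact commutation needs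
    the exponent M = - a / (q - 1). The integers M = a (q^k - 1) / (q - 1) approach that number
    p-adically; the defect of commutation is then eta = a q^k, and, M being a natural number, the
    main term is a finite sum with a closed form. *)

Section Convolution.
Variable R : comNzRingType.
Implicit Types f g h : nat -> R.

Definition conv f g n := \sum_(i < n.+1) f i * g (n - i)%N.

Definition trunc L f : {poly R} := \poly_(i < L) f i.

Lemma conv_trunc L f g n : (n < L)%N -> conv f g n = (trunc L f * trunc L g)`_n.
Proof.
move=> ltnL; rewrite coefM; apply: eq_bigr => i _; rewrite !coef_poly.
by rewrite (leq_ltn_trans _ ltnL) ?(leq_ltn_trans (leq_subr _ _) ltnL) // -ltnS.
Qed.

Lemma eq_conv f f' g g' : f =1 f' -> g =1 g' -> conv f g =1 conv f' g'.
Proof. by move=> ef eg n; apply: eq_bigr => i _; rewrite ef eg. Qed.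

Lemma convC f g : conv f g =1 conv g f.
Proof. by move=> n; rewrite !(@conv_trunc n.+1) // mulrC. Qed.

Lemma conv_truncl L f g h n : (n < L)%N ->
  (trunc L (conv f g) * trunc L h)`_n = (trunc L f * trunc L g * trunc L h)`_n.
Proof.
move=> ltnL; rewrite !coefM; apply: eq_bigr => i _; congr (_ * _).
have ltiL : (i < L)%N by apply: leq_ltn_trans ltnL; rewrite -ltnS.
by rewrite coef_poly ltiL (conv_trunc f g ltiL).
Qed.

Lemma convA f g h : conv f (conv g h) =1 conv (conv f g) h.
Proof.
move=> n; have ltn := ltnSn n; rewrite convC !(conv_trunc _ _ ltn).
by rewrite !conv_truncl // mulrC mulrA.
Qed.

Lemma convCA f g h : conv f (conv g h) =1 conv g (conv f h).
Proof.
by move=> n; rewrite convA (eq_conv (convC f g) (frefl h)) -convA.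
Qed.

Lemma convACA f g h k : conv (conv f g) (conv h k) =1 conv (conv f h) (conv g k).
Proof.
move=> n; rewrite -convA (eq_conv (frefl f) (convA g h k)).
rewrite (eq_conv (frefl f) (eq_conv (convC g h) (frefl k))).
by rewrite -(eq_conv (frefl f) (convA h g k)) convA.
Qed.

Lemma conv_supp L1 L2 f g n :
    (forall m, (L1 <= m)%N -> f m = 0) -> (forall m, (L2 <= m)%N -> g m = 0) ->
  (L1 + L2 <= n)%N -> conv f g n = 0.
Proof.
move=> f0 g0 len; apply: big1 => i _; have [leL|ltL] := leqP L1 i.
  by rewrite f0 ?mul0r.
by rewrite g0 ?mulr0 //; lia.
Qed.

Lemma sum_trunc L f : \sum_(n < L) f n = (trunc L f).[1].
Proof. by rewrite horner_poly; apply: eq_bigr => i _; rewrite expr1n mulr1. Qed.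

Lemma sum_supp L L' f : (forall m, (L <= m)%N -> f m = 0) -> (L <= L')%N ->
  \sum_(n < L') f n = \sum_(n < L) f n.
Proof.
move=> f0 leL; rewrite -!(big_mkord xpredT f) (big_cat_nat (n := L)) //=.
by rewrite [X in _ + X]big_nat_cond [X in _ + X]big1 ?addr0 // => i; case/andP=> /andP[] /f0.
Qed.

(** Series of finite support are polynomials, and summing coefficients is evaluation at 1, which is
    multiplicative. This turns identities between series into identities in R without any notion of
    convergence. *)
Lemma sum_conv L1 L2 L f g :
    (forall m, (L1 <= m)%N -> f m = 0) -> (forall m, (L2 <= m)%N -> g m = 0) ->
    (L1 + L2 <= L)%N ->
  \sum_(n < L) conv f g n = (\sum_(n < L1) f n) * (\sum_(n < L2) g n).
Proof.
move=> f0 g0 leL.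
rewrite -(sum_supp f0 (_ : (L1 <= L)%N)); last by lia.
rewrite -(sum_supp g0 (_ : (L2 <= L)%N)); last by lia.
rewrite !sum_trunc -hornerM; congr horner.
apply/polyP=> n; rewrite coef_poly; case: ltnP => [ltn|len]; first exact: conv_trunc.
rewrite coefM big1 // => i _; rewrite !coef_poly.
case: ifP => // ltiL; case: ifP => ltnL; rewrite ?mulr0 ?mul0r //.
have [leL1|ltL1] := leqP L1 i; first by rewrite f0 ?mul0r.
by rewrite g0 ?mulr0 //; lia.
Qed.

(** The series f(x^k). *)
Definition stretch k f n := if (k %| n)%N then f (n %/ k)%N else 0.

Lemma sum_stretch k f m : (0 < k)%N ->
  \sum_(i < (k * m).+1) stretch k f i = \sum_(i < m.+1) f i.
Proof.
move=> k0; elim: m => [|m IHm].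
  by rewrite muln0 !big_ord_recl !big_ord0 /stretch dvdn0 div0n.
rewrite [RHS]big_ord_recr -IHm -!(big_mkord xpredT (stretch k f)) /=.
rewrite (big_cat_nat (n := (k * m).+1)) //=; last by rewrite mulnS; lia.
congr (_ + _); rewrite mulnS addnC big_nat_recr /=; last by lia.
rewrite big_nat_cond big1 ?add0r => [|i].
  by rewrite /stretch dvdn_addr ?dvdn_mulr // dvdnn divnDr // divnn k0 mulKn // addn1.
rewrite andbT => /andP[lti1 lti2]; rewrite /stretch; case: ifP => // /dvdnP[j ej].
have ltmj : (m < j)%N by rewrite -(ltn_pmul2r k0); lia.
have ltjm : (j < m.+1)%N by rewrite -(ltn_pmul2r k0); lia.
by lia.
Qed.

Lemma conv_stretch k f g : (0 < k)%N ->
  conv (stretch k f) (stretch k g) =1 stretch k (conv f g).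
Proof.
move=> k0 n; rewrite /stretch; case: ifP => [/dvdnP[m ->]|kn].
  rewrite mulnC mulKn //.
  transitivity (\sum_(i < (k * m).+1) stretch k (fun i => f i * g (m - i)%N) i); last first.
    exact: sum_stretch.
  apply: eq_bigr => i _; rewrite /stretch; case: ifP => ki; rewrite ?mul0r //.
  case/dvdnP: ki => j ->; rewrite mulnC -mulnBr dvdn_mulr // !mulKn //.
apply: big1 => i _; case: ifP => ki; rewrite ?mul0r //; case: ifP => kni; rewrite ?mulr0 //.
have lein : (i <= n)%N by rewrite -ltnS.
by rewrite -(subnK lein) dvdn_addl ?kni in kn.
Qed.

Section DividedExp.
Variable e : nat -> R.
Hypothesis e0 : e 0 = 1.
Hypothesis eM : forall i j, e i * e j = 'C(i + j, i)%:R * e (i + j)%N.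

(** Under the divided-power law [eM] this is exp(s x). The law holds for 1/n! over [rat] and for the
    images of pi^n/n! in a ring where n! is not invertible, so both settings share these proofs. *)
Definition expser s n := e n * s ^+ n.

Lemma expserD s t : conv (expser s) (expser t) =1 expser (s + t).
Proof.
move=> n; rewrite /conv /expser [s + t]addrC exprDn mulr_sumr; apply: eq_bigr => i _.
have lein : (i <= n)%N by rewrite -ltnS.
by rewrite mulrACA eM subnKC // -mulr_natl; ring.
Qed.

Definition expk k s := stretch k (expser s).

Lemma expkD k s t : (0 < k)%N -> conv (expk k s) (expk k t) =1 expk k (s + t).
Proof.
move=> k0 n; rewrite conv_stretch // /expk /stretch.
by case: ifP => // _; rewrite expserD.
Qed.

End DividedExp.
End Convolution.

(** * p-integral rationals and their reduction *)

Section PIntegral.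
Variables (p : nat) (p_pr : prime p).
Implicit Types x y : rat.

Definition pint x := coprime p `|denq x|.

(** The fraction need not be reduced, which makes closure under sums and products immediate. *)
Lemma pintP x :
  pint x <-> exists (a : int) (b : nat), ~~ (p %| b)%N /\ x * b%:R = a%:~R.
Proof.
rewrite /pint prime_coprime //; split=> [pd|[a [b [pb xb]]]].
  exists (numq x), `|denq x|%N; split=> //.
  by rewrite pmulrn absz_denq -numqE.
apply: contra pb => /dvdn_trans; apply.
have : (numq x)%:~R * (b%:R : rat) = (a * denq x)%:~R.
  by rewrite numqE intrM -xb; ring.
rewrite pmulrn -intrM => /eqP; rewrite eqr_int => /eqP e.
have : (denq x %| numq x * b)%Z by rewrite e dvdz_mull.
by rewrite Gauss_dvdzr // coprimezE coprime_sym coprime_num_den.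
Qed.

Lemma pint_intr (a : int) : pint a%:~R.
Proof. by rewrite /pint denq_int coprimen1. Qed.

Lemma pint_natr (a : nat) : pint a%:R.
Proof. by rewrite pmulrn pint_intr. Qed.

Lemma pint0 : pint 0. Proof. exact: (pint_natr 0). Qed.
Lemma pint1 : pint 1. Proof. exact: (pint_natr 1). Qed.

Lemma pintD x y : pint x -> pint y -> pint (x + y).
Proof.
move=> /pintP[a [b [pb xb]]] /pintP[c [d [pd yd]]]; apply/pintP.
exists (a * d%:Z + c * b%:Z), (b * d)%N; rewrite Euclid_dvdM // negb_or pb pd; split=> //.
by rewrite natrM intrD !intrM -xb -yd -!pmulrn; ring.
Qed.

Lemma pintM x y : pint x -> pint y -> pint (x * y).
Proof.
move=> /pintP[a [b [pb xb]]] /pintP[c [d [pd yd]]]; apply/pintP.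
exists (a * c), (b * d)%N; rewrite Euclid_dvdM // negb_or pb pd; split=> //.
by rewrite natrM intrM -xb -yd; ring.
Qed.

Lemma pintN x : pint x -> pint (- x).
Proof. by rewrite -mulN1r; apply: pintM; apply: (pint_intr (-1)). Qed.

Lemma pintB x y : pint x -> pint y -> pint (x - y).
Proof. by move=> px py; apply: pintD => //; apply: pintN. Qed.

Lemma pintX x n : pint x -> pint (x ^+ n).
Proof.
by move=> px; elim: n => [|n IHn]; rewrite ?pint1 // exprS pintM.
Qed.

Lemma pint_sum (I : Type) (s : seq I) (P : pred I) (F : I -> rat) :
  (forall i, P i -> pint (F i)) -> pint (\sum_(i <- s | P i) F i).
Proof. by move=> h; apply: (big_ind pint) => //; [exact: pint0 | exact: pintD]. Qed.

Lemma pint_prod (I : Type) (s : seq I) (P : pred I) (F : I -> rat) :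
  (forall i, P i -> pint (F i)) -> pint (\prod_(i <- s | P i) F i).
Proof. by move=> h; apply: (big_ind pint) => //; [exact: pint1 | exact: pintM]. Qed.

Lemma pint_sign n : pint ((-1) ^+ n).
Proof. by apply: pintX; apply: (pint_intr (-1)). Qed.

Lemma pintV (b : nat) : ~~ (p %| b)%N -> pint (b%:R^-1).
Proof.
move=> pb; apply/pintP; exists 1, b; split=> //.
by rewrite mulVf // pnatr_eq0; apply: contraNneq pb => ->; rewrite dvdn0.
Qed.

Let pnz : (p%:R : rat) != 0.
Proof. by rewrite pnatr_eq0 -lt0n prime_gt0. Qed.

Lemma pint_expn_le m n x : (m <= n)%N -> pint (p%:R ^+ m * x) -> pint (p%:R ^+ n * x).
Proof.
move=> lemn; rewrite -(subnK lemn) exprD -mulrA => h.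
by apply: pintM => //; apply: pintX; apply: pint_natr.
Qed.

Lemma natr_logn (b : nat) : (0 < b)%N -> exists c, [/\ ~~ (p %| c)%N & b = (p ^ logn p b * c)%N].
Proof.
move=> b0; exists (b %/ p ^ logn p b)%N.
have e : b = (p ^ logn p b * (b %/ p ^ logn p b))%N by rewrite mulnC divnK // pfactor_dvdnn.
split=> //; apply/negP => h.
have : (p ^ (logn p b).+1 %| b)%N by rewrite [X in (_ %| X)%N]e expnSr dvdn_mul.
by rewrite pfactor_dvdn // ltnn.
Qed.

Lemma pint_divn (b : nat) : (0 < b)%N -> pint (p%:R ^+ logn p b / b%:R).
Proof.
move=> b0; have [c [pc ebc]] := natr_logn b0.
rewrite {2}ebc natrM natrX invfM mulrA divff ?mul1r ?expf_neq0 //.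
exact: pintV.
Qed.

Variable N : nat.
Local Notation Z := 'Z_(p ^ N.+1).

Lemma modulus_gt1 : (1 < p ^ N.+1)%N.
Proof. by rewrite -(expn0 p) ltn_exp2l ?prime_gt1. Qed.

Lemma unit_Zpn (b : nat) : ~~ (p %| b)%N -> (b%:R : Z) \is a GRing.unit.
Proof.
by move=> pb; rewrite unitZpE ?modulus_gt1 // coprimeXl // prime_coprime.
Qed.

Lemma Zpn_p0 : (p%:R : Z) ^+ N.+1 = 0.
Proof. by rewrite -natrX pchar_Zp ?modulus_gt1. Qed.

Definition zmodp x : Z := (numq x)%:~R / (denq x)%:~R.

Lemma zmodpE x (a : int) (b : nat) : ~~ (p %| b)%N -> x * b%:R = a%:~R ->
  zmodp x = a%:~R / b%:R.
Proof.
move=> pb xb; have pd : pint x by apply/pintP; exists a, b.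
have ud : ((denq x)%:~R : Z) \is a GRing.unit.
  by rewrite -absz_denq -pmulrn unit_Zpn // -prime_coprime.
have ub := unit_Zpn pb.
apply: (mulIr ud); rewrite /zmodp mulrVK // mulrAC; apply: (mulIr ub); rewrite mulrVK //.
have : (numq x)%:~R * (b%:R : rat) = (a * denq x)%:~R.
  by rewrite numqE intrM -xb; ring.
rewrite pmulrn -intrM => /eqP; rewrite eqr_int => /eqP e.
by rewrite pmulrn -!intrM e.
Qed.

Lemma zmodp_intr (a : int) : zmodp a%:~R = a%:~R.
Proof. by rewrite /zmodp numq_int denq_int divr1. Qed.

Lemma zmodp_natr (a : nat) : zmodp a%:R = a%:R.
Proof. by rewrite pmulrn zmodp_intr -pmulrn. Qed.

Lemma zmodpD x y : pint x -> pint y -> zmodp (x + y) = zmodp x + zmodp y.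
Proof.
move=> /pintP[a [b [pb xb]]] /pintP[c [d [pd yd]]].
have pbd : ~~ (p %| b * d)%N by rewrite Euclid_dvdM // negb_or pb pd.
have e : (x + y) * (b * d)%:R = (a * d%:Z + c * b%:Z)%:~R.
  by rewrite natrM intrD !intrM -xb -yd -!pmulrn; ring.
rewrite (zmodpE pb xb) (zmodpE pd yd) (zmodpE pbd e).
have ub := unit_Zpn pb; have ud := unit_Zpn pd.
rewrite natrM invrM // intrD !intrM -!pmulrn mulrDl; congr (_ + _).
  by rewrite mulrA mulrK.
by rewrite [_^-1 / _]mulrC mulrA mulrK.
Qed.

Lemma zmodpM x y : pint x -> pint y -> zmodp (x * y) = zmodp x * zmodp y.
Proof.
move=> /pintP[a [b [pb xb]]] /pintP[c [d [pd yd]]].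
have pbd : ~~ (p %| b * d)%N by rewrite Euclid_dvdM // negb_or pb pd.
have e : (x * y) * (b * d)%:R = (a * c)%:~R by rewrite natrM intrM -xb -yd; ring.
rewrite (zmodpE pb xb) (zmodpE pd yd) (zmodpE pbd e).
have ub := unit_Zpn pb; have ud := unit_Zpn pd.
by rewrite natrM invrM // intrM [_^-1 / _]mulrC mulrACA.
Qed.

Lemma zmodpN x : pint x -> zmodp (- x) = - zmodp x.
Proof.
move=> px; rewrite -mulN1r zmodpM ?(pint_intr (-1)) //.
by rewrite (zmodp_intr (-1)) mulN1r.
Qed.

Lemma zmodpX x n : pint x -> zmodp (x ^+ n) = zmodp x ^+ n.
Proof.
move=> px; elim: n => [|n IHn]; first by rewrite !expr0 (zmodp_natr 1).
by rewrite !exprS zmodpM ?IHn // pintX.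
Qed.

Lemma zmodp_sum (I : Type) (s : seq I) (P : pred I) (F : I -> rat) :
  (forall i, P i -> pint (F i)) ->
  zmodp (\sum_(i <- s | P i) F i) = \sum_(i <- s | P i) zmodp (F i).
Proof.
move=> h; suff [] : pint (\sum_(i <- s | P i) F i) /\
  zmodp (\sum_(i <- s | P i) F i) = \sum_(i <- s | P i) zmodp (F i) by [].
elim: s => [|i s [IH1 IH2]]; first by rewrite !big_nil (zmodp_natr 0) pint0.
rewrite !big_cons; case: ifP => // Pi; rewrite -IH2 zmodpD ?h //.
by split=> //; apply: pintD; rewrite ?h.
Qed.

Lemma zmodp_prod (I : Type) (s : seq I) (P : pred I) (F : I -> rat) :
  (forall i, P i -> pint (F i)) ->
  zmodp (\prod_(i <- s | P i) F i) = \prod_(i <- s | P i) zmodp (F i).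
Proof.
move=> h; suff [] : pint (\prod_(i <- s | P i) F i) /\
  zmodp (\prod_(i <- s | P i) F i) = \prod_(i <- s | P i) zmodp (F i) by [].
elim: s => [|i s [IH1 IH2]]; first by rewrite !big_nil (zmodp_natr 1) pint1.
rewrite !big_cons; case: ifP => // Pi; rewrite -IH2 zmodpM ?h //.
by split=> //; apply: pintM; rewrite ?h.
Qed.

Lemma zmodp_eq0 x : pint x -> zmodp (p%:R ^+ N.+1 * x) = 0.
Proof.
move=> px; rewrite zmodpM // ?zmodpX ?zmodp_natr ?Zpn_p0 ?mul0r ?pint_natr //.
by apply: pintX; apply: pint_natr.
Qed.

Lemma zmodp_cong x y : pint y -> pint ((x - y) / p%:R ^+ N.+1) ->
  pint x /\ zmodp x = zmodp y.
Proof.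
move=> py h; have e : x = y + p%:R ^+ N.+1 * ((x - y) / p%:R ^+ N.+1).
  by rewrite mulrC divfK ?expf_neq0 // addrC subrK.
have ph : pint (p%:R ^+ N.+1 * ((x - y) / p%:R ^+ N.+1)).
  by apply: pintM => //; apply: pintX; apply: pint_natr.
by rewrite e zmodpD // zmodp_eq0 // addr0; split=> //; apply: pintD.
Qed.

End PIntegral.

(** * Factorials and their p-adic valuation *)

Section FactorialValuation.
Variables (p : nat) (p_pr : prime p).

Definition pfact n := \prod_(1 <= j < n.+1 | ~~ (p %| j)%N) j.

Lemma pfact_ndvd n : ~~ (p %| pfact n)%N.
Proof.
rewrite /pfact; elim/big_rec: _ => [|j x pj IHx].
  by rewrite dvdn1 neq_ltn prime_gt1 ?orbT.
by rewrite Euclid_dvdM // negb_or pj.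
Qed.

Lemma pfact_gt0 n : (0 < pfact n)%N.
Proof. by rewrite lt0n; apply: contraNneq (pfact_ndvd n) => ->; rewrite dvdn0. Qed.

Lemma fact_pfact n : (n`! = p ^ (n %/ p) * (n %/ p)`! * pfact n)%N.
Proof.
have p0 := prime_gt0 p_pr.
elim: n => [|n IHn]; first by rewrite div0n /pfact big_geq.
rewrite factS /pfact big_mkcond big_nat_recr //= -big_mkcond -/(pfact n) IHn.
rewrite divnS //; case: (boolP (p %| n.+1)%N) => pn /=; last by rewrite add0n; ring.
have -> : (n.+1 = p * (n %/ p).+1)%N.
  by rewrite -{1}(divnK pn) divnS // pn add1n mulnC.
by rewrite add1n factS expnS; ring.
Qed.

Lemma logn_fact_div n : logn p n`! = (n %/ p + logn p (n %/ p)`!)%N.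
Proof.
have pp0 : (0 < p ^ (n %/ p))%N by rewrite expn_gt0 prime_gt0.
have q0 : (0 < p ^ (n %/ p) * (n %/ p)`!)%N by rewrite muln_gt0 pp0 fact_gt0.
rewrite {1}fact_pfact (lognM _ q0 (pfact_gt0 n)) (lognM _ pp0 (fact_gt0 _)) pfactorK //.
suff -> : logn p (pfact n) = 0%N by rewrite addn0.
by apply/eqP; rewrite -leqn0 leqNgt logn_gt0 mem_primes negb_and negb_and pfact_ndvd !orbT.
Qed.

(** Legendre: (p - 1) v(n!) is n minus the sum of the base-p digits of n. *)
Lemma logn_fact_le n : ((p - 1) * logn p n`! <= n)%N.
Proof.
have p1 := prime_gt1 p_pr.
elim/ltn_ind: n => -[|n] IHn; first by rewrite fact0 logn1 muln0.
rewrite logn_fact_div mulnDr; set m := (n.+1 %/ p)%N.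
have ltm : (m < n.+1)%N by rewrite ltn_Pdiv.
have : (m * p <= n.+1)%N by rewrite leq_trunc_div.
have := IHn _ ltm; nia.
Qed.

(** Legendre again: the t lowest digits of n sum to at most t (p - 1), the remaining ones to at most
    n / p^t. The loss is a constant plus an arbitrarily small proportion of n. *)
Lemma logn_fact_ge t n : ((p ^ t - 1) * n <= p ^ t * ((p - 1) * logn p n`! + t * (p - 1)))%N.
Proof.
have p1 := prime_gt1 p_pr.
elim: t n => [|t IHt] n; first by rewrite expn0 mul1n.
rewrite logn_fact_div; set m := (n %/ p)%N.
have := IHt m; set v := logn p m`!.
have nm : (n <= m * p + (p - 1))%N by rewrite {1}(divn_eq n p); have := ltn_pmod n (prime_gt0 p_pr); lia.
have pt0 : (0 < p ^ t)%N by rewrite expn_gt0; lia.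
rewrite expnS; set P := (p ^ t)%N in pt0 *; move=> h.
have hP : (p * ((P - 1) * m) <= p * (P * ((p - 1) * v + t * (p - 1))))%N by rewrite leq_mul2l h orbT.
apply: (@leq_trans ((p * P - 1) * (m * p + (p - 1)))); first by rewrite leq_mul2l nm orbT.
have [p' ep] : exists p', p = p'.+1 by exists p.-1; lia.
have [P' eP] : exists P', P = P'.+1 by exists P.-1; lia.
have eA : (p * P - 1 = p' * P' + p' + P')%N by rewrite ep eP; lia.
rewrite eA; move: hP; rewrite ep eP !subSS !subn0 => hP.
have e : ((p' * P' + p' + P') * (m * p'.+1 + p') + p' + p'.+1 * (P'.+1 * (p' * v + t * p'))
   = p'.+1 * P'.+1 * (p' * (m + v) + t.+1 * p') + p'.+1 * (P' * m))%N by ring.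
by lia.
Qed.

End FactorialValuation.

Definition einv n : rat := n`!%:R^-1.

Lemma einv0 : einv 0 = 1. Proof. by rewrite /einv fact0 invr1. Qed.

Lemma factr_neq0 n : (n`!%:R : rat) != 0.
Proof. by rewrite pnatr_eq0 -lt0n fact_gt0. Qed.

Lemma einvM i j : einv i * einv j = 'C(i + j, i)%:R * einv (i + j)%N.
Proof.
apply: (mulIf (factr_neq0 (i + j))); rewrite /einv -[RHS]mulrA mulVf ?factr_neq0 // mulr1.
apply: (mulIf (factr_neq0 i)); apply: (mulIf (factr_neq0 j)).
have := @bin_fact (i + j) i (leq_addr _ _); rewrite addKn => e.
rewrite -[RHS]mulrA -!natrM e; field.
by rewrite !factr_neq0.
Qed.

(** * Formal derivatives and the differential equation of exp(s x^k) *)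

Section Derivation.
Variable R : comNzRingType.

Definition dser (f : nat -> R) n := n.+1%:R * f n.+1.

Lemma dser_conv f g n : dser (conv f g) n = conv (dser f) g n + conv f (dser g) n.
Proof.
have dT h i : (i < n.+1)%N -> (trunc n.+2 h)^`()`_i = dser h i.
  by move=> lti; rewrite coef_deriv coef_poly ltnS lti /dser mulr_natl.
rewrite /dser (@conv_trunc _ n.+2) // mulr_natl -coef_deriv derivM coefD.
congr (_ + _); rewrite coefM; apply: eq_bigr => i _; rewrite dT ?coef_poly //.
- by rewrite (leq_ltn_trans (leq_subr _ _)).
- by rewrite (ltn_trans (ltn_ord i)).
by rewrite ltnS leq_subr.
Qed.

Definition mono (c : R) (j i : nat) := if i == j then c else 0.

Lemma conv_mono c j g n : conv (mono c j) g n = if (j <= n)%N then c * g (n - j)%N else 0.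
Proof.
rewrite /conv; case: leqP => [lej|ltn].
  rewrite (bigD1 (Ordinal (lej : (j < n.+1)%N))) //= /mono eqxx big1 ?addr0 // => i.
  by rewrite -val_eqE /= => /negPf ->; rewrite mul0r.
rewrite big1 // => i _; rewrite /mono; case: eqP => [e|_]; last by rewrite mul0r.
by have := ltn_ord i; rewrite e ltnS leqNgt ltn.
Qed.

Definition cf (P : {poly int}) i : R := (P`_i)%:~R.

Lemma cfM P Q : conv (cf P) (cf Q) =1 cf (P * Q).
Proof.
move=> n; rewrite /conv /cf coefM -[RHS]/(intr _) rmorph_sum /=.
by apply: eq_bigr => i _; rewrite intrM.
Qed.

Lemma dser_cf P n : dser (cf P) n = cf P^`() n.
Proof. by rewrite /dser /cf coef_deriv mulr_natl -[RHS]/(intr _) rmorphMn. Qed.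

End Derivation.

Lemma dser_expk k (s : rat) n : (0 < k)%N ->
  dser (expk einv k s) n = conv (mono (k%:R * s) k.-1) (expk einv k s) n.
Proof.
move=> k0; rewrite conv_mono /dser /expk /stretch /expser.
case: (boolP (k %| n.+1)%N) => [/dvdnP[[|m] e]|kn] //.
  have -> : (k.-1 <= n)%N by lia.
  have -> : (n - k.-1 = m * k)%N by lia.
  rewrite dvdn_mull // e !mulnK // /einv factS natrM exprS.
  have anz : (m.+1%:R : rat) != 0 by rewrite pnatr_eq0.
  by rewrite natrM; move: (m.+1%:R) anz => b bnz; field; rewrite factr_neq0 bnz.
rewrite mulr0; case: leqP => // len; case: ifP; rewrite ?mulr0 // => h.
by move: kn; rewrite -[n.+1](_ : n - k.-1 + k = _)%N ?dvdn_addl ?h //; lia.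
Qed.

(** * Growth of the coefficients of Dwork's exponential *)

Section Decay.
Variables (p : nat) (p_pr : prime p).

(* exp(x + x^p / p). *)
Definition theta := conv (expk einv 1 1) (expk einv p p%:R^-1).

Let p0 := prime_gt0 p_pr.
Let p1 := prime_gt1 p_pr.
Let pnz : (p%:R : rat) != 0. Proof. by rewrite pnatr_eq0 -lt0n. Qed.

(** As theta' = (1 + x^(p-1)) theta, the k-th derivative of theta is theta times this polynomial. *)
Fixpoint dpol k : {poly int} :=
  if k is k'.+1 then (dpol k')^`() + dpol k' * (1 + 'X^(p.-1)) else 1.

Lemma dser_theta n : dser theta n = conv (@cf rat (1 + 'X^(p.-1))) theta n.
Proof.
rewrite dser_conv (eq_conv (fun m => @dser_expk 1 1 m isT) (frefl _)).
rewrite (eq_conv (frefl _) (fun m => @dser_expk p p%:R^-1 m p0)).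
rewrite -convA [X in _ + X]convCA -/theta /conv -big_split /=; apply: eq_bigr => i _.
rewrite -mulrDl; congr (_ * _).
by rewrite /mono /cf coefD coef1 coefXn mul1r divff // intrD; congr (_ + _); case: eqP.
Qed.

Lemma theta_dpol k n :
  ((n + k) ^_ k)%:R * theta (n + k)%N = conv (cf rat (dpol k)) theta n.
Proof.
elim: k n => [|k IHk] n.
  rewrite addn0 mul1r /conv big_ord_recl /= subn0 /cf coef1 mul1r big1 ?addr0 // => i _.
  by rewrite coef1 mul0r.
rewrite /= addnS.
have e : dser (fun m => ((m + k) ^_ k)%:R * theta (m + k)%N) n
         = dser (conv (cf rat (dpol k)) theta) n by rewrite /dser IHk.
rewrite dser_conv (eq_conv (frefl _) dser_theta) (convA (cf rat (dpol k)) (cf rat _)) in e.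
rewrite (eq_conv (cfM _ _ _) (frefl _)) in e.
rewrite (eq_conv (dser_cf _ _) (frefl _)) in e.
transitivity (dser (fun m => ((m + k) ^_ k)%:R * theta (m + k)%N) n).
  rewrite /dser addSn mulrA -natrM; congr (_%:R * _).
  by rewrite ffactnSr mulnC; congr (_ * _)%N; lia.
rewrite e /conv -big_split /=; apply: eq_bigr => i _.
by rewrite -mulrDl /cf coefD intrD.
Qed.

Lemma theta_small n : (n < p)%N -> theta n = einv n.
Proof.
move=> ltn; rewrite /theta convC /conv big_ord_recl /= /expk /stretch /expser.
rewrite dvdn0 div0n subn0 einv0 dvd1n divn1 expr0 expr1n !mul1r mulr1 big1 ?addr0 // => i _.
by rewrite gtnNdvd ?mul0r // (leq_ltn_trans _ ltn).
Qed.

Lemma theta_p : theta p = einv p + p%:R^-1.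
Proof.
rewrite /theta convC /conv big_ord_recr (bigD1 (Ordinal p0)) //= subn0 subnn.
rewrite /expk /stretch dvdn0 div0n dvdnn divnn p0 dvd1n !divn1 /expser einv0 !expr1n !mulr1 mul1r.
rewrite [X in _ + X + _]big1 ?addr0 => [|i]; first by rewrite [einv 1]invr1 mul1r expr1.
by rewrite -val_eqE /= => i0; rewrite gtnNdvd ?mul0r // lt0n.
Qed.

(** The constant term is the p-th derivative of theta at 0, that is p! (1/p! + 1/p) = 1 + (p - 1)!,
    and Wilson applies. *)
Lemma dpol_p0 : (p%:Z %| (dpol p)`_0)%Z.
Proof.
have := theta_dpol p 0; rewrite add0n theta_p /conv big_ord_recl big_ord0 addr0 subnn.
rewrite theta_small // einv0 mulr1 /cf ffactnn mulrDr mulfV ?factr_neq0 //.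
have -> : (p`!%:R * p%:R^-1 : rat) = (p.-1)`!%:R.
  by rewrite -{1}(prednK p0) factS (prednK p0) natrM mulrC mulKf.
rewrite addrC natr1 pmulrn => /eqP; rewrite eqr_int => /eqP <-.
by rewrite dvdzE /= -Wilson.
Qed.

(* Applying d/dx p times to theta multiplies it by an integral polynomial whose
   constant term 1 + (p-1)! is divisible by p: this gains a factor p over the
   trivial bound once every p + 1 steps. *)
Definition theta_bound n := (logn p (n %/ p)`! + n %/ p.+1)%N.

Lemma theta_pint n : pint p (p%:R ^+ theta_bound n * theta n).
Proof.
elim/ltn_ind: n => n IHn; have [ltnp|lepn] := ltnP n p.
  rewrite theta_small //; apply: pintM => //; first by apply: pintX => //; apply: pint_natr.
  by apply: pintV; rewrite // (fact_pfact p_pr) divn_small // expn0 !mul1n pfact_ndvd.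
set m := (n %/ p)%N; have m0 : (0 < m)%N by rewrite divn_gt0.
have eqn : (n = (n - p) + p)%N by rewrite subnK.
have em : ((n - p) %/ p = m.-1)%N.
  by rewrite /m {2}eqn divnDr ?dvdnn // divnn p0 addn1.
(* Among n - p + 1, ..., n a single factor is divisible by p, namely p m. *)
have ffn : ((n ^_ p)%:R : rat) = (p * m)%:R * (pfact p n)%:R / (pfact p (n - p))%:R.
  have w0 : ((pfact p (n - p))%:R : rat) != 0 by rewrite pnatr_eq0 -lt0n pfact_gt0.
  apply: (mulIf w0); rewrite divfK //; apply: (mulIf (factr_neq0 (n - p))).
  apply/eqP; rewrite -!natrM eqr_nat; apply/eqP.
  rewrite mulnAC ffact_fact // [in LHS](fact_pfact p_pr n) [in RHS](fact_pfact p_pr (n - p)) em -/m.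
  by rewrite -{1 2}(prednK m0) factS expnS (prednK m0); ring.
have h := theta_dpol p (n - p); rewrite -eqn ffn in h.
have wn0 : ((pfact p n)%:R : rat) != 0 by rewrite pnatr_eq0 -lt0n pfact_gt0.
have wp0 : ((pfact p (n - p))%:R : rat) != 0 by rewrite pnatr_eq0 -lt0n pfact_gt0.
have mnz : (m%:R : rat) != 0 by rewrite pnatr_eq0 -lt0n.
have {h}-> : theta n = (pfact p (n - p))%:R * (pfact p n)%:R^-1 * m%:R^-1 *
     (p%:R^-1 * conv (cf rat (dpol p)) theta (n - p)).
  by rewrite -h natrM; field; rewrite wn0 wp0 pnz mnz.
set C := p%:R^-1 * _.
have lem : (logn p m + logn p (m.-1)`! = logn p m`!)%N.
  by rewrite -{3}(prednK m0) factS lognM ?fact_gt0 // (prednK m0).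
have lend : ((n - p) %/ p.+1 <= n %/ p.+1)%N by rewrite leq_div2r // leq_subr.
have lebn : (logn p m <= theta_bound n)%N by rewrite /theta_bound -/m -lem -addnA leq_addr.
have -> : p%:R ^+ theta_bound n * ((pfact p (n - p))%:R * (pfact p n)%:R^-1 * m%:R^-1 * C) =
   ((pfact p (n - p))%:R * (pfact p n)%:R^-1) * (p%:R ^+ logn p m / m%:R) *
   (p%:R ^+ (theta_bound n - logn p m) * C).
  by rewrite -{1}(subnK lebn) exprD; ring.
apply: pintM => //; first apply: pintM => //.
- by apply: pintM; rewrite ?pint_natr //; apply: pintV; rewrite ?pfact_ndvd.
- exact: pint_divn.
(* The remaining 1/p is paid by [dpol_p0] in the constant term, and in the others by an index at
   most n - p - 1, which lowers the quotient by p + 1 in [theta_bound] by at least one. *)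
rewrite /C mulrA /conv mulr_sumr big_ord_recl /= subn0; apply: pintD => //.
  have /dvdzP[c ec] := dpol_p0; rewrite /cf ec intrM.
  have -> : p%:R ^+ (theta_bound n - logn p m) / p%:R * (c%:~R * (p%:Z)%:~R * theta (n - p)) =
     c%:~R * (p%:R ^+ (theta_bound n - logn p m) * theta (n - p)) :> rat.
    by rewrite -pmulrn; field.
  apply: pintM; rewrite ?pint_intr //; apply: pint_expn_le (IHn (n - p)%N _) => //; last by lia.
  by rewrite /theta_bound em -/m; lia.
apply: pint_sum => // i _; rewrite /cf mulrCA; apply: pintM; rewrite ?pint_intr //.
have hk : (n - p - bump 0 i + p.+1 <= n)%N.
  by have := ltn_ord i; rewrite /bump leq0n add1n; clear -lepn; lia.
move: (n - p - bump 0 i)%N (leq_subr (bump 0 i) (n - p)) hk => k lek hk.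
have hi : (k < n)%N by apply: leq_trans hk; rewrite addnS ltnS leq_addr.
have le1 : (k %/ p <= m.-1)%N by rewrite -em leq_div2r.
have le2 : ((k %/ p.+1).+1 <= n %/ p.+1)%N.
  have -> : ((k %/ p.+1).+1 = (k + p.+1) %/ p.+1)%N by rewrite divnDr ?dvdnn // divnn addn1.
  by rewrite leq_div2r.
have le3 : (logn p (k %/ p)`! <= logn p (m.-1)`!)%N.
  by rewrite dvdn_leq_log ?fact_gt0 // -(bin_fact le1) mulnCA dvdn_mulr.
have eqb : (theta_bound n - logn p m = (theta_bound n - logn p m).-1.+1)%N.
  move: lem le2 le3; rewrite /theta_bound -/m; move: (logn p m) (logn p (m.-1)`!) (logn p m`!).
  by move: (n %/ p.+1)%N (k %/ p.+1)%N (logn p (k %/ p)`!); clear; lia.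
rewrite eqb exprSr mulfK //; apply: pint_expn_le (IHn k hi) => //.
move: lem le2 le3; rewrite /theta_bound -/m; move: (logn p m) (logn p (m.-1)`!) (logn p m`!).
by move: (n %/ p.+1)%N (k %/ p.+1)%N (logn p (k %/ p)`!); clear; lia.
Qed.

End Decay.

(** * Decay of the coefficients of exp(x - x^q / varpi) *)

Section DworkSeries.
Variables (p : nat) (p_pr : prime p).
Let p0 := prime_gt0 p_pr.
Let p1 := prime_gt1 p_pr.
Let pnz : (p%:R : rat) != 0. Proof. by rewrite pnatr_eq0 -lt0n. Qed.

(* v_p(g n) >= - (1 - 1/K) n / (p - 1), which makes pi^n g_n tend to 0. *)
Definition decay K (g : nat -> rat) :=
  forall n, pint p (p%:R ^+ (((K - 1) * n) %/ (K * (p - 1))) * g n).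

Lemma decay_conv K f g : (0 < K)%N -> decay K f -> decay K g -> decay K (conv f g).
Proof.
move=> K0 df dg n; rewrite /conv mulr_sumr; apply: pint_sum => // i _.
have lein : (i <= n)%N by rewrite -ltnS.
set D := (K * (p - 1))%N; have D0 : (0 < D)%N by rewrite muln_gt0 K0 subn_gt0.
apply: (@pint_expn_le _ p_pr (((K - 1) * i) %/ D + ((K - 1) * (n - i)) %/ D)).
  have -> : ((K - 1) * n = (K - 1) * i + (K - 1) * (n - i))%N by rewrite -mulnDr subnKC.
  by rewrite leq_divRL // mulnDl leq_add // leq_trunc_div.
by rewrite exprD mulrACA; apply: pintM.
Qed.

Lemma decay_le K K' f : (0 < K <= K')%N -> decay K f -> decay K' f.
Proof.
move=> /andP[K0 leK] df n; apply: pint_expn_le (df n) => //.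
have p10 : (0 < p - 1)%N by rewrite subn_gt0.
rewrite leq_divRL ?muln_gt0 ?p10 ?(leq_trans K0) //.
set D := (_ %/ _)%N; have : (D * (K * (p - 1)) <= (K - 1) * n)%N by apply: leq_trunc_div.
move: D => D; rewrite !mulnBl !mul1n => h.
have [m em] : exists m, n = (m + D * (p - 1))%N.
  exists (n - D * (p - 1))%N; rewrite subnK //.
  have : (K * (D * (p - 1)) <= K * n)%N by apply: leq_trans (_ : K * n - n <= _)%N; lia.
  by rewrite leq_pmul2l.
have h1 : (n <= K * m)%N.
  rewrite em mulnDr in h *; have : (K * (D * (p - 1)) = D * (K * (p - 1)))%N by lia.
  nia.
have : (n <= K' * m)%N by apply: leq_trans h1 _; rewrite leq_mul2r leK orbT.
rewrite em mulnDr; lia.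
Qed.

(** Legendre bounds the first part of [theta_bound n] by n / (p (p - 1)), the second is at most n /
    (p + 1). The sum is n (p^2 + 1) / (p (p + 1) (p - 1)), and p^2 + 1 <= K - 1 for K = p (p +
    1). *)
Lemma decay_theta : decay (p * p.+1) (theta p).
Proof.
move=> n; apply: pint_expn_le (theta_pint p_pr n) => //.
have p10 : (0 < p - 1)%N by rewrite subn_gt0.
rewrite leq_divRL ?muln_gt0 ?p0 ?p10 // /theta_bound mulnDl.
have := logn_fact_le p_pr (n %/ p).
have := leq_trunc_div n p; have := leq_trunc_div n p.+1.
move: (n %/ p)%N (n %/ p.+1)%N (logn _ _) => a b c hb ha hc.
have h1 : (c * (p * p.+1 * (p - 1)) <= p.+1 * n)%N.
  by apply: (@leq_trans (p.+1 * (a * p))); [nia | rewrite leq_mul2l ha orbT].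
have h2 : (b * (p * p.+1 * (p - 1)) <= p * (p - 1) * n)%N.
  by apply: (@leq_trans (p * (p - 1) * (b * p.+1))); [nia | rewrite leq_mul2l hb orbT].
apply: leq_trans (leq_add h1 h2) _; rewrite -mulnDl leq_mul2r; apply/orP; right.
nia.
Qed.

Fixpoint repunit r := if r is r'.+1 then (p * repunit r').+1 else 0%N.

Lemma repunitE r : ((p - 1) * repunit r = p ^ r - 1)%N.
Proof.
elim: r => [|r IHr]; first by rewrite muln0.
rewrite [repunit _]/= mulnS mulnCA IHr expnS.
have : (0 < p ^ r)%N by rewrite expn_gt0 p0.
move: (p ^ r)%N => P; nia.
Qed.

Definition varpi r : rat := (- p%:R) ^+ repunit r.

Lemma varpi_neq0 r : varpi r != 0.
Proof. by rewrite expf_neq0 // oppr_eq0. Qed.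

Lemma varpiS r : varpi r.+1 = - p%:R * varpi r ^+ p.
Proof. by rewrite /varpi /= exprS mulnC exprM. Qed.

(* exp(x - x^q / varpi), which becomes exp(pi (x - x^q)) after x := pi x, because
   varpi = pi^(q-1). It is a product of rescaled series theta(x^(p^i)). *)
Definition dwork r := conv (expk einv 1 1) (expk einv (p ^ r) (- (varpi r)^-1)).

Lemma expk_stretch (e : nat -> rat) k l s : (0 < k)%N -> (0 < l)%N ->
  expk e (k * l) s =1 stretch k (expk e l s).
Proof.
move=> k0 l0 n; rewrite /expk /stretch; case: (boolP (k %| n)%N) => [/dvdnP[m ->]|kn].
  by rewrite [(m * k)%N]mulnC dvdn_pmul2l // !mulKn // divnMl.
case: ifP => // kln; case/negP: kn; apply: dvdn_trans kln; exact: dvdn_mulr.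
Qed.

Lemma expk0 k : (0 < k)%N -> expk einv k 0 =1 mono 1 0.
Proof.
move=> k0 n; rewrite /expk /stretch /expser /mono; case: n => [|n] /=.
  by rewrite dvdn0 div0n einv0 expr0 mulr1.
case: ifP => // /dvdnP[[|j]] // ->; by rewrite mulnK // expr0n mulr0.
Qed.

Lemma theta_scale s m :
  conv (expk einv 1 s) (expk einv p (s ^+ p / p%:R)) m = s ^+ m * theta p m.
Proof.
rewrite /theta /conv mulr_sumr; apply: eq_bigr => i _.
have lein : (i <= m)%N by rewrite -ltnS.
have -> : s ^+ m = s ^+ i * s ^+ (m - i) by rewrite -exprD subnKC.
rewrite mulrACA /expk /stretch dvd1n divn1 /expser expr1n mulr1.
rewrite [s ^+ i * _]mulrC; congr (_ * _).
case: ifP => [/dvdnP[j ->]|_]; last by rewrite mulr0.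
by rewrite mulnK // exprMn -exprM [(p * j)%N]mulnC; ring.
Qed.

(** The second factor is exp(x^q / varpi) times the new exponential in x^(p q), because varpi for r
    + 1 is - p varpi^p; the two exponentials in x^q then cancel. *)
Lemma dworkS r : dwork r.+1 =1
  conv (dwork r) (stretch (p ^ r) (fun m => (varpi r)^-1 ^+ m * theta p m)).
Proof.
move=> n; have pr0 : (0 < p ^ r)%N by rewrite expn_gt0 p0.
set s := (varpi r)^-1.
have e1 : expk einv (p ^ r.+1) (- (varpi r.+1)^-1) =1 stretch (p ^ r) (expk einv p (s ^+ p / p%:R)).
  move=> m; rewrite expnSr expk_stretch // varpiS /s; congr (stretch _ (expk _ _ _) _).
  by rewrite exprVn invfM invrN mulNr opprK mulrC.
have e2 : expk einv (p ^ r) s =1 stretch (p ^ r) (expk einv 1 s).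
  by move=> m; rewrite -expk_stretch // muln1.
have e3 : stretch (p ^ r) (fun m => s ^+ m * theta p m) =1
    conv (expk einv (p ^ r) s) (expk einv (p ^ r.+1) (- (varpi r.+1)^-1)).
  move=> m; rewrite (eq_conv e2 e1) conv_stretch // /stretch; case: ifP => // _.
  by rewrite theta_scale.
rewrite (eq_conv (frefl _) e3) /dwork -convA.
rewrite (eq_conv (frefl _) (convA _ _ _)).
rewrite (eq_conv (frefl _) (eq_conv (fun m => expkD einvM _ _ pr0 m) (frefl _))) addNr.
rewrite (eq_conv (frefl _) (eq_conv (expk0 pr0) (frefl _))).
by apply: eq_conv => // m; rewrite conv_mono leq0n mul1r subn0.
Qed.

(** At index q m the new factor loses (q - 1) m / (p - 1) through varpi^(-m) and (1 - 1/K) m / (p -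
    1) through theta, with K = p (p + 1). Together this is (1 - 1/(K q)) q m / (p - 1), so the
    constant grows with q. *)
Lemma decay_dwork r : decay (p * p.+1 * p ^ r) (dwork r).
Proof.
have K0 : (0 < p * p.+1)%N by rewrite muln_gt0 p0.
elim: r => [|r IHr] n.
  rewrite /dwork /varpi expr0 invr1 expn0 (expkD einvM) // subrr.
  rewrite expk0 // /mono; case: eqP => [->|_]; last by rewrite mulr0 pint0.
  by rewrite muln0 div0n mulr1 pint1.
rewrite dworkS; have pr0 : (0 < p ^ r)%N by rewrite expn_gt0 p0.
apply: (@decay_le (p * p.+1 * p ^ r)).
  by rewrite muln_gt0 K0 pr0 leq_mul2l leq_exp2l // leqnSn orbT.
apply: decay_conv => [|//|{}n]; first by rewrite muln_gt0 K0 pr0.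
rewrite /stretch; case: ifP => [/dvdnP[m ->]|_]; last by rewrite mulr0 pint0.
rewrite mulnK // mulrA.
have -> : forall e, p%:R ^+ e * (varpi r)^-1 ^+ m * theta p m =
   (p%:R ^+ e / p%:R ^+ (repunit r * m)) * ((-1) ^+ (repunit r * m) * theta p m) :> rat.
  move=> e; rewrite /varpi exprVn -exprM (exprNn p%:R) invfM.
  by rewrite -[((-1) ^+ _)^-1]exprVn invrN1; ring.
have hexp := decay_theta m; set e0 := (_ %/ _)%N in hexp.
set e := (_ %/ _)%N.
have le : (repunit r * m + e0 <= e)%N.
  rewrite /e leq_divRL; last by rewrite !muln_gt0 p0 pr0 subn_gt0.
  have : (e0 * (p * p.+1 * (p - 1)) <= (p * p.+1 - 1) * m)%N by apply: leq_trunc_div.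
  move: e0 {hexp} => e0; have := repunitE r; move: (p * p.+1)%N K0 (p ^ r)%N pr0 (repunit r).
  clear e; move=> K K0 P P0 R hR h.
  have e1 : ((R * m + e0) * (K * P * (p - 1)) = K * P * m * ((p - 1) * R) + P * (e0 * (K * (p - 1))))%N by ring.
  rewrite e1 hR; have h2 : (P * (e0 * (K * (p - 1))) <= P * ((K - 1) * m))%N by rewrite leq_mul2l h orbT.
  apply: leq_trans (leq_add (leqnn _) h2) _.
  have [K' eK] : exists K', K = K'.+1 by exists K.-1; lia.
  have [P' eP] : exists P', P = P'.+1 by exists P.-1; lia.
  have -> : (K * P - 1 = K' * P' + K' + P')%N by rewrite eK eP; lia.
  have -> : (K - 1 = K')%N by lia.
  have -> : (P - 1 = P')%N by lia.
  by rewrite eK eP; apply/eq_leq; ring.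
have -> : p%:R ^+ e = p%:R ^+ (e - (repunit r * m + e0)) * p%:R ^+ e0 * p%:R ^+ (repunit r * m) :> rat.
  by rewrite -!exprD -addnA [(e0 + _)%N]addnC subnK.
rewrite mulfK ?expf_neq0 // -mulrA; apply: pintM => //; first by apply: pintX => //; apply: pint_natr.
by rewrite mulrCA; apply: pintM => //; apply: pint_sign.
Qed.
End DworkSeries.

(** * The trace of Dwork's operator *)

Section TraceIdentity.
Variables (p : nat) (p_pr : prime p) (r a : nat).
Let p0 := prime_gt0 p_pr.
Let p1 := prime_gt1 p_pr.
Let pnz : (p%:R : rat) != 0. Proof. by rewrite pnatr_eq0 -lt0n. Qed.
Local Notation q := (p ^ r)%N.
Local Notation f := (dwork p r).
Local Notation w_ := (varpi p r).
Let q0 : (0 < q)%N. Proof. by rewrite expn_gt0 p0. Qed.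
Let wnz : w_ != 0. Proof. exact: varpi_neq0. Qed.

(** Coefficients of F' = (1 - q x^(q-1) / varpi) F for F = exp(x - x^q / varpi). *)
Lemma dwork_rec n :
  n.+1%:R * f n.+1 = f n - (if (q <= n.+1)%N then q%:R / w_ * f (n.+1 - q)%N else 0).
Proof.
have -> : n.+1%:R * f n.+1 = dser f n by [].
rewrite /dwork dser_conv (eq_conv (fun m => @dser_expk 1 1 m isT) (frefl _)).
rewrite (eq_conv (frefl _) (fun m => @dser_expk q (- w_^-1) m q0)).
rewrite -convA [X in _ + X]convCA !conv_mono leq0n subn0 !mul1r -/(dwork p r); congr (_ + _).
rewrite -ltnS (prednK q0); case: ifP => // leq.
by rewrite mulrN mulNr; congr (- (_ * f _)); lia.
Qed.

(** Matrix, in the basis x^u, of: multiply by x^(-a) exp(x - x^q / varpi), keep the exponents q n,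
    replace x^(q n) by varpi^n x^n. The diagonal holds the coefficients occurring in the Gauss sum.
    For u <= n, the range in use, the truncated subtraction is exact. *)
Definition phi n u := w_ ^+ n * f (a + q * n - u)%N.

Variable M : nat.
Local Notation eta := ((a + (q - 1) * M)%N%:R : rat).

(** Commutation, up to the factor q, with the bidiagonal operator D that sends x^w to (w - M) x^w +
    x^(w+1), a twist of x d/dx + x. The defect eta vanishes only at M = - a / (q - 1). *)
Lemma phi_rec n w : (w <= n)%N -> (0 < a)%N ->
  (w%:R - M%:R) * phi n.+1 w + phi n.+1 w.+1 =
  q%:R * ((n.+1%:R - M%:R) * phi n.+1 w + phi n w) + eta * phi n.+1 w.
Proof.
move=> lewn a0.
have e : (a + q * n.+1 - w = (a + q * n.+1 - w.+1).+1)%N by nia.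
have h := dwork_rec (a + q * n.+1 - w.+1); rewrite -e in h.
have leq : (q <= a + q * n.+1 - w)%N by nia.
rewrite leq in h.
have eq : (a + q * n.+1 - w - q = a + q * n - w)%N by nia.
rewrite eq in h.
have ew : ((a + q * n.+1 - w)%N%:R : rat) = a%:R + q%:R * n.+1%:R - w%:R.
  by rewrite natrB ?natrD ?natrM //; nia.
rewrite ew in h.
have h2 : w_ ^+ n.+1 * ((a%:R + q%:R * n.+1%:R - w%:R) * f (a + q * n.+1 - w)) =
  phi n.+1 w.+1 - q%:R * phi n w by rewrite h /phi exprS; field.
have -> : phi n.+1 w.+1 = q%:R * phi n w +
   w_ ^+ n.+1 * ((a%:R + q%:R * n.+1%:R - w%:R) * f (a + q * n.+1 - w)) by rewrite h2; ring.
rewrite natrD natrM natrB //; rewrite /phi; ring.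
Qed.

(** Modulo the image of D, x^(v+1) is congruent to (M - v) x^v, so every x^u is a multiple of the
    class of 1. These products are the coefficients of that reduction, and [ysum] is the preimage
    under D that it produces. *)
Definition sker w u : rat := \prod_(w.+1 <= v < u) (M%:R - v%:R).
Definition ysum n u := \sum_(0 <= w < u) phi n w * sker w u.

Lemma skerS w u : (w < u)%N -> sker w u.+1 = sker w u * (M%:R - u%:R).
Proof. by move=> lt; rewrite /sker big_nat_recr. Qed.

Lemma skerSn u : sker u u.+1 = 1.
Proof. by rewrite /sker big_geq. Qed.

Lemma sum_skerS (g : nat -> rat) u : \sum_(0 <= w < u.+1) g w * sker w u.+1 =
  g u + (M%:R - u%:R) * \sum_(0 <= w < u) g w * sker w u.
Proof.
rewrite big_nat_recr //= skerSn mulr1 addrC; congr (_ + _).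
rewrite mulr_sumr; apply: eq_big_nat => w /andP[_ lt]; rewrite skerS //; ring.
Qed.

Lemma ysumS n u : ysum n u.+1 = phi n u + (M%:R - u%:R) * ysum n u.
Proof. exact: sum_skerS. Qed.

Lemma sker_telescope n u :
  \sum_(0 <= w < u) ((w%:R - M%:R) * phi n w + phi n w.+1) * sker w u =
  phi n u - (\prod_(0 <= v < u) (M%:R - v%:R)) * phi n 0.
Proof.
elim: u => [|u IHu]; first by rewrite !big_geq // mul1r subrr.
rewrite (sum_skerS (fun w => (w%:R - M%:R) * phi n w + phi n w.+1)) IHu big_nat_recr //=; ring.
Qed.

(* The left-hand side is the truncated trace of the operator with matrix phi. The
   two error terms vanish p-adically: the first as L grows, the second because
   eta = a q^k is highly divisible by p. *)
Lemma trace_identity L : (0 < a)%N ->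
  (1 - q%:R) * \sum_(0 <= u < L.+1) phi u u =
  \sum_(0 <= u < L.+1) (\prod_(0 <= v < u) (M%:R - v%:R)) * phi u 0
  - q%:R * ysum L L.+1 + eta * \sum_(0 <= u < L.+1) ysum u u.
Proof.
move=> a0; elim: L => [|L IHL].
  rewrite !big_nat1 ysumS {1}/ysum !big_geq // {1}/ysum big_geq //; ring.
(* Row L + 1 of the commutation relation summed against [sker]: the q-part moves the boundary term
   from L to L + 1, the eta-part enters the second error term. *)
have h := sker_telescope L.+1 L.+1.
rewrite (eq_big_nat _ _ (F2 := fun w => q%:R * ((L.+1%:R - M%:R) * (phi L.+1 w * sker w L.+1)
     + phi L w * sker w L.+1) + eta * (phi L.+1 w * sker w L.+1))) in h; last first.
  by move=> w /andP[_ lt]; rewrite phi_rec //; ring.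
rewrite big_split /= -!mulr_sumr big_split /= -mulr_sumr -/(ysum _ _) -/(ysum L L.+1) in h.
rewrite !(big_nat_recr L.+1) //= mulrDr IHL [ysum L.+1 L.+2]ysumS.
have {h} h : phi L.+1 L.+1 = (\prod_(0 <= v < L.+1) (M%:R - v%:R)) * phi L.+1 0 +
  (q%:R * ((L.+1%:R - M%:R) * ysum L.+1 L.+1 + ysum L L.+1) + eta * ysum L.+1 L.+1).
  by rewrite h; ring.
rewrite mulrBl mul1r {1}h; ring.
Qed.

Lemma falling_prod u : \prod_(0 <= v < u) (M%:R - v%:R) = (M ^_ u)%:R :> rat.
Proof.
elim: u => [|u IHu]; first by rewrite big_geq.
rewrite big_nat_recr //= IHu ffactnSr natrM; have [leu|ltM] := leqP u M.
  by rewrite natrB.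
by rewrite ffact_small // !mul0r.
Qed.

Lemma sum_stretch_rem (g : nat -> rat) k m b : (b < k)%N ->
  \sum_(i < (k * m + b).+1) stretch k g i = \sum_(i < m.+1) g i.
Proof.
move=> ltb; have k0 : (0 < k)%N by apply: leq_ltn_trans ltb.
rewrite -[RHS](@sum_stretch _ k) // -!(big_mkord xpredT (stretch k g)).
rewrite (big_cat_nat (n := (k * m).+1)) //=; last by rewrite ltnS leq_addr.
rewrite [X in _ + X]big_nat_cond [X in _ + X]big1 ?addr0 // => i.
rewrite andbT => /andP[lt1 lt2]; rewrite /stretch; case: ifP => // /dvdnP[j ej].
have ltmj : (m < j)%N by rewrite -(ltn_pmul2r k0); lia.
have ltjm : (j < m.+1)%N by rewrite -(ltn_pmul2r k0); lia.
by lia.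
Qed.

Lemma dwork_undo n : conv f (expk einv q w_^-1) n = einv n.
Proof.
rewrite /dwork -convA (eq_conv (frefl _) (fun m => expkD einvM _ _ q0 m)) addNr.
rewrite (eq_conv (frefl _) (expk0 q0)) convC conv_mono leq0n mul1r subn0.
by rewrite /expk /stretch dvd1n divn1 /expser expr1n mulr1.
Qed.

(** The falling factorial is M! / (M - u)!, so the sum is M! varpi^M times the coefficient of x^(q M
    + a) in F exp(x^q / varpi) = exp(x). The bound a < q ensures that every exponent q j up to q M +
    a has j <= M. *)
Lemma trace_main_term L : (a < q)%N -> (M <= L)%N ->
  \sum_(0 <= u < L.+1) (\prod_(0 <= v < u) (M%:R - v%:R)) * phi u 0 =
  M`!%:R * w_ ^+ M / (q * M + a)`!%:R.
Proof.
move=> ltaq leML.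
rewrite (big_cat_nat (n := M.+1)) //= [X in _ + X]big_nat_cond [X in _ + X]big1 ?addr0; last first.
  by move=> u; rewrite andbT => /andP[ltM _]; rewrite falling_prod ffact_small // mul0r.
have -> : (q * M + a)`!%:R^-1 = einv (q * M + a) by [].
rewrite -dwork_undo convC /conv.
transitivity (M`!%:R * w_ ^+ M * \sum_(i < (q * M + a).+1)
   stretch q (fun j => einv j * w_^-1 ^+ j * f (q * M + a - q * j)%N) i).
  rewrite sum_stretch_rem // mulr_sumr (reindex_inj rev_ord_inj) /= big_mkord.
  apply: eq_bigr => u _; rewrite falling_prod subSS.
  have leu : (u <= M)%N by rewrite -ltnS.
  rewrite /phi subn0 mulnBr.
  have -> : (q * M + a - (q * M - q * u) = a + q * u)%N.
    have : (q * u <= q * M)%N by rewrite leq_mul2l leu orbT.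
    by move: (q * u)%N (q * M)%N; lia.
  have -> : w_ ^+ M = w_ ^+ u * w_ ^+ (M - u) by rewrite -exprD subnKC.
  rewrite /einv -(ffact_fact leu) natrM exprVn; field.
  by rewrite expf_neq0 // factr_neq0.
congr (_ * _); apply: eq_bigr => i _; rewrite /expk /stretch /expser.
by case: ifP => [/dvdnP[j ->]|_]; rewrite ?mul0r // mulnK // [(j * q)%N]mulnC.
Qed.

End TraceIdentity.

(** * p-adic size of the error terms in the trace identity *)

Section TraceBound.
Variables (p : nat) (p_pr : prime p) (r a : nat) (r_gt0 : (0 < r)%N).
Let p0 := prime_gt0 p_pr.
Let p1 := prime_gt1 p_pr.
Let pnz : (p%:R : rat) != 0. Proof. by rewrite pnatr_eq0 -lt0n. Qed.
Local Notation q := (p ^ r)%N.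
Local Notation f := (dwork p r).
Local Notation w_ := (varpi p r).
Local Notation K := (p * p.+1 * p ^ r)%N.
Local Notation C := (a + 1 + K)%N.

(** The part (q - 1) u of the index costs less than the power of p in varpi^u, by a margin growing
    with u. The cost of m is met by (m - 1)! through [logn_fact_ge] with t = K, chosen because p^K >
    K. What remains is the constant C, independent of u and m. *)
Lemma term_exponent u m :
  (((K - 1) * (a + (q - 1) * u + m)) %/ (K * (p - 1)) + u %/ (K * (p - 1))
   <= C + (repunit p r * u + logn p (m.-1)`!))%N.
Proof.
have K0 : (0 < K)%N by rewrite !muln_gt0 p0 expn_gt0 p0.
have q1 : (1 < q)%N by rewrite -(expn0 p) ltn_exp2l.
have hR := repunitE p_pr r; have hv := logn_fact_ge p_pr K m.-1.
have hP : (K < p ^ K)%N by apply: ltn_expl.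
move: (p ^ K)%N hP hv => P hP hv; move: (logn p _) hv => v hv.
move: (repunit p r) hR => R hR; move: K0 q1 hP hv hR; move: K => k; move: q => Q K0 Q1 hP hv hR.
have p10 : (0 < p - 1)%N by rewrite subn_gt0.
have D0 : (0 < k * (p - 1))%N by rewrite muln_gt0 K0.
rewrite -(leq_pmul2r D0) mulnDl.
apply: leq_trans (leq_add (leq_trunc_div _ _) (leq_trunc_div _ _)) _.
have h1 : ((k - 1) * m.-1 <= k * (p - 1) * v + k * k * (p - 1))%N.
  rewrite -(@leq_pmul2l P); last by apply: leq_ltn_trans hP.
  have h2 : (k * ((P - 1) * m.-1) <= k * (P * ((p - 1) * v + k * (p - 1))))%N.
    by rewrite leq_mul2l hv orbT.
  apply: (@leq_trans (k * ((P - 1) * m.-1))).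
    rewrite !mulnA leq_mul2r; apply/orP; right; rewrite !mulnBr !muln1 mulnC.
    by apply: leq_sub2l; apply: ltnW.
  by apply: leq_trans h2 _; apply/eq_leq; ring.
have h3 : ((k - 1) * (a + (Q - 1) * u + m) <= k * a + k + (k - 1) * m.-1 + (k - 1) * ((Q - 1) * u))%N.
  have : (m <= m.-1 + 1)%N by rewrite addn1 leqSpred.
  move: (m.-1) ((Q - 1) * u)%N => m' X hm.
  have : ((k - 1) * (a + X + m) <= (k - 1) * (a + X + (m' + 1)))%N by rewrite leq_mul2l leq_add2l hm orbT.
  move=> /leq_trans; apply; rewrite !mulnDr.
  have : ((k - 1) * a <= k * a)%N by rewrite leq_mul2r leq_subr orbT.
  lia.
have h4 : (u + (k - 1) * ((Q - 1) * u) <= k * ((Q - 1) * u))%N.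
  have : (u <= (Q - 1) * u)%N by rewrite leq_pmull // subn_gt0.
  move: ((Q - 1) * u)%N => X hX; have -> : (k = (k - 1) + 1)%N by lia.
  by rewrite addnK mulnDl mul1n addnC leq_add2l.
have -> : ((a + 1 + k + (R * u + v)) * (k * (p - 1)) =
   k * a * (p - 1) + k * (p - 1) + k * k * (p - 1) + k * ((p - 1) * R * u) + k * (p - 1) * v)%N by ring.
rewrite hR; have h5 : (k * a <= k * a * (p - 1))%N by rewrite leq_pmulr.
have h6 : (k <= k * (p - 1))%N by rewrite leq_pmulr.
move: h1 h3 h4 h5 h6; clear; lia.
Qed.

Lemma term_bound u m :
  pint p (p%:R ^+ C * (w_ ^+ u * f (a + (q - 1) * u + m)%N * (m.-1)`!%:R) /
          p%:R ^+ (u %/ (K * (p - 1)))).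
Proof.
have hf := decay_dwork p_pr r (a + (q - 1) * u + m)%N; have le := term_exponent u m.
move: (_ %/ _)%N (_ %/ _)%N hf le => e2 e1 hf le.
have [c [_ ec]] := natr_logn p_pr (fact_gt0 m.-1).
rewrite ec natrM natrX /varpi -exprM (exprNn p%:R); move: (logn p _) le => v le.
have -> : p%:R ^+ C * ((-1) ^+ (repunit p r * u) * p%:R ^+ (repunit p r * u) *
   f (a + (q - 1) * u + m)%N * (p%:R ^+ v * c%:R)) / p%:R ^+ e2 =
   (-1) ^+ (repunit p r * u) * c%:R *
   (p%:R ^+ (C + (repunit p r * u + v) - (e1 + e2)) * (p%:R ^+ e1 * f (a + (q - 1) * u + m)%N)).
  have e3 : p%:R ^+ C * (p%:R ^+ (repunit p r * u) * p%:R ^+ v) =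
     p%:R ^+ (C + (repunit p r * u + v) - (e1 + e2)) * (p%:R ^+ e1 * p%:R ^+ e2) :> rat.
    by rewrite -!exprD subnK.
  apply: (mulIf (expf_neq0 e2 pnz)); rewrite mulfVK ?expf_neq0 //.
  transitivity ((-1) ^+ (repunit p r * u) * c%:R * f (a + (q - 1) * u + m)%N *
     (p%:R ^+ C * (p%:R ^+ (repunit p r * u) * p%:R ^+ v))); first by ring.
  by rewrite e3; ring.
apply: pintM => //; first by apply: pintM; rewrite ?pint_natr ?pint_sign.
by apply: pintM => //; apply: pintX => //; apply: pint_natr.
Qed.

(** A product of u - w - 1 consecutive integers, which are positive, contain 0 or are negative
    according to the position of M. The factorial compensates denominators in [term_bound]. *)
Lemma sker_fact M w u : (w < u)%N -> exists z : int, sker M w u = (u - w.+1)`!%:R * z%:~R.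
Proof.
move=> lt; rewrite /sker; have [leu|ltM] := leqP u M.
  exists 'C(M - w.+1, u - w.+1)%:Z; rewrite -pmulrn -natrM mulnC bin_ffact.
  have -> : \prod_(w.+1 <= v < u) (M%:R - v%:R : rat) = \prod_(0 <= v < u - w.+1) ((M - w.+1)%N%:R - v%:R).
    rewrite -{1}[w.+1]add0n big_addn; apply: eq_big_nat => v /andP[_ ltv].
    by rewrite natrB ?natrD ?opprD ?addrA 1?addrAC // (leq_trans lt).
  exact: falling_prod.
have [ltwM|leMw] := ltnP w M.
  exists 0; rewrite mulr0 big_nat_cond; apply/eqP; rewrite prodf_seq_eq0; apply/hasP.
  by exists M; rewrite ?mem_index_iota ?ltwM ?ltM ?subrr ?eqxx.
exists ((-1) ^+ (u - w.+1) * 'C(u - 1 - M, u - w.+1)%:Z).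
rewrite intrM -pmulrn mulrCA -natrM [(_`! * _)%N]mulnC bin_ffact -falling_prod.
rewrite intr_sign.
have -> : \prod_(w.+1 <= v < u) (M%:R - v%:R : rat) = \prod_(0 <= v < u - w.+1) (M%:R - (v + w.+1)%N%:R).
  by rewrite -{1}[w.+1]add0n big_addn.
have -> : (-1 : rat) ^+ (u - w.+1) = \prod_(0 <= v < u - w.+1) -1.
  by rewrite prodr_const_nat subn0.
rewrite -big_split /= big_nat_rev /=; apply: eq_big_nat => v /andP[_ ltv].
rewrite add0n natrB; last by lia.
rewrite mulN1r opprB natrB; last by lia.
have -> : (u - w.+1 - v.+1 + w.+1 = u - 1 - v)%N by lia.
by rewrite !natrB; first ring; lia.
Qed.

Lemma ysum_diag_bound M u : pint p (p%:R ^+ C * ysum p r a M u u).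
Proof.
rewrite /ysum mulr_sumr big_nat_cond; apply: pint_sum => // w; rewrite andbT => /andP[_ lt].
have [z ->] := sker_fact M lt; rewrite /phi.
have -> : (a + q * u - w = a + (q - 1) * u + (u - w))%N.
  have -> : (q * u = (q - 1) * u + u)%N by rewrite mulnBl mul1n subnK // leq_pmull // expn_gt0 p0.
  by rewrite addnA addnBA //; lia.
have -> : (u - w.+1 = (u - w).-1)%N by lia.
have h := term_bound u (u - w)%N; move: (_ %/ _)%N h => e h.
have -> : p%:R ^+ C * (w_ ^+ u * f (a + (q - 1) * u + (u - w))%N * ((u - w).-1`!%:R * z%:~R)) =
   p%:R ^+ e * z%:~R * (p%:R ^+ C * (w_ ^+ u * f (a + (q - 1) * u + (u - w))%N * (u - w).-1`!%:R) / p%:R ^+ e).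
  by field; rewrite ?expf_neq0.
by do !apply: pintM => //; rewrite ?pint_intr //; apply: pintX => //; apply: pint_natr.
Qed.

Lemma ysum_last_bound M L :
  pint p (p%:R ^+ C * ysum p r a M L L.+1 / p%:R ^+ (L %/ (K * (p - 1)))).
Proof.
rewrite /ysum mulr_sumr mulr_suml big_nat_cond; apply: pint_sum => // w; rewrite andbT => /andP[_ lt].
have [z ->] := sker_fact M lt; rewrite /phi.
have -> : (a + q * L - w = a + (q - 1) * L + (L - w))%N.
  have -> : (q * L = (q - 1) * L + L)%N by rewrite mulnBl mul1n subnK // leq_pmull // expn_gt0 p0.
  by rewrite addnA addnBA //; lia.
rewrite subSS; have h := term_bound L (L - w)%N; move: (_ %/ _)%N h => e h.
(* [term_bound] asks for (L - w - 1)! only; for w = L the truncated predecessor makes both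
   factorials 1. *)
have [k ek] : exists k, (L - w)`! = (k * (L - w).-1`!)%N.
  by case: (L - w)%N => [|m]; [exists 1%N | exists m.+1; rewrite factS].
rewrite ek natrM.
have -> : p%:R ^+ C * (w_ ^+ L * f (a + (q - 1) * L + (L - w))%N * (k%:R * (L - w).-1`!%:R * z%:~R)) / p%:R ^+ e =
   k%:R * z%:~R * (p%:R ^+ C * (w_ ^+ L * f (a + (q - 1) * L + (L - w))%N * (L - w).-1`!%:R) / p%:R ^+ e).
  by ring.
by do !apply: pintM => //; rewrite ?pint_intr ?pint_natr.
Qed.

Lemma trace_limit B : (0 < a < q)%N -> exists k0, forall k M, (k0 <= k)%N ->
    (a + (q - 1) * M = a * q ^ k)%N ->
  exists L0, forall L, (L0 <= L)%N ->
  pint p (((1 - q%:R) * \sum_(0 <= u < L.+1) phi p r a u u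
           - M`!%:R * w_ ^+ M / (q * M + a)`!%:R) / p%:R ^+ B).
Proof.
(* This k0 makes eta = a q^k divisible by p^(B + C), C bounding all denominators. Below, L is at
   least M to complete the main sum, and the multiple of K (p - 1) makes the boundary term divisible
   by p^B. *)
move=> /andP[a0 aq]; exists (B + C)%N => k M lek eM.
exists (M + (B + C) * (K * (p - 1)))%N => L leL.
rewrite (trace_identity p_pr r M L a0) trace_main_term //; last by apply: leq_trans leL; rewrite leq_addr.
have D0 : (0 < K * (p - 1))%N by rewrite !muln_gt0 p0 expn_gt0 p0 subn_gt0.
have h1 : (B + C <= L %/ (K * (p - 1)))%N by rewrite leq_divRL // (leq_trans _ leL) // leq_addl.
have h2 := ysum_last_bound M L; move: (_ %/ _)%N h1 h2 => e h1 h2.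
rewrite -(subnK h1) in h2; move: (e - _)%N h2 => e' h2.
rewrite eM; set Ys := \sum_(_ <= u < _) ysum _ _ _ _ _ _.
have h3 : pint p (p%:R ^+ C * Ys) by rewrite /Ys mulr_sumr; apply: pint_sum => // u _; apply: ysum_diag_bound.
have lek2 : (B + C <= r * k)%N by rewrite (leq_trans lek) // leq_pmull.
set X := M`!%:R * _ / _; set Y := ysum _ _ _ _ _ _ in h2 *.
have -> : (X - q%:R * Y + (a * q ^ k)%:R * Ys - X) / p%:R ^+ B =
  - (q%:R * p%:R ^+ e' * (p%:R ^+ C * Y / p%:R ^+ (e' + (B + C)))) +
  (a%:R * p%:R ^+ (r * k - (B + C)) * (p%:R ^+ C * Ys)).
  have -> : ((a * q ^ k)%:R : rat) = a%:R * p%:R ^+ (r * k - (B + C)) * (p%:R ^+ B * p%:R ^+ C).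
    by rewrite natrM -expnM natrX -mulrA -!exprD subnK.
  by rewrite (exprD _ e') (exprD _ B); field; rewrite ?expf_neq0 ?pnz ?andbT // ?expf_neq0.
apply: pintD => //; first apply: pintN => //.
  by do !apply: pintM => //; rewrite ?pint_natr //; apply: pintX => //; apply: pint_natr.
by do !apply: pintM => //; rewrite ?pint_natr //; apply: pintX => //; apply: pint_natr.
Qed.
End TraceBound.

(** * Gauss and Jacobi sums *)

Section GaussSum.
Variables (p : nat) (p_pr : prime p) (r N : nat) (r_gt0 : (0 < r)%N).
Local Notation q := (p ^ r)%N.
Variables (F : finFieldType) (cardF : #|F| = q).
Variables (A : comNzRingType) (iota : {rmorphism 'Z_(p ^ N.+1) -> A}).
Variables (pi : A) (piE : pi ^+ (p - 1) = - p%:R).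
Variable om : F -> A.
Hypotheses (om0 : om 0 = 0) (om1 : om 1 = 1) (omM : {morph om : x y / x * y}).
Hypothesis omD : forall x y, exists c, om (x + y) = om x + om y + p%:R * c.

Let p0 := prime_gt0 p_pr.
Let p1 := prime_gt1 p_pr.
Let p10 : (0 < p - 1)%N. Proof. by rewrite subn_gt0. Qed.
Let pnz : (p%:R : rat) != 0. Proof. by rewrite pnatr_eq0 -lt0n. Qed.
Let q0 : (0 < q)%N. Proof. by rewrite expn_gt0 p0. Qed.
Let q1 : (1 < q)%N. Proof. by rewrite -(expn0 p) ltn_exp2l. Qed.

Lemma iota_natr n : iota n%:R = n%:R.
Proof. exact: rmorph_nat. Qed.

Lemma A_p0 : (p%:R : A) ^+ N.+1 = 0.
Proof. by rewrite -iota_natr -rmorphXn Zpn_p0 // rmorph0. Qed.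

Definition evint n (x : rat) := pint p ((- p%:R) ^+ (n %/ (p - 1)) * x).
(* pi^n x, which makes sense as soon as the valuation of x is at least - n/(p-1)
   rounded towards 0. *)
Definition ev n (x : rat) : A :=
  pi ^+ (n %% (p - 1)) * iota (zmodp p N ((- p%:R) ^+ (n %/ (p - 1)) * x)).

Let pint_Np k : pint p ((- p%:R) ^+ k).
Proof. by apply: pintX => //; apply: pintN => //; apply: pint_natr. Qed.

Let zmodp_Np k : iota (zmodp p N ((- p%:R) ^+ k)) = (- p%:R) ^+ k.
Proof.
rewrite zmodpX ?zmodpN ?zmodp_natr ?pint_natr ?rmorphXn ?rmorphN ?iota_natr //.
by apply: pintN => //; apply: pint_natr.
Qed.

Lemma evint_sum n (I : Type) (s : seq I) (P : pred I) (G : I -> rat) :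
  (forall i, P i -> evint n (G i)) -> evint n (\sum_(i <- s | P i) G i).
Proof. by move=> h; rewrite /evint mulr_sumr; apply: pint_sum. Qed.

Lemma ev_sum n (I : Type) (s : seq I) (P : pred I) (G : I -> rat) :
  (forall i, P i -> evint n (G i)) ->
  ev n (\sum_(i <- s | P i) G i) = \sum_(i <- s | P i) ev n (G i).
Proof. by move=> h; rewrite /ev mulr_sumr zmodp_sum // rmorph_sum mulr_sumr. Qed.

Lemma evint_pint n x y : pint p x -> evint n y -> evint n (x * y).
Proof. by move=> hx hy; rewrite /evint mulrCA; apply: pintM. Qed.

Lemma ev_pint n x y : pint p x -> evint n y -> ev n (x * y) = iota (zmodp p N x) * ev n y.
Proof. by move=> hx hy; rewrite /ev mulrCA zmodpM // rmorphM mulrCA. Qed.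

Let divmodD i j : let c := ((i %% (p - 1) + j %% (p - 1)) %/ (p - 1))%N in
  ((i + j) %/ (p - 1) = i %/ (p - 1) + j %/ (p - 1) + c)%N /\
  (i %% (p - 1) + j %% (p - 1) = (i + j) %% (p - 1) + (p - 1) * c)%N.
Proof.
move=> c; have := p10; rewrite {}/c; move: (p - 1)%N => D D0; set c := ((i %% D + j %% D) %/ D)%N.
have e : (i + j = (i %/ D + j %/ D + c) * D + (i %% D + j %% D) %% D)%N.
  have e := divn_eq (i %% D + j %% D) D; rewrite -/c in e.
  have ei := divn_eq i D; have ej := divn_eq j D.
  rewrite !mulnDl; move: e ei ej; move: (i %/ D * D)%N (j %/ D * D)%N (c * D)%N.
  by move: (i %% D)%N (j %% D)%N => s t x y z; move: ((s + t) %% D)%N; clear; lia.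
split; first by rewrite e divnMDl // [((_ %% D) %/ _)%N]divn_small ?addn0 // ltn_mod.
by rewrite e modnMDl modn_mod [RHS]addnC [(D * c)%N]mulnC -divn_eq.
Qed.

Lemma evintM i j x y : evint i x -> evint j y -> evint (i + j) (x * y).
Proof.
move=> hx hy; rewrite /evint; have [-> _] := divmodD i j; set c := ((_ + _) %/ (p - 1))%N.
have -> : (- p%:R) ^+ (i %/ (p - 1) + j %/ (p - 1) + c) * (x * y) =
  ((- p%:R) ^+ (i %/ (p - 1)) * x) * ((- p%:R) ^+ (j %/ (p - 1)) * y) * (- p%:R) ^+ c.
  by rewrite !exprD; ring.
by apply: pintM (pint_Np _) => //; apply: pintM.
Qed.

Lemma evM i j x y : evint i x -> evint j y -> ev i x * ev j y = ev (i + j) (x * y).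
Proof.
move=> hx hy; rewrite /ev; have [-> e] := divmodD i j.
move: e; set c := ((_ + _) %/ (p - 1))%N => e.
rewrite mulrACA -exprD e exprD exprM piE -zmodp_Np -!mulrA -!rmorphM -!zmodpM //; last first.
  exact: pintM.
by congr (_ * iota (zmodp _ _ _)); rewrite !exprD; ring.
Qed.

Lemma ev_shift n k x : ev (n + (p - 1) * k) x = ev n ((- p%:R) ^+ k * x).
Proof.
rewrite /ev [(_ * k)%N]mulnC addnC modnMDl divnMDl //; congr (_ * iota (zmodp _ _ _)).
by rewrite exprD; ring.
Qed.

Lemma evint_shift n k x : evint (n + (p - 1) * k) x = evint n ((- p%:R) ^+ k * x).
Proof.
by rewrite /evint [(_ * k)%N]mulnC addnC divnMDl //; congr (pint _ _); rewrite exprD; ring.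
Qed.

Lemma evint_einv n : evint n (einv n).
Proof.
rewrite /evint /einv exprNn -mulrA; apply: pintM; rewrite ?pint_sign //.
apply: (@pint_expn_le _ p_pr (logn p n`!)); last exact: pint_divn (fact_gt0 _).
by rewrite leq_divRL // mulnC logn_fact_le.
Qed.

Definition pexp n := ev n (einv n).

Lemma pexp0 : pexp 0 = 1.
Proof. by rewrite /pexp /ev div0n mod0n einv0 !mul1r (zmodp_natr p N 1) rmorph1. Qed.

Lemma pexpM i j : pexp i * pexp j = 'C(i + j, i)%:R * pexp (i + j)%N.
Proof.
rewrite /pexp evM ?evint_einv // einvM ev_pint ?pint_natr ?evint_einv //.
by rewrite zmodp_natr iota_natr.
Qed.

(** exp(pi (x - x^q)) built inside A, where its functional equation is formal. The rational series
    [dwork] yields the same coefficients and controls their decay. *)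
Definition fcoef := conv (expk pexp 1 1) (expk pexp q (-1)).

Let evint_term i j : evint (i + q * j) (einv i * (einv j * (- (varpi p r)^-1) ^+ j)) /\
  ev (i + q * j) (einv i * (einv j * (- (varpi p r)^-1) ^+ j)) = pexp i * (pexp j * (-1) ^+ j).
Proof.
(* The weight is i + j plus (q - 1) j, and pi^((q - 1) j) is the image of varpi^j, which cancels the
   denominator. *)
have e : (i + q * j = i + j + (p - 1) * (repunit p r * j))%N.
  by rewrite mulnA repunitE // mulnBl mul1n -addnA subnKC // leq_pmull.
have e2 : (- p%:R) ^+ (repunit p r * j) * (einv i * (einv j * (- (varpi p r)^-1) ^+ j))
   = (-1) ^+ j * (einv i * einv j).
  rewrite exprM -/(varpi p r) [(- _^-1) ^+ j]exprNn exprVn; field.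
  by rewrite expf_neq0 // varpi_neq0.
rewrite e evint_shift ev_shift e2; split.
  by apply: evint_pint; rewrite ?pint_sign //; apply: evintM; apply: evint_einv.
rewrite ev_pint ?pint_sign //; last by apply: evintM; apply: evint_einv.
rewrite /pexp -evM ?evint_einv // zmodpX //; last exact: (pint_intr p (-1)).
by rewrite (zmodp_intr p N (-1)) rmorphXn rmorphN1; ring.
Qed.

Lemma fcoef_ev n : evint n (dwork p r n) /\ fcoef n = ev n (dwork p r n).
Proof.
pose G i := expk einv 1 1 i * expk einv q (- (varpi p r)^-1) (n - i).
have h i : (i <= n)%N ->
    evint n (G i) /\ ev n (G i) = expk pexp 1 1 i * expk pexp q (-1) (n - i).
  move=> lein; rewrite /G /expk /stretch dvd1n divn1 /expser !expr1n !mulr1.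
  case: (boolP (q %| n - i)%N) => [/dvdnP[j ej]|_].
    have -> : n = (i + q * j)%N by rewrite mulnC -ej subnKC.
    by rewrite addKn mulKn //; apply: evint_term.
  by rewrite !mulr0 /evint /ev mulr0 pint0 (zmodp_natr p N 0) rmorph0 mulr0.
have le (i : 'I_n.+1) : (i <= n)%N by rewrite -ltnS.
split; first by apply: evint_sum => i _; have [] := h i (le i).
have -> : dwork p r n = \sum_(i < n.+1) G i by [].
rewrite ev_sum => [|i _]; last by have [] := h i (le i).
by apply: eq_bigr => i _; have [_ ->] := h i (le i).
Qed.

Local Notation K := (p * p.+1 * p ^ r)%N.
(** The valuation of pi^n times the n-th coefficient is about n / (K (p - 1)); from this index on it
    reaches N + 1 even after rounding. *)
Definition fdeg := (K * (p - 1) * N.+1)%N.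

Lemma fcoef_eq0 n : (fdeg <= n)%N -> fcoef n = 0.
Proof.
move=> le; have [_ ->] := fcoef_ev n; rewrite /ev.
have := decay_dwork p_pr r n; set e := (_ %/ _)%N => h.
have K0 : (0 < K)%N by rewrite !muln_gt0 p0 q0.
have le2 : (N.+1 + e <= n %/ (p - 1))%N.
  rewrite leq_divRL // -(leq_pmul2l K0) !mulnA.
  have : (e * (K * (p - 1)) <= (K - 1) * n)%N by apply: leq_trunc_div.
  move: le; rewrite /fdeg; move: K K0 e {h} => k k0 e h1 h2.
  have -> : (k * (N.+1 + e) * (p - 1) = k * (p - 1) * N.+1 + e * (k * (p - 1)))%N by ring.
  apply: leq_trans (leq_add h1 h2) _; rewrite mulnBl mul1n subnKC // leq_pmull //.
set m := (n %/ (p - 1))%N in le2 *.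
have -> : (- p%:R) ^+ m * dwork p r n =
    p%:R ^+ N.+1 * ((-1) ^+ m * p%:R ^+ (m - (N.+1 + e)) * (p%:R ^+ e * dwork p r n)).
  have em : p%:R ^+ m = p%:R ^+ (m - (N.+1 + e)) * (p%:R ^+ N.+1 * p%:R ^+ e) :> rat.
    by rewrite -!exprD subnK.
  by rewrite exprNn em; ring.
rewrite zmodp_eq0 ?rmorph0 ?mulr0 //; apply: pintM => //; apply: pintM; rewrite ?pint_sign //.
by apply: pintX => //; apply: pint_natr.
Qed.

Definition psi x := \sum_(n < fdeg) fcoef n * om x ^+ n.

Lemma om_exp x n : om x ^+ n = om (x ^+ n).
Proof. by elim: n => [|n IHn]; rewrite ?expr0 ?om1 // !exprS omM IHn. Qed.

(** om u - 1 differs from the invertible om (u - 1) by a multiple of p, which is nilpotent. *)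
Lemma om_cancel u (z : A) : u != 1 -> (om u - 1) * z = 0 -> z = 0.
Proof.
move=> u1 h; have [c ec] := omD (u - 1) 1; rewrite subrK om1 in ec.
have u10 : u - 1 != 0 by rewrite subr_eq0.
have h2 : z = p%:R * (- c * om (u - 1)^-1) * z.
  have : om (u - 1)^-1 * ((om u - 1) * z) = 0 by rewrite h mulr0.
  rewrite ec => h3; have h4 : om (u - 1)^-1 * om (u - 1) = 1 by rewrite -omM mulVf.
  have h5 : om (u - 1)^-1 * om (u - 1) * z = - (p%:R * c * om (u - 1)^-1 * z).
    by apply/eqP; rewrite -subr_eq0 -h3; apply/eqP; ring.
  by rewrite h4 mul1r in h5; rewrite {1}h5; ring.
move: (- c * _) h2 => b h2.
have h3 k : z = (p%:R * b) ^+ k * z.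
  by elim: k => [|k IHk]; rewrite ?mul1r // exprSr -mulrA -h2.
by rewrite (h3 N.+1) exprMn A_p0 !mul0r.
Qed.

Lemma fermat (x : F) : x != 0 -> x ^+ (q - 1) = 1.
Proof.
move=> x0; apply: (mulfI x0); rewrite -exprS subn1 prednK // mulr1 -{2}[x]expf_card.
by rewrite cardF.
Qed.

Lemma exp_neq1 m : ~~ (q - 1 %| m)%N -> exists2 c : F, c != 0 & c ^+ m != 1.
Proof.
move=> ndv; have q10 : (0 < q - 1)%N by rewrite subn_gt0.
have e (x : F) : x != 0 -> x ^+ m = x ^+ (m %% (q - 1)).
  by move=> x0; rewrite {1}(divn_eq m (q - 1)) exprD mulnC exprM fermat // expr1n mul1r.
set k := (m %% (q - 1))%N in e.
have k0 : (0 < k)%N by rewrite lt0n; apply: contraNneq ndv => k0; rewrite /dvdn -/k k0.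
have kq : (k < q - 1)%N by rewrite ltn_mod.
have [/existsP[c /andP[c0 c1]]|] := boolP [exists c : F, (c != 0) && (c ^+ k != 1)].
  by exists c; rewrite ?e.
move/existsPn => h.
have := @max_poly_roots F ('X^k - 1) [seq x <- enum F | x != 0].
have -> : ('X^k - 1 : {poly F}) != 0 by rewrite -size_poly_eq0 size_XnsubC.
move=> /(_ isT); rewrite size_XnsubC // filter_uniq ?enum_uniq //.
have -> : all (root ('X^k - 1)) [seq x <- enum F | x != 0].
  apply/allP => x; rewrite mem_filter => /andP[x0 _]; rewrite rootE !hornerE.
  by have := h x; rewrite x0 /= negbK => /eqP ->; rewrite subrr.
move=> /(_ isT isT); rewrite ltnS => hs.
have : size [seq x <- enum F | x != 0] = (q - 1)%N.
  rewrite size_filter -sum1_count big_enum_cond /= sum1_card subn1 -cardF -(cardC1 (0 : F)).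
  by apply: eq_card => x; rewrite !inE.
by move=> es; rewrite es leqNgt kq in hs.
Qed.

Lemma power_sum m : \sum_(x : F | x != 0) om x ^+ m = if (q - 1 %| m)%N then (q - 1)%:R else 0.
Proof.
case: ifP => [/dvdnP[k ->]|/negbT /exp_neq1[c c0 cm]].
  rewrite (eq_bigr (fun _ => 1)) => [|x x0]; last first.
    by rewrite om_exp mulnC exprM fermat // expr1n om1.
  rewrite sumr_const -cardF subn1 -(cardC1 (0 : F)); congr (_ *+ _).
apply: (om_cancel cm); rewrite mulrBl mul1r mulr_sumr; apply/eqP; rewrite subr_eq0; apply/eqP.
rewrite [RHS](reindex_inj (mulfI c0)) /=; apply: eq_big => x; first by rewrite mulf_eq0 negb_or c0.
by move=> _; rewrite !om_exp -omM exprMn.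
Qed.

Lemma expk_fcoef x n : conv (expk pexp 1 x) (expk pexp q (- x ^+ q)) n = fcoef n * x ^+ n.
Proof.
rewrite /fcoef /conv mulr_suml; apply: eq_bigr => i _.
have lein : (i <= n)%N by rewrite -ltnS.
have -> : x ^+ n = x ^+ i * x ^+ (n - i) by rewrite -exprD subnKC.
rewrite mulrACA /expk /stretch dvd1n divn1 /expser expr1n mulr1; congr (_ * _).
case: ifP => [/dvdnP[j ->]|_]; last by rewrite mul0r.
by rewrite mulnK // exprNn -exprM [(q * j)%N]mulnC mulrA.
Qed.

Lemma expk_small k x c n : (0 < k)%N -> x = p%:R * c -> (k * N.+1 <= n)%N -> expk pexp k x n = 0.
Proof.
move=> k0 -> le; rewrite /expk /stretch; case: ifP => // kn; rewrite /expser exprMn.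
have leN : (N.+1 <= n %/ k)%N by rewrite leq_divRL // mulnC.
by rewrite -(subnK leN) [p%:R ^+ _]exprD A_p0 mulr0 !mul0r mulr0.
Qed.

Lemma sum_expk k x c L : (0 < k)%N -> x = p%:R * c -> (k * N.+1 <= L)%N ->
  \sum_(n < L) expk pexp k x n = \sum_(n < N.+1) expser pexp x n.
Proof.
move=> k0 ex le.
rewrite (@sum_supp _ (k * N.+1)); last by []; last by move=> m; apply: expk_small ex.
rewrite -(@sum_supp _ (k * N.+1) (k * N.+1).+1) //; last by move=> m; apply: expk_small ex.
rewrite sum_stretch // big_ord_recr /=.
suff -> : expser pexp x N.+1 = 0 by rewrite addr0.
by rewrite /expser ex exprMn A_p0 mul0r mulr0.
Qed.

Lemma psi_sum L x : (fdeg <= L)%N -> psi x = \sum_(n < L) fcoef n * om x ^+ n.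
Proof.
move=> le; apply/esym/(@sum_supp _ fdeg L (fun n => fcoef n * om x ^+ n)) => // m.
by move/fcoef_eq0 ->; rewrite mul0r.
Qed.

(** om is additive only up to a multiple dl of p. Comparing exponential series leaves exp(dl X^q) on
    one side and exp(dl X) on the other; both have finite support and the same invertible sum [e] at
    X = 1. The single factors exp(om x X) have no sum of their own, so the comparison has to take
    place between series. *)
Lemma psiD x y : psi (x + y) = psi x * psi y.
Proof.
have [c ec] := omD x y; set z := om (x + y) in ec.
have zq : z ^+ q = z by rewrite /z om_exp -cardF expf_card.
have xq : om x ^+ q = om x by rewrite om_exp -cardF expf_card.
have yq : om y ^+ q = om y by rewrite om_exp -cardF expf_card.
pose dl := p%:R * c.
pose Fs t n := fcoef n * t ^+ n.
have eF t : Fs t =1 conv (expk pexp 1 t) (expk pexp q (- t ^+ q)) by move=> n; rewrite expk_fcoef.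
have D k s t n : (0 < k)%N -> expk pexp k (s + t) n = conv (expk pexp k s) (expk pexp k t) n.
  by move=> k0; rewrite (expkD pexpM).
have main : conv (Fs z) (expk pexp q dl) =1 conv (conv (Fs (om x)) (Fs (om y))) (expk pexp 1 dl).
  move=> n.
  rewrite (eq_conv (eF z) (frefl _)) -convA.
  have -> : conv (expk pexp 1 z) (conv (expk pexp q (- z ^+ q)) (expk pexp q dl)) n =
      conv (conv (expk pexp 1 (om x + om y)) (expk pexp 1 dl)) (expk pexp q (- (om x + om y))) n.
    apply: eq_conv => m; first by rewrite -D // -ec.
    by rewrite -D // zq ec -/dl; congr (expk _ _ _ _); ring.
  rewrite -convA (eq_conv (frefl _) (convC _ _)) convA; apply: eq_conv => // m.
  rewrite (eq_conv (eF (om x)) (eF (om y))) convACA.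
  by apply: eq_conv => l; rewrite -D // xq yq; congr (expk _ _ _ _); ring.
pose e := \sum_(n < N.+1) expser pexp dl n.
have FsZ t m : (fdeg <= m)%N -> Fs t m = 0 by move=> h; rewrite /Fs fcoef_eq0 ?mul0r.
have s1 : \sum_(n < fdeg + fdeg + q * N.+1 + N.+1) conv (Fs z) (expk pexp q dl) n = psi (x + y) * e.
  rewrite (@sum_conv _ fdeg (q * N.+1)); last by lia.
  - by rewrite (@sum_expk q dl c).
  - exact: FsZ.
  by move=> m; apply: expk_small.
have s2 : \sum_(n < fdeg + fdeg + q * N.+1 + N.+1)
    conv (conv (Fs (om x)) (Fs (om y))) (expk pexp 1 dl) n = psi x * psi y * e.
  rewrite (@sum_conv _ (fdeg + fdeg) N.+1); last by lia.
  - rewrite (@sum_expk 1 dl c) // ?mul1n // (@sum_conv _ fdeg fdeg) //; exact: FsZ.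
  - by move=> m; apply: conv_supp; apply: FsZ.
  by move=> m; rewrite -{1}[N.+1]mul1n; apply: expk_small.
have einvertible : e * \sum_(n < N.+1) expser pexp (- dl) n = 1.
  have ed : - dl = p%:R * - c by rewrite mulrN.
  have le1 : (1 * N.+1 <= N.+1)%N by rewrite mul1n.
  have -> : e = \sum_(n < N.+1) expk pexp 1 dl n by rewrite (@sum_expk 1 dl c).
  have -> : \sum_(n < N.+1) expser pexp (- dl) n = \sum_(n < N.+1) expk pexp 1 (- dl) n.
    by rewrite (sum_expk _ ed).
  rewrite -(@sum_conv _ N.+1 N.+1 (N.+1 + N.+1)) //; last first.
  - by move=> m; rewrite -{1}[N.+1]mul1n; apply: expk_small ed.
  - by move=> m; rewrite -{1}[N.+1]mul1n; apply: expk_small.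
  rewrite (eq_bigr (fun n : 'I__ => expk pexp 1 0 n)) => [|n _]; last by rewrite -D // subrr.
  rewrite addSn big_ord_recl big1 ?addr0 => [|n _].
    by rewrite /expk /stretch /expser pexp0 expr0 mulr1.
  by rewrite /expk /stretch dvd1n divn1 /expser expr0n mulr0.
have : psi (x + y) * e = psi x * psi y * e by rewrite -s1 -s2; apply: eq_bigr.
move/(congr1 (fun t => t * \sum_(n < N.+1) expser pexp (- dl) n)).
by rewrite -!mulrA einvertible !mulr1.
Qed.

Lemma psi0 : psi 0 = 1.
Proof.
have h : (0 < fdeg)%N by rewrite /fdeg !muln_gt0 p0 q0 p10.
rewrite /psi -(prednK h) big_ord_recl big1 ?addr0 => [|i _]; last by rewrite om0 expr0n mulr0.
rewrite expr0 mulr1 /fcoef /conv big_ord1 /expk /stretch /expser.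
by rewrite !dvdn0 !div0n pexp0 !expr0 !mulr1.
Qed.

Definition gauss a := \sum_(x : F | x != 0) om x^-1 ^+ a * psi x.

Lemma sum_progression (G : nat -> A) a m : (a < q - 1)%N ->
  \sum_(n < a + (q - 1) * m | (q - 1 %| n + (q - 1 - a))%N) G n =
  \sum_(0 <= u < m) G (a + (q - 1) * u)%N.
Proof.
move=> ltaq; rewrite -(big_mkord (fun n => (q - 1 %| n + (q - 1 - a))%N) G).
set Q := (q - 1)%N in ltaq *; elim: m => [|m IHm].
  rewrite muln0 addn0 (big_geq (leqnn 0)) big_nat_cond big1 // => n /andP[/andP[_ lt] /dvdnP[j ej]].
  by case: j ej => [|j] ej; nia.
rewrite (big_cat_nat (n := (a + Q * m)%N)) //=; last by rewrite leq_add2l leq_mul2l leqnSn orbT.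
rewrite IHm [RHS]big_nat_recr //=; congr (_ + _).
rewrite big_ltn_cond; last by rewrite ltn_add2l mulnS; lia.
have -> : (Q %| a + Q * m + (Q - a))%N.
  by have -> : (a + Q * m + (Q - a) = Q * m.+1)%N; [rewrite mulnS; lia | apply: dvdn_mulr].
rewrite big_nat_cond big1 ?addr0 // => n /andP[/andP[lt1 lt2] /dvdnP[j ej]].
have Q0 : (0 < Q)%N by lia.
have h1 : (m.+1 < j)%N by rewrite -(ltn_pmul2r Q0) -ej mulnC mulnS; lia.
have h2 : (j < m.+2)%N by rewrite -(ltn_pmul2r Q0) -ej [(m.+2 * Q)%N]mulnC !mulnS; rewrite mulnS in lt2; lia.
lia.
Qed.

(** Since the a-th power of om (1/x) is om x^(q - 1 - a), summing over x keeps exactly the indices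
    congruent to a modulo q - 1. *)
Lemma gauss_sum a L : (a < q - 1)%N -> (fdeg <= L)%N ->
  gauss a = (q - 1)%:R * \sum_(0 <= u < L) fcoef (a + (q - 1) * u)%N.
Proof.
move=> ltaq leL; have q10 : (0 < q - 1)%N by rewrite subn_gt0.
have le : (fdeg <= a + (q - 1) * L)%N.
  by apply: leq_trans leL _; apply: leq_trans (leq_addl _ _); rewrite leq_pmull.
rewrite -(sum_progression _ _ ltaq) mulr_sumr /gauss.
rewrite (eq_bigr (fun x => \sum_(n < a + (q - 1) * L) fcoef n * om x ^+ (n + (q - 1 - a)))).
  rewrite exchange_big [RHS]big_mkcond /=; apply: eq_bigr => n _.
  by rewrite -mulr_sumr power_sum; case: ifP; rewrite ?mulr0 // mulrC.
move=> x x0; rewrite (psi_sum _ le) mulr_sumr; apply: eq_bigr => n _.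
rewrite exprD mulrCA; congr (_ * _); rewrite mulrC; congr (_ * _).
rewrite !om_exp; congr om; apply: (mulfI (expf_neq0 a x0)).
by rewrite -exprMn mulfV // expr1n -exprD subnKC ?fermat // ltnW.
Qed.

Lemma gauss_eval a : (0 < a < q - 1)%N -> exists k0, forall k M, (k0 <= k)%N ->
    (a + (q - 1) * M = a * q ^ k)%N ->
  evint a (M`!%:R * varpi p r ^+ M / (q * M + a)`!%:R) /\
  gauss a = - ev a (M`!%:R * varpi p r ^+ M / (q * M + a)`!%:R).
Proof.
move=> /andP[a0 aq].
have aq' : (0 < a < q)%N by rewrite a0 (leq_trans aq) // leq_subr.
have [k0 hk] := trace_limit p_pr r_gt0 N.+1 aq'.
exists k0 => k M lek eM; have [L0 hL] := hk k M lek eM.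
have := hL (L0 + fdeg)%N (leq_addr _ _); set L := (L0 + fdeg)%N => h.
set X := M`!%:R * _ / _ in h *.
have ephi u : fcoef (a + (q - 1) * u) = ev a (phi p r a u u) /\ evint a (phi p r a u u).
  have [i1 ->] := fcoef_ev (a + (q - 1) * u)%N.
  have e : (a + (q - 1) * u = a + (p - 1) * (repunit p r * u))%N by rewrite mulnA repunitE.
  have e2 : (a + q * u - u = a + (q - 1) * u)%N by rewrite mulnBl mul1n -addnBA // leq_pmull.
  move: i1; rewrite /phi e2; move: (dwork _ _ _) => D.
  by rewrite e evint_shift ev_shift exprM -/(varpi p r).
have hS : evint a ((1 - q%:R) * \sum_(0 <= u < L.+1) phi p r a u u).
  apply: evint_pint; last by apply: evint_sum => u _; have [] := ephi u.
  by apply: pintB; rewrite ?pint1 ?pint_natr.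
have hX : pint p (((- p%:R) ^+ (a %/ (p - 1)) * X -
    (- p%:R) ^+ (a %/ (p - 1)) * ((1 - q%:R) * \sum_(0 <= u < L.+1) phi p r a u u)) / p%:R ^+ N.+1).
  rewrite -mulrBr -mulrA; apply: pintM => //.
  by rewrite -[X - _]opprB mulNr; apply: pintN.
have [iX eX] := zmodp_cong p_pr hS hX; split=> //.
rewrite {1}/ev eX -/(ev _ _) (@gauss_sum a L.+1) //; last by rewrite /L; lia.
rewrite ev_pint; last first.
- by apply: evint_sum => u _; have [] := ephi u.
- by apply: pintB; rewrite ?pint1 ?pint_natr.
rewrite ev_sum => [|u _]; last by have [] := ephi u.
rewrite -mulNr -rmorphN -zmodpN //; last by apply: pintB; rewrite ?pint1 ?pint_natr.
rewrite opprB -(natrB _ q0) zmodp_natr iota_natr; congr (_ * _).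
by apply: eq_bigr => u _; have [] := ephi u.
Qed.

End GaussSum.

(** * The product relation between Jacobi and Gauss sums *)

Section JacobiSum.
Variables (F : finFieldType) (A : comNzRingType) (om psi : F -> A).
Hypotheses (om1 : om 1 = 1) (omM : {morph om : x y / x * y}).
Hypothesis om_cancel : forall u z, u != 1 -> (om u - 1) * z = 0 -> z = 0.

Definition nonzero d (y : {ffun 'I_d -> F}) := [forall i, y i != 0].

Definition jacobi d j : A :=
  \sum_(y : {ffun 'I_d -> F} | nonzero y && (\sum_i y i == 1)) om (\prod_i y i)^-1 ^+ j.

Let omX x n : om x ^+ n = om (x ^+ n).
Proof. by elim: n => [|n IHn]; rewrite ?expr0 ?om1 // !exprS omM IHn. Qed.

Let om_prod d (G : 'I_d -> F) : \prod_i om (G i) = om (\prod_i G i).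
Proof. by apply: (big_ind2 (fun x y => x = om y)) => // x1 y1 x2 y2 -> ->; rewrite omM. Qed.

Definition dilate d (c : F) (y : {ffun 'I_d -> F}) : {ffun 'I_d -> F} := [ffun i => c * y i].

Lemma dilateK d c : c != 0 -> cancel (@dilate d c) (@dilate d c^-1).
Proof. by move=> c0 y; apply/ffunP => i; rewrite !ffunE mulKf. Qed.

Lemma nonzero_dilate d c (y : {ffun 'I_d -> F}) : c != 0 -> nonzero (dilate c y) = nonzero y.
Proof.
by move=> c0; apply: eq_forallb => i; rewrite ffunE mulf_eq0 (negPf c0).
Qed.

Lemma sum_dilate d c (y : {ffun 'I_d -> F}) : \sum_i dilate c y i = c * \sum_i y i.
Proof. by rewrite mulr_sumr; apply: eq_bigr => i _; rewrite ffunE. Qed.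

Lemma prod_dilate d c (y : {ffun 'I_d -> F}) : \prod_i dilate c y i = c ^+ d * \prod_i y i.
Proof.
rewrite -[X in c ^+ X]card_ord -prodr_const -big_split; apply: eq_bigr => i _.
by rewrite ffunE.
Qed.

Hypotheses (psi0 : psi 0 = 1) (psiD : forall x y, psi (x + y) = psi x * psi y).

Let prod_psi d (G : 'I_d -> F) : \prod_i psi (G i) = psi (\sum_i G i).
Proof. by apply: (big_ind2 (fun x y => x = psi y)) => // x1 y1 x2 y2 -> ->; rewrite psiD. Qed.

Definition gsum j : A := \sum_(x | x != 0) om x^-1 ^+ j * psi x.

(** The power of the Gauss sum expands over d-tuples, split by their sum. Dilation by c multiplies
    the part of sum 0 by a value of om other than 1, so this part vanishes by [om_cancel]; a part of
    sum s nonzero is rescaled to sum 1. The product form avoids dividing by a Gauss sum. *)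
Lemma jacobi_gsum d j : (exists2 c : F, c != 0 & c ^+ (d * j) != 1) ->
  jacobi d j * gsum (d * j) = gsum j ^+ d.
Proof.
move=> [c c0 c1].
have -> : gsum j ^+ d = \sum_(y : {ffun 'I_d -> F} | nonzero y)
    om (\prod_i y i)^-1 ^+ j * psi (\sum_i y i).
  rewrite -[d in LHS]card_ord -prodr_const /gsum bigA_distr_big /=.
  apply: eq_big => [y|y _].
    by apply/ffun_onP/forallP.
  rewrite big_split /= prod_psi; congr (_ * _); rewrite prodrXl; congr (_ ^+ _).
  by rewrite om_prod prodfV.
rewrite (bigID (fun y : {ffun 'I_d -> F} => \sum_i y i == 0)) /=.
have -> : \sum_(y : {ffun 'I_d -> F} | nonzero y && (\sum_i y i == 0))
    om (\prod_i y i)^-1 ^+ j * psi (\sum_i y i) = 0.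
  set z := LHS; have ez : z = om (c ^- (d * j)) * z.
    rewrite {1}/z (reindex_inj (can_inj (@dilateK d c c0))) /= mulr_sumr.
    apply: eq_big => [y|y].
      by rewrite nonzero_dilate // sum_dilate mulf_eq0 (negPf c0).
    rewrite sum_dilate => /andP[_]; rewrite mulf_eq0 (negPf c0) /= => /eqP ->.
    rewrite mulr0 prod_dilate mulrA invfM omM exprMn; congr (_ * _ * _).
    by rewrite omX exprVn -exprM.
  apply: (@om_cancel (c ^- (d * j))); first by rewrite invr_eq1.
  by rewrite mulrBl mul1r -ez subrr.
rewrite add0r /jacobi mulr_suml /gsum.
rewrite [RHS](partition_big (fun y : {ffun 'I_d -> F} => \sum_i y i) (fun s => s != 0)) /=; last first.
  by move=> y /andP[].
rewrite (eq_bigr (fun y : {ffun 'I_d -> F} => \sum_(x | x != 0)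
    om (\prod_i y i)^-1 ^+ j * (om x^-1 ^+ (d * j) * psi x))); last by move=> y _; rewrite mulr_sumr.
rewrite exchange_big /=; apply: eq_bigr => s s0.
rewrite [RHS](reindex_inj (can_inj (@dilateK d s s0))) /=.
apply: eq_big => [y|y /andP[_ /eqP es]].
  rewrite nonzero_dilate // sum_dilate mulf_eq0 (negPf s0) /=.
  have -> t : (s * t == s) = (t == 1) by rewrite -{2}[s]mulr1 (inj_eq (mulfI s0)).
  by case: (nonzero y) => //=; case: eqP => [->|_]; rewrite ?oner_eq0 ?andbF.
rewrite sum_dilate es mulr1 prod_dilate invfM omM exprMn mulrA; congr (_ * _).
by rewrite mulrC !omX -exprVn -exprM.
Qed.
End JacobiSum.

(** * Morita's gamma function *)

Section MoritaGamma.
Variables (p : nat) (p_pr : prime p) (p_odd : odd p) (N : nat).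
Local Notation P := (p ^ N.+1)%N.
Local Notation Z := 'Z_(p ^ N.+1).
Let p0 := prime_gt0 p_pr.
Let p1 := prime_gt1 p_pr.
Let pnz : (p%:R : rat) != 0. Proof. by rewrite pnatr_eq0 -lt0n. Qed.
Let P1 : (1 < P)%N. Proof. exact: modulus_gt1. Qed.
Let P0 : (0 < P)%N. Proof. exact: ltnW. Qed.
Let Pnz : (p%:R ^+ N.+1 : rat) != 0. Proof. exact: expf_neq0. Qed.
Let charZ : (P%:R : Z) = 0. Proof. exact: pchar_Zp. Qed.

Definition pval (R : comNzRingType) j : R := if (p %| j)%N then 1 else j%:R.

Lemma prod_pval_Fp m : \prod_(0 <= j < p * m) pval 'F_p j = (-1) ^+ m.
Proof.
have Fp0 : (p%:R : 'F_p) = 0 by apply: pchar_Fp_0.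
elim: m => [|m IHm]; first by rewrite muln0 big_geq.
rewrite (big_cat_nat (n := (p * m)%N)) ?leq_pmul2l //= IHm exprSr; congr (_ * _).
rewrite mulnS addnC -{1}[(p * m)%N]add0n big_addn addKn big_ltn // {1}/pval add0n dvdn_mulr // mul1r.
transitivity (\prod_(1 <= j < p) (j%:R : 'F_p)).
  apply: eq_big_nat => j /andP[j0 jp]; rewrite /pval dvdn_addl ?dvdn_mulr // gtnNdvd //.
  by rewrite natrD natrM Fp0 mul0r addr0.
rewrite -natr_prod.
have -> : (\prod_(1 <= i < p) i)%N = (p.-1)`! by rewrite fact_prod prednK.
have := p_pr; rewrite (Wilson p1) => /dvdnP[c ec].
by apply/eqP; rewrite -subr_eq0 opprK natr1 ec natrM Fp0 mulr0.
Qed.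

Let big_Zpn (Q : pred nat) (G : nat -> Z) :
  \prod_(0 <= j < P | Q j) G j = \prod_(x : Z | Q x) G x.
Proof.
have h m : (Zp_trunc P).+2 = m -> \prod_(0 <= j < m | Q j) G j = \prod_(x : Z | Q x) G x.
  by move=> <-; rewrite big_mkord.
by rewrite h // Zp_cast.
Qed.

(** Gauss's generalization of Wilson. Pairing x with its inverse gives w^2 = 1; Wilson on p^N blocks
    gives w = -1 modulo p, so w - 1 is a unit, p being odd, and w + 1 = 0. *)
Lemma prod_units_Zpn : \prod_(x : Z | x \is a GRing.unit) x = -1.
Proof.
set w := LHS.
have uw : w \is a GRing.unit by rewrite /w; apply: rpred_prod.
have w2 : w * w = 1.
  rewrite -(mulrV uw); congr (_ * _); rewrite {2}/w -prodrV // /w.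
  rewrite (reindex_inj invr_inj) /=.
  by apply: eq_big => x; rewrite ?unitrV.
pose X := (\prod_(0 <= j < P | ~~ (p %| j)) j)%N.
have wX : w = X%:R.
  rewrite /w /X natr_prod big_Zpn.
  apply: eq_big => x; last by move=> _; rewrite natr_Zp.
  by rewrite -{1}[x]natr_Zp unitZpE // coprime_pexpl // prime_coprime.
have pX : (p %| X.+1)%N.
  have Fp0 : (p%:R : 'F_p) = 0 by apply: pchar_Fp_0.
  have : (X.+1%:R : 'F_p) = 0.
    rewrite -natr1 /X natr_prod big_mkcond /= expnS.
    under eq_bigr => j _ do rewrite -if_neg negbK.
    rewrite (eq_bigr (fun j => pval 'F_p j)) // prod_pval_Fp -signr_odd oddX p_odd orbT.
    by rewrite expr1 addNr.
  move/eqP; rewrite -(dvdn_pcharf (pchar_Fp p_pr)) //.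
have X0 : (0 < X)%N.
  by rewrite lt0n; apply: contraTneq pX => ->; rewrite dvdn1 neq_ltn p1 orbT.
have pX1 : ~~ (p %| X - 1)%N.
  apply/negP => h; have : (p %| X.+1 - (X - 1))%N by apply: dvdn_sub.
  have -> : (X.+1 - (X - 1) = 2)%N by lia.
  move/dvdn_leq => /(_ isT) le2; have p2 : p = 2 by lia.
  by move: p_odd; rewrite p2.
have u1 := unit_Zpn p_pr N pX1.
have : (X - 1)%:R * (w + 1) = 0 :> Z by rewrite natrB // -wX; have -> : (w - 1) * (w + 1) = w * w - 1; [ring | rewrite w2 subrr].
by move/(canRL (mulKr u1)); rewrite mulr0 => /eqP; rewrite addr_eq0 => /eqP.
Qed.

Lemma pval_addP j : pval Z (j + P) = pval Z j.
Proof. by rewrite /pval dvdn_addl ?dvdn_exp // natrD charZ addr0. Qed.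

Lemma prod_pval_block n : \prod_(n <= j < n + P) pval Z j = -1.
Proof.
elim: n => [|n IHn].
  rewrite -prod_units_Zpn add0n big_Zpn [RHS]big_mkcond /=.
  apply: eq_bigr => x _; rewrite -[in RHS](natr_Zp x) /pval unitZpE // coprime_pexpl // prime_coprime //.
  by case: ifP.
rewrite -IHn [RHS]big_ltn; last by lia.
by rewrite addSn big_nat_recr /= ?pval_addP; [rewrite mulrC | lia].
Qed.

Definition gn n : Z := (gammap_nat p n)%:~R.

Lemma gnE n : gn n = (-1) ^+ n * \prod_(1 <= j < n) pval Z j.
Proof.
rewrite /gn /gammap_nat intrM -[((-1) ^+ n)%:~R]/(intr _) rmorphXn rmorphN1; congr (_ * _).
rewrite -[LHS]/(intr _) rmorph_prod big_mkcond /=; apply: eq_bigr => j _.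
by rewrite /pval; case: (p %| j)%N.
Qed.

Lemma gnS n : (0 < n)%N -> gn n.+1 = - (gn n * pval Z n).
Proof. by move=> n0; rewrite !gnE big_nat_recr //= exprS; ring. Qed.

Lemma pval_unit n : pval Z n \is a GRing.unit.
Proof. by rewrite /pval; case: ifP => [_|/negbT]; [exact: unitr1 | exact: unit_Zpn]. Qed.

Lemma gn_unit n : gn n \is a GRing.unit.
Proof.
rewrite gnE unitrM unitrX ?unitrN1 //=.
by apply: rpred_prod => j _; apply: pval_unit.
Qed.

(** A block of P consecutive integers contributes -1, which the sign (-1)^P cancels, P being odd. *)
Lemma gn_period n m : (0 < n)%N -> gn (n + m * P) = gn n.
Proof.
move=> n0; elim: m => [|m IHm]; first by rewrite addn0.
rewrite mulSn addnCA addnC -IHm; have : (0 < n + m * P)%N by rewrite addn_gt0 n0.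
move: (n + m * P)%N => k k0; rewrite !gnE (big_cat_nat (n := k)) ?leq_addr //= prod_pval_block.
by rewrite exprD -[(-1) ^+ P]signr_odd oddX p_odd orbT; ring.
Qed.

Lemma gn_cong n m : (0 < n)%N -> (0 < m)%N -> (P%:Z %| n%:Z - m%:Z)%Z -> gn n = gn m.
Proof.
wlog le : n m / (m <= n)%N => [hw|] n0 m0 h.
  case: (leqP m n) => [le|/ltnW le]; first exact: hw.
  by apply/esym/hw => //; rewrite -opprB rpredN.
have : (P %| n - m)%N by move: h; rewrite subzn.
by case/dvdnP => k ek; rewrite -(subnKC le) ek gn_period.
Qed.

Lemma pint_divX_int k (a : int) : pint p (a%:~R / p%:R ^+ k) -> ((p ^ k)%:Z %| a)%Z.
Proof.
case/(pintP p_pr) => c [b [pb e]].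
have : (a * b%:Z)%:~R = ((p ^ k)%:Z * c)%:~R :> rat.
  by rewrite !intrM -e -!pmulrn natrX; field; rewrite expf_neq0.
move/eqP; rewrite eqr_int => /eqP e2.
have : ((p ^ k)%:Z %| a * b%:Z)%Z by rewrite e2 dvdz_mulr.
by rewrite Gauss_dvdzl // coprimezE /= coprimeXl // prime_coprime.
Qed.

Lemma near_exists k x : pint p x ->
  exists n, (0 < n)%N /\ pint p ((x - n%:R) / p%:R ^+ k).
Proof.
move=> /(pintP p_pr)[a [b [pb e]]].
have cop : coprimez (p ^ k)%:Z b%:Z by rewrite coprimezE /= coprimeXl // prime_coprime.
have [u [v]] := Bezoutz (p ^ k)%:Z b%:Z; rewrite (eqP cop) => uv.
have pk0 : (0 < p ^ k)%N by rewrite expn_gt0 p0.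
pose n := (`|(a * v) %% (p ^ k)%:Z|%Z + p ^ k)%N.
exists n; split; first by rewrite /n; lia.
apply/(pintP p_pr).
have nE : n%:Z = a * v + (p ^ k)%:Z * (1 - ((a * v) %/ (p ^ k)%:Z)%Z).
  rewrite /n PoszD gez0_abs; last by apply: modz_ge0; lia.
  by rewrite {2}(divz_eq (a * v) (p ^ k)%:Z); ring.
exists (a * u - b%:Z * (1 - ((a * v) %/ (p ^ k)%:Z)%Z)), b; split=> //.
have -> : (x - n%:R) / p%:R ^+ k * b%:R = (x * b%:R - n%:R * b%:R) / p%:R ^+ k by ring.
have -> : (n%:R : rat) = (n%:Z)%:~R by rewrite -pmulrn.
apply: (mulIf (expf_neq0 k pnz)); rewrite divfK ?expf_neq0 // e nE.
have -> : a%:~R = (a * (u * (p ^ k)%:Z + v * b%:Z))%:~R :> rat by rewrite uv mulr1.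
by rewrite !(intrD, intrM, intrB, rmorphN) /= -!pmulrn -natrX; ring.
Qed.

(** [epsilon] only promises some radius M. By [gn_cong] the radius N + 1 works too, and an integer
    within both of x identifies the chosen value. *)
Lemma gammapE x n : (0 < n)%N -> pint p ((x - n%:R) / p%:R ^+ N.+1) -> gammap p N x = gn n.
Proof.
move=> n0 hn.
have px : pint p x.
  have -> : x = (x - n%:R) / p%:R ^+ N.+1 * p%:R ^+ N.+1 + n%:R by rewrite divfK // subrK.
  by apply: pintD; rewrite ?pint_natr //; apply: pintM => //; apply: pintX => //; apply: pint_natr.
have dx0 : (denq x)%:~R != 0 :> rat by rewrite intr_eq0 denq_eq0.
have near m k : ((p ^ k)%:Z %| m%:Z * denq x - numq x)%Z -> pint p ((x - m%:R) / p%:R ^+ k).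
  case/dvdzP => c e; apply/(pintP p_pr); exists (- c), `|denq x|%N.
  split; first by rewrite -prime_coprime.
  have ->: (`|denq x|%:R : rat) = (denq x)%:~R by rewrite pmulrn absz_denq.
  have : (m%:Z * denq x - numq x)%:~R = (c * (p ^ k)%:Z)%:~R :> rat by rewrite e.
  rewrite intrB !intrM numqE -!pmulrn natrX => e2.
  apply: (mulIf (expf_neq0 k pnz)).
  have -> : (x - m%:R) / p%:R ^+ k * (denq x)%:~R * p%:R ^+ k = (x - m%:R) * (denq x)%:~R.
    by field; rewrite expf_neq0.
  by rewrite rmorphN mulNr -e2; ring.
have cong m m' k : pint p ((x - m%:R) / p%:R ^+ k) -> pint p ((x - m'%:R) / p%:R ^+ k) ->
    ((p ^ k)%:Z %| m%:Z - m'%:Z)%Z.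
  move=> h h'; apply: pint_divX_int => //; rewrite intrB -!pmulrn.
  have -> : (m%:R - m'%:R) / p%:R ^+ k = (x - m'%:R) / p%:R ^+ k - (x - m%:R) / p%:R ^+ k :> rat by ring.
  exact: pintB.
have ex : exists y : Z, exists M : nat, forall n : nat, (0 < n)%N ->
      ((p ^ M)%:Z %| (n%:Z * denq x - numq x))%Z -> (gammap_nat p n)%:~R = y.
  exists (gn n), N.+1 => m m0 /near hm; apply: gn_cong => //; exact: cong.
have [M hM] := epsilon_spec (inhabits 0) _ ex; rewrite -/(gammap p N x) in hM.
have [m [m0 hm]] := near_exists (M + N.+1) px.
have hm1 : pint p ((x - m%:R) / p%:R ^+ N.+1).
  have -> : (x - m%:R) / p%:R ^+ N.+1 = p%:R ^+ M * ((x - m%:R) / p%:R ^+ (M + N.+1)).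
    by rewrite exprD; field; rewrite !expf_neq0.
  by apply: pintM => //; apply: pintX => //; apply: pint_natr.
have hm2 : ((p ^ M)%:Z %| m%:Z * denq x - numq x)%Z.
  apply: pint_divX_int => //; rewrite intrB intrM numqE -pmulrn.
  have -> : (m%:R * (denq x)%:~R - x * (denq x)%:~R) / p%:R ^+ M =
     - ((denq x)%:~R * p%:R ^+ N.+1 * ((x - m%:R) / p%:R ^+ (M + N.+1))).
    by rewrite exprD; field; rewrite !expf_neq0.
  apply: pintN => //; apply: pintM => //; apply: pintM; rewrite ?pint_intr //.
  by apply: pintX => //; apply: pint_natr.
rewrite -(hM m m0 hm2); apply: gn_cong => //; exact: cong.
Qed.

End MoritaGamma.

Definition pcount p n := (\sum_(0 <= l < n) ~~ (p %| l))%N.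

Lemma pcountS p n : (0 < p)%N -> pcount p n.+1 = (n - n %/ p)%N.
Proof.
move=> p0; elim: n => [|n IHn]; first by rewrite /pcount big_nat1 dvdn0 div0n.
rewrite /pcount big_nat_recr //= -/(pcount p n.+1) IHn divnS //.
have : (n %/ p <= n)%N by rewrite leq_div.
by case: (p %| n.+1)%N => /=; lia.
Qed.

(** * Functional equation, reflection and multiplication formula of the gamma function *)

Section GammaFunctional.
Variables (p : nat) (p_pr : prime p) (p_odd : odd p) (N : nat).
Local Notation Z := 'Z_(p ^ N.+1).
Local Notation G := (gammap p N).
Let p0 := prime_gt0 p_pr.
Let p1 := prime_gt1 p_pr.
Let pnz : (p%:R : rat) != 0. Proof. by rewrite pnatr_eq0 -lt0n. Qed.
Let Pnz : (p%:R ^+ N.+1 : rat) != 0. Proof. exact: expf_neq0. Qed.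

Definition pcong (x y : rat) := pint p ((x - y) / p%:R ^+ N.+1).

Lemma pcong_sym x y : pcong x y -> pcong y x.
Proof. by rewrite /pcong => h; rewrite -opprB mulNr; apply: pintN. Qed.

Lemma pcong_trans x y z : pcong x y -> pcong y z -> pcong x z.
Proof.
rewrite /pcong => h1 h2; have -> : x - z = (x - y) + (y - z) by ring.
by rewrite mulrDl; apply: pintD.
Qed.

Lemma pcongM c x y : pint p c -> pcong x y -> pcong (c * x) (c * y).
Proof. by move=> pc h; rewrite /pcong -mulrBr -mulrA; apply: pintM. Qed.

Lemma pcongDl c x y : pcong x y -> pcong (c + x) (c + y).
Proof. by rewrite /pcong => h; have -> : c + x - (c + y) = x - y by ring. Qed.

Lemma pcong_near x : pint p x -> exists n, (0 < n)%N /\ pcong x n%:R.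
Proof. exact: near_exists. Qed.

Lemma pcong_zmodp x y : pcong x y -> pint p y -> zmodp p N x = zmodp p N y.
Proof. by move=> h py; have [] := zmodp_cong p_pr py h. Qed.

Lemma gammap_cong x y : pint p x -> pcong x y -> G x = G y.
Proof.
move=> px h; have [n [n0 hn]] := pcong_near px.
by rewrite (gammapE p_pr p_odd n0 hn) (gammapE p_pr p_odd n0 (pcong_trans (pcong_sym h) hn)).
Qed.

Lemma gammap_unit x : pint p x -> G x \is a GRing.unit.
Proof.
by move=> px; have [n [n0 hn]] := pcong_near px; rewrite (gammapE p_pr p_odd n0 hn) gn_unit.
Qed.

Lemma gammap0 : G 0 = 1.
Proof.
have P0 : (0 < p ^ N.+1)%N by rewrite expn_gt0 p0.
rewrite (gammapE p_pr p_odd P0); last first.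
  by rewrite sub0r natrX mulNr divff // (pint_intr p (-1)).
have := @gn_period p p_pr p_odd N 1 1 isT; rewrite mul1n add1n gnS // /pval dvdn_exp // mulr1.
by rewrite [gn _ _ 1]gnE big_geq // expr1 mulr1 => /oppr_inj.
Qed.

Lemma gammap1 : G 1 = -1.
Proof.
rewrite (@gammapE _ p_pr p_odd N _ 1) // ?subrr ?mul0r ?pint0 //.
by rewrite gnE big_geq // expr1 mulr1.
Qed.

Definition gfac (x : rat) : Z := if pint p (x / p%:R) then -1 else - zmodp p N x.

Lemma pint_divp_nat n : pint p (n%:R / p%:R) = (p %| n)%N.
Proof.
apply/idP/idP => [h|/dvdnP[k ->]]; last by rewrite natrM mulfK // pint_natr.
by have := @pint_divX_int p p_pr 1 n%:Z; rewrite -pmulrn expr1 expn1 => /(_ h).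
Qed.

Lemma gammapS x : pint p x -> G (x + 1) = G x * gfac x.
Proof.
move=> px; have [n [n0 hn]] := pcong_near px.
rewrite (gammapE p_pr p_odd n0 hn) (@gammapE _ p_pr p_odd N _ n.+1) //; last first.
  by rewrite -natr1 opprD addrACA subrr addr0.
rewrite gnS // -mulrN; congr (_ * _); rewrite /pval /gfac.
have -> : pint p (x / p%:R) = (p %| n)%N.
  rewrite -pint_divp_nat.
  have e : (x - n%:R) / p%:R = p%:R ^+ N * ((x - n%:R) / p%:R ^+ N.+1).
    by rewrite exprS; field; rewrite pnz expf_neq0.
  have h : pint p ((x - n%:R) / p%:R).
    by rewrite e; apply: pintM => //; apply: pintX => //; apply: pint_natr.
  apply/idP/idP => hh.
    by have -> : n%:R / p%:R = x / p%:R - (x - n%:R) / p%:R; [ring | apply: pintB].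
  by have -> : x / p%:R = n%:R / p%:R + (x - n%:R) / p%:R; [ring | apply: pintD].
by case: ifP => // _; rewrite (pcong_zmodp hn) ?pint_natr // zmodp_natr.
Qed.

(** Squaring removes the sign of the reflection formula, which is enough for its later use with the
    even exponent d - 1. By continuity x may be a natural number n; the step to n + 1 holds because
    [gfac] has equal squares at n and - n. *)
Lemma gammap_reflect x : pint p x -> (G x * G (1 - x)) ^+ 2 = 1.
Proof.
move=> px; have [n [n0 hn]] := pcong_near px.
have p1x : pint p (1 - x) by apply: pintB; rewrite ?pint1.
have h1 : pcong (1 - x) (1 - n%:R).
  rewrite /pcong; have -> : 1 - x - (1 - n%:R) = - (x - n%:R) by ring.
  by rewrite mulNr; apply: pintN.
rewrite (gammap_cong px hn) (gammap_cong p1x h1) {px hn p1x h1 n0 x}.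
elim: n => [|n IHn]; first by rewrite subr0 gammap0 gammap1 mul1r sqrrN expr1n.
have pn : pint p (- n%:R) by apply: pintN; rewrite ?pint_natr.
have e1 : G n.+1%:R = G n%:R * gfac n%:R by rewrite -natr1 gammapS ?pint_natr.
have e2 : G (1 - n%:R) = G (- n%:R) * gfac (- n%:R) by rewrite addrC gammapS.
have e3 : gfac (- n%:R) ^+ 2 = gfac n%:R ^+ 2.
  rewrite /gfac mulNr; have -> : pint p (- (n%:R / p%:R)) = pint p (n%:R / p%:R).
    by apply/idP/idP => h; [rewrite -[_ / _]opprK|]; apply: pintN.
  by case: ifP => // _; rewrite zmodpN ?pint_natr // opprK sqrrN.
have -> : 1 - n.+1%:R = - n%:R :> rat by rewrite -natr1 opprD addrCA subrr addr0.
by rewrite -IHn e1 e2 !exprMn e3; ring.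
Qed.

Variables (d : nat) (d_ndvd : ~~ (p %| d)%N).

(* Gauss's multiplication formula; the power of d counts the integers below n that
   are prime to p. *)
Lemma gammap_mult n :
  (\prod_(i < d) G ((n + i)%N%:R / d%:R)) * d%:R ^+ pcount p n =
  G n%:R * \prod_(i < d) G (i%:R / d%:R).
Proof.
have d0 : (0 < d)%N by rewrite lt0n; apply: contraNneq d_ndvd => ->; rewrite dvdn0.
have dnz : (d%:R : rat) != 0 by rewrite pnatr_eq0 -lt0n.
have pdV : pint p d%:R^-1 by apply: pintV.
have pd m : pint p (m%:R / d%:R) by apply: pintM; rewrite ?pint_natr.
elim: n => [|n IHn].
  by rewrite /pcount big_geq // expr0 mulr1 gammap0 mul1r.
(* The window of d arguments moves by 1/d: n/d leaves it and n/d + 1 enters. *)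
have e1 : \prod_(i < d) G ((n.+1 + i)%N%:R / d%:R) =
    (\prod_(i < d) G ((n + i)%N%:R / d%:R)) * gfac (n%:R / d%:R).
  rewrite -!(big_mkord xpredT (fun i => G ((_ + i)%N%:R / d%:R))).
  have -> : \prod_(0 <= i < d) G ((n.+1 + i)%N%:R / d%:R) = \prod_(1 <= i < d.+1) G ((n + i)%N%:R / d%:R).
    rewrite -(add0n 1%N) -[d.+1]addn1 big_addn addnK; apply: eq_bigr => i _.
    by rewrite addnA addn1 addSn.
  rewrite big_nat_recr //= [in RHS]big_ltn // addn0 natrD mulrDl divff // gammapS //; ring.
have e2 : G n.+1%:R = G n%:R * gfac n%:R by rewrite -natr1 gammapS ?pint_natr.
have e3 : gfac (n%:R / d%:R) * d%:R ^+ (~~ (p %| n)%N) = gfac n%:R.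
  rewrite /gfac; have -> : pint p (n%:R / d%:R / p%:R) = (p %| n)%N.
    rewrite -pint_divp_nat; apply/idP/idP => h.
      have -> : n%:R / p%:R = d%:R * (n%:R / d%:R / p%:R) :> rat by field; rewrite pnz dnz.
      by apply: pintM; rewrite ?pint_natr.
    have -> : n%:R / d%:R / p%:R = d%:R^-1 * (n%:R / p%:R) :> rat by ring.
    exact: pintM.
  rewrite pint_divp_nat; case: (p %| n)%N; first by rewrite mulr1.
  rewrite expr1 mulNr -[X in _ * X](zmodp_natr p N d) -zmodpM ?pint_natr // divfK //.
rewrite e1 /pcount big_nat_recr //= exprD -/(pcount p n) e2 -e3.
by have -> : forall a b c e : Z, a * b * (c * e) = (a * c) * (b * e); [move=> *; ring | rewrite IHn; ring].
Qed.

End GammaFunctional.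

(** * Gauss and Jacobi sums as values of the gamma function *)

Section Digits.
Variables (p : nat) (p_pr : prime p) (r : nat).
Local Notation q := (p ^ r)%N.
Let p0 := prime_gt0 p_pr.
Let p1 := prime_gt1 p_pr.
Let q0 : (0 < q)%N. Proof. by rewrite expn_gt0 p0. Qed.

Definition geomq k := (\sum_(i < k) q ^ i)%N.

Lemma geomE k : ((q - 1) * geomq k = q ^ k - 1)%N.
Proof. by rewrite !subn1 (predn_exp q k). Qed.

Lemma geomS k : (geomq k.+1 = q * geomq k + 1)%N.
Proof.
rewrite /geomq big_ord_recl expn0 addnC big_distrr; congr (_ + _)%N.
by apply: eq_bigr => i _; rewrite /= -expnS.
Qed.

(* Multiplication by p^l modulo q - 1, i.e. rotation of the r base-p digits of a. *)
Definition drot a l := ((a * p ^ l) %% (q - 1))%N.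

(** With M = a (q^k - 1) / (q - 1), this is q M + a for i = 0 and M for i = r. The steps between are
    divisions by p, so [fact_pfact] unwinds (q M + a)! / M! in r steps. *)
Definition nn a k i := ((a * geomq k.+1) %/ p ^ i)%N.

Variable a : nat.
Hypothesis a_bound : (0 < a < q - 1)%N.
Let a0 : (0 < a)%N. Proof. by case/andP: a_bound. Qed.
Let aq1 : (a < q - 1)%N. Proof. by case/andP: a_bound. Qed.
Let aq : (a < q)%N. Proof. by apply: leq_trans aq1 _; rewrite leq_subr. Qed.

Lemma coprime_q1 l : coprime (q - 1) (p ^ l).
Proof.
have r0 : (0 < r)%N by rewrite lt0n; apply/eqP => er; move: aq1; rewrite er.
rewrite coprimeXr // coprime_sym prime_coprime //; apply/negP => h.
have : (p %| q - (q - 1))%N by apply: dvdn_sub => //; apply: dvdn_exp.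
by rewrite subKn // => /dvdn_leq => /(_ isT); rewrite leqNgt p1.
Qed.

Lemma drot_gt0 l : (0 < drot a l)%N.
Proof.
rewrite lt0n; apply/negP => /eqP h; have : (q - 1 %| a * p ^ l)%N by rewrite /dvdn -/(drot a l) h.
by rewrite Gauss_dvdl ?coprime_q1 // => /dvdn_leq; lia.
Qed.

Lemma drot_lt l : (drot a l < q - 1)%N.
Proof. by rewrite ltn_mod; apply: leq_trans aq1. Qed.

Lemma drotE i : (i <= r)%N -> (drot a (r - i) = (a %% p ^ i) * p ^ (r - i) + a %/ p ^ i)%N.
Proof.
move=> leir; set B := (_ + _)%N.
have pi0 : (0 < p ^ i)%N by rewrite expn_gt0 p0.
have qE : (p ^ (r - i) * p ^ i = q)%N by rewrite -expnD subnK.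
have e : (a * p ^ (r - i) = (a %/ p ^ i) * (q - 1) + B)%N.
  rewrite /B {1}(divn_eq a (p ^ i)) mulnDl -mulnA [(p ^ i * _)%N]mulnC qE.
  rewrite mulnBr muln1; have : (a %/ p ^ i <= a %/ p ^ i * q)%N by rewrite leq_pmulr.
  by move: (a %/ p ^ i * q)%N (a %% p ^ i * p ^ (r - i))%N (a %/ p ^ i)%N; lia.
have leB : (B <= q - 1)%N.
  have h1 : (a %/ p ^ i < p ^ (r - i))%N by rewrite ltn_divLR // qE.
  have h2 : (a %% p ^ i < p ^ i)%N by rewrite ltn_mod.
  have h3 : ((a %% p ^ i).+1 * p ^ (r - i) <= q)%N by rewrite -qE mulnC leq_mul2l h2 orbT.
  by move: h1 h3; rewrite /B mulSn; move: (a %% p ^ i * _)%N; lia.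
have Bne : B != (q - 1)%N.
  apply/eqP => eB; have : (q - 1 %| a * p ^ (r - i))%N by rewrite e eB -mulSnr dvdn_mull.
  by rewrite Gauss_dvdl ?coprime_q1 // => /dvdn_leq; lia.
by rewrite /drot e modnMDl modn_small // ltn_neqAle Bne.
Qed.

Lemma drot_r : drot a r = a.
Proof. by have := @drotE 0 (leq0n _); rewrite subn0 expn0 modn1 divn1. Qed.

(** The right-hand side is p-adically small, so [nn a k i] is close to - drot a (r - i) / (q - 1).
    This produces the arguments of the gamma function in the Gross-Koblitz formula. *)
Lemma nn_rot k i : (i <= r)%N ->
  ((q - 1) * nn a k i + drot a (r - i) = a * p ^ (r * k.+1 - i))%N.
Proof.
move=> leir; have pi0 : (0 < p ^ i)%N by rewrite expn_gt0 p0.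
have qE : (p ^ (r - i) * p ^ i = q)%N by rewrite -expnD subnK.
have em : ((a * geomq k.+1) %% p ^ i = a %% p ^ i)%N.
  rewrite geomS; move: (geomq k) => g.
  have -> : (a * (q * g + 1) = (a * p ^ (r - i) * g) * p ^ i + a)%N by rewrite -qE; ring.
  by rewrite modnMDl.
have e := divn_eq (a * geomq k.+1) (p ^ i); rewrite em -/(nn a k i) in e.
have h : ((q - 1) * (a * geomq k.+1) = a * (q ^ k.+1 - 1))%N by rewrite mulnCA geomE.
rewrite drotE //; apply/eqP; rewrite -(eqn_pmul2r pi0); apply/eqP.
have -> : (a * p ^ (r * k.+1 - i) * p ^ i = a * q ^ k.+1)%N.
  by rewrite -mulnA -expnD subnK ?expnM // (leq_trans leir) // mulnS leq_addr.
have ea := divn_eq a (p ^ i).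
move: h; rewrite {1}e mulnBr muln1 => h.
have qk : (a <= a * q ^ k.+1)%N by rewrite leq_pmulr // expn_gt0 q0.
have -> : (a * q ^ k.+1 = (q - 1) * (nn a k i * p ^ i + a %% p ^ i) + (a %/ p ^ i * p ^ i + a %% p ^ i))%N.
  by rewrite -ea h subnK.
have hq : (p ^ (r - i) * p ^ i = q - 1 + 1)%N by rewrite qE subnK.
transitivity ((q - 1) * (nn a k i * p ^ i) + (a %% p ^ i) * (p ^ (r - i) * p ^ i) + a %/ p ^ i * p ^ i)%N.
  by ring.
rewrite hq; move: (q - 1)%N (a %% p ^ i)%N (a %/ p ^ i * p ^ i)%N => Q m t; ring.
Qed.

Lemma nn0 k : nn a k 0 = (q * (a * geomq k) + a)%N.
Proof. by rewrite /nn expn0 divn1 geomS; ring. Qed.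

Lemma nnS k i : nn a k i.+1 = (nn a k i %/ p)%N.
Proof. by rewrite /nn expnSr divnMA. Qed.

Lemma nn_r k : nn a k r = (a * geomq k)%N.
Proof. by rewrite /nn geomS mulnDr muln1 mulnCA mulnC divnMDl // divn_small ?addn0. Qed.

Lemma nn_diff k : (nn a k 0 - nn a k r = a * q ^ k)%N.
Proof.
rewrite nn0 nn_r; have := geomE k; move: (geomq k) => g hg.
have : (0 < q ^ k)%N by rewrite expn_gt0 q0.
have : (q = q - 1 + 1)%N by rewrite subnK.
move: hg; move: (q - 1)%N (q ^ k)%N => Q X hg eq X0; rewrite eq.
have : (X = Q * g + 1)%N by lia.
move=> ->; have -> : ((Q + 1) * (a * g) + a = a * (Q * g + 1) + a * g)%N by ring.
by rewrite addnK.
Qed.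

Lemma nn_le k : (nn a k r <= nn a k 0)%N.
Proof. by rewrite nn0 nn_r (leq_trans _ (leq_addr _ _)) // leq_pmull. Qed.

Definition nsum k := (\sum_(i < r) nn a k i.+1)%N.

Lemma sum_rot : (\sum_(i < r) drot a (r - i.+1) = \sum_(l < r) drot a l)%N.
Proof. by rewrite [RHS](reindex_inj rev_ord_inj). Qed.

Lemma nsum_rot k : ((p - 1) * ((q - 1) * nsum k) + (p - 1) * (\sum_(l < r) drot a l)
   = (q - 1) * (a * q ^ k))%N.
Proof.
rewrite -sum_rot -mulnDr /nsum big_distrr -big_split /=.
rewrite (eq_bigr (fun i : 'I_r => a * q ^ k * p ^ (r - i.+1)))%N; last first.
  move=> i _; rewrite nn_rot // -mulnA -expnM -expnD; congr (_ * p ^ _)%N.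
  by rewrite mulnS; have := ltn_ord i; lia.
have e : ((p - 1) * \sum_(i < r) p ^ (r - i.+1) = q - 1)%N.
  rewrite !subn1 predn_exp; congr (_ * _)%N.
  by rewrite [RHS](reindex_inj rev_ord_inj).
by rewrite -big_distrr /= mulnCA e mulnC.
Qed.

(** s is the sum of the base-p digits of a, Stickelberger's exponent of pi: the r rotations of a add
    up to s (q - 1) / (p - 1). *)
Lemma digit_sum_exists k : exists s,
  [/\ (s + (p - 1) * nsum k = a * q ^ k)%N
    & ((q - 1) * s = (p - 1) * \sum_(l < r) drot a l)%N].
Proof.
have h := nsum_rot k; have q10 : (0 < q - 1)%N by apply: leq_trans aq1.
have le : ((p - 1) * nsum k <= a * q ^ k)%N.
  by rewrite -(leq_pmul2l q10) mulnCA -h leq_addr.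
exists (a * q ^ k - (p - 1) * nsum k)%N; split; first by rewrite subnK.
by rewrite mulnBr -h mulnCA addKn.
Qed.

End Digits.

Lemma fact_nn p r a k : prime p -> forall i,
  ((nn p r a k 0)`! = p ^ (\sum_(l < i) nn p r a k l.+1) * (nn p r a k i)`! *
     \prod_(l < i) pfact p (nn p r a k l))%N.
Proof.
move=> p_pr; elim=> [|i IHi]; first by rewrite !big_ord0 mul1n muln1.
rewrite IHi !big_ord_recr /= expnD (fact_pfact p_pr (nn p r a k i)) -nnS; ring.
Qed.

Section GaussGamma.
Variables (p : nat) (p_pr : prime p) (p_odd : odd p) (r N : nat) (r_gt0 : (0 < r)%N).
Local Notation q := (p ^ r)%N.
Variables (F : finFieldType) (cardF : #|F| = q).
Variables (A : comNzRingType) (iota : {rmorphism 'Z_(p ^ N.+1) -> A}).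
Variables (pi : A) (piE : pi ^+ (p - 1) = - p%:R).
Variable om : F -> A.
Hypotheses (om0 : om 0 = 0) (om1 : om 1 = 1) (omM : {morph om : x y / x * y}).
Hypothesis omD : forall x y, exists c, om (x + y) = om x + om y + p%:R * c.
Let p0 := prime_gt0 p_pr.
Let p1 := prime_gt1 p_pr.
Let p10 : (0 < p - 1)%N. Proof. by rewrite subn_gt0. Qed.
Let pnz : (p%:R : rat) != 0. Proof. by rewrite pnatr_eq0 -lt0n. Qed.

Definition ngamma a k : 'Z_(p ^ N.+1) := \prod_(i < r) gn p N (nn p r a k i).+1.

Lemma pfact_gn n : (pfact p n)%:R = (-1) ^+ n.+1 * gn p N n.+1 :> 'Z_(p ^ N.+1).
Proof.
rewrite gnE mulrA -exprMn mulrN1 opprK expr1n mul1r /pfact natr_prod big_mkcond.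
by apply: eq_bigr => j _; rewrite /pval; case: (p %| j)%N.
Qed.

Lemma zmodp_pfactV n : zmodp p N (pfact p n)%:R^-1 = (-1) ^+ n.+1 * (gn p N n.+1)^-1.
Proof.
have ug := gn_unit p_pr N n.+1.
have up := unit_Zpn p_pr N (pfact_ndvd p_pr n).
have pi1 : pint p (pfact p n)%:R^-1 by apply: pintV; rewrite ?pfact_ndvd.
apply: (mulIr up); rewrite -{1}(zmodp_natr p N (pfact p n)) -zmodpM ?pint_natr //.
rewrite mulVf ?(zmodp_natr p N 1); last by rewrite pnatr_eq0 -lt0n pfact_gt0.
by rewrite pfact_gn mulrACA -exprMn mulrN1 opprK expr1n mul1r mulVr.
Qed.

(** Gross-Koblitz: the powers of p in the factorials and in varpi^M combine with pi^a to pi^s, while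
    the parts of the factorials prime to p are gamma values at integers approximating the true
    arguments. *)
Lemma gauss_gamma a : (0 < a < q - 1)%N -> exists k0, forall k, (k0 <= k)%N ->
  forall s, (s + (p - 1) * nsum p r a k = a * q ^ k)%N ->
  gauss r iota pi om a = (-1) ^+ (a + r).+1 * pi ^+ s * iota (ngamma a k)^-1.
Proof.
move=> ha; have [k0 hk] := gauss_eval p_pr r_gt0 cardF iota piE om1 omM omD ha.
exists k0 => k lek s es; set M := (a * geomq p r k)%N.
have hM : (a + (q - 1) * M = a * q ^ k)%N.
  rewrite /M mulnCA geomE // mulnBr muln1 subnKC // leq_pmulr // expn_gt0 expn_gt0 p0 //.
have [_ ->] := hk k M lek hM; rewrite /ev.
have eq1 := repunitE p_pr r.
pose t := (a %/ (p - 1) + repunit p r * M - nsum p r a k)%N.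
have leS : (nsum p r a k <= a %/ (p - 1) + repunit p r * M)%N.
  rewrite addnC -divnMDl // leq_divRL //.
  have -> : (repunit p r * M * (p - 1) + a = a + (q - 1) * M)%N by rewrite -eq1; ring.
  by rewrite hM -es mulnC leq_addl.
have est : (s = a %% (p - 1) + (p - 1) * t)%N.
  have h := divn_eq a (p - 1); apply/eqP; rewrite -(eqn_add2r ((p - 1) * nsum p r a k)) es -hM -eq1.
  rewrite -addnA -mulnDr /t subnK // {1}h mulnDr -mulnA; apply/eqP; ring.
have aq : (a < q)%N by case/andP: ha => _ /leq_trans; apply; rewrite leq_subr.
have nS := @fact_nn p r a k p_pr r; rewrite nn0 nn_r // -/M -/(nsum p r a k) in nS.
set S := nsum p r a k in nS es t leS est *.
have -> : (- p%:R) ^+ (a %/ (p - 1)) * (M`!%:R * varpi p r ^+ M / (q * M + a)`!%:R) =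
   (- p%:R) ^+ t * ((-1) ^+ S * \prod_(l < r) (pfact p (nn p r a k l))%:R^-1) :> rat.
  have h : (- p%:R) ^+ (a %/ (p - 1)) * varpi p r ^+ M = (- p%:R) ^+ t * ((-1) ^+ S * p%:R ^+ S) :> rat.
    by rewrite /varpi -exprM -exprD -exprNn -exprD /t subnK.
  rewrite nS !natrM natrX natr_prod prodfV; set Q := \prod_(l < r) _.
  have Q0 : Q != 0 by apply/prodf_neq0 => l _; rewrite pnatr_eq0 -lt0n pfact_gt0.
  move: (factr_neq0 M) (expf_neq0 S pnz) => x0 y0.
  transitivity ((- p%:R) ^+ (a %/ (p - 1)) * varpi p r ^+ M * (M`!%:R / (p%:R ^+ S * M`!%:R * Q))).
    by ring.
  rewrite h; move: (M`!%:R) (p%:R ^+ S) x0 y0 => x y x0 y0.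
  by field; rewrite x0 y0 Q0.
have piV n : pint p (pfact p n)%:R^-1 by apply: pintV; rewrite ?pfact_ndvd.
have pprod : pint p (\prod_(l < r) (pfact p (nn p r a k l))%:R^-1) by apply: pint_prod.
have pNp : pint p (- p%:R) by apply: pintN; rewrite ?pint_natr.
have pS : pint p ((-1) ^+ S) by apply: pint_sign.
rewrite zmodpM //; [|by apply: pintX|by apply: pintM].
rewrite zmodpM // !zmodpX //; last exact: (pint_intr p (-1)).
rewrite zmodpN ?pint_natr // zmodp_natr.
rewrite (zmodp_intr p N (-1)) zmodp_prod //.
rewrite (eq_bigr (fun l : 'I_r => (-1) ^+ (nn p r a k l).+1 * (gn p N (nn p r a k l).+1)^-1)); last first.
  by move=> l _; rewrite zmodp_pfactV.
rewrite big_split /= prodrV; last by move=> l _; apply: gn_unit.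
rewrite -/(ngamma a k) !rmorphM !rmorphXn rmorphN rmorph_nat rmorphN1 est exprD exprM piE.
rewrite rmorph_prod (eq_bigr (fun l : 'I_r => (-1) ^+ (nn p r a k l).+1)); last first.
  by move=> l _; rewrite rmorphXn rmorphN1.
rewrite prodrXr.
(* The sum of the [nn p r a k l] telescopes to a q^k + S, and q is odd. *)
have par : (-1) ^+ S * (-1) ^+ (\sum_(l < r) (nn p r a k l).+1) = (-1) ^+ (a + r) :> A.
  have e1 : (\sum_(l < r) nn p r a k l + nn p r a k r = nn p r a k 0 + S)%N.
    transitivity (\sum_(l < r.+1) nn p r a k l)%N; first by rewrite big_ord_recr.
    by rewrite big_ord_recl.
  have e2 : (\sum_(l < r) nn p r a k l = a * q ^ k + S)%N.
    have := nn_diff p_pr ha k; have := nn_le p_pr ha k.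
    by move: e1; move: (\sum_(l < r) nn p r a k l)%N; clear; lia.
  have -> : (\sum_(l < r) (nn p r a k l).+1 = \sum_(l < r) nn p r a k l + r)%N.
    under eq_bigr do rewrite -addn1.
    by rewrite big_split sum1_card card_ord.
  rewrite e2 -exprD -signr_odd -[RHS]signr_odd !oddD oddM !oddX p_odd !orbT andbT.
  by case: (odd S); case: (odd a); case: (odd r).
by rewrite exprS mulN1r -par; ring.
Qed.
End GaussGamma.

(** * Carries when the rotations of j are multiplied by d *)

Section CarrySum.
Variables (p : nat) (p_pr : prime p) (r d j : nat).
Local Notation q := (p ^ r)%N.
Hypothesis d_cop : coprime (q - 1) d.
Hypothesis j_bound : (0 < j < q - 1)%N.

Definition jmul := ((d * j) %% (q - 1))%N.
(** The number of m from 1 to d - 1 with m / d below drot(j, l) / (q - 1); it becomes the exponent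
    of p in McCarthy's factors. *)
Definition carry l := ((d * drot p r j l) %/ (q - 1))%N.
Definition carries := (\sum_(l < r) carry l)%N.

Lemma ndvd_mul : ~~ (q - 1 %| d * j)%N.
Proof.
rewrite Gauss_dvdr //; apply/negP => /dvdn_leq.
by case/andP: j_bound => j0 jq => /(_ j0); rewrite leqNgt jq.
Qed.

Lemma jmul_bound : (0 < jmul < q - 1)%N.
Proof.
rewrite lt0n ltn_mod; case/andP: j_bound => j0 jq.
by rewrite (leq_trans _ jq) // andbT; apply: ndvd_mul.
Qed.

Lemma carryE l : (d * drot p r j l = carry l * (q - 1) + drot p r jmul l)%N.
Proof.
rewrite {1}(divn_eq (d * drot p r j l) (q - 1)) -/(carry l); congr (_ + _)%N.
by rewrite /drot /jmul modnMml modnMmr mulnA.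
Qed.

(** Compares Stickelberger's exponents for the d-th power of the Gauss sum at j and for the Gauss
    sum at d j; the quotient is (- p)^carries. *)
Lemma carries_sum s s' : ((q - 1) * s = (p - 1) * \sum_(l < r) drot p r j l)%N ->
  ((q - 1) * s' = (p - 1) * \sum_(l < r) drot p r jmul l)%N ->
  (d * s = (p - 1) * carries + s')%N.
Proof.
move=> h h'; have q10 : (0 < q - 1)%N by case/andP: j_bound => _; apply: leq_trans.
apply/eqP; rewrite -(eqn_pmul2l q10) mulnCA h mulnCA big_distrr /=.
rewrite (eq_bigr _ (fun (l : 'I_r) _ => carryE l)) big_split /= -big_distrl /= !mulnDr h' -/carries.
by apply/eqP; congr (_ + _)%N; ring.
Qed.

Lemma digit_sum_le s : ((q - 1) * s = (p - 1) * \sum_(l < r) drot p r j l)%N -> (s <= (p - 1) * r)%N.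
Proof.
move=> h; have q10 : (0 < q - 1)%N by case/andP: j_bound => _; apply: leq_trans.
rewrite -(leq_pmul2l q10) h mulnCA leq_mul2l; apply/orP; right.
rewrite mulnC -[X in (_ <= X * _)%N]card_ord -sum_nat_const.
by apply: leq_sum => l _; apply: ltnW; apply: drot_lt.
Qed.
End CarrySum.

Section JacobiGamma.
Variables (p : nat) (p_pr : prime p) (p_odd : odd p) (r N : nat) (r_gt0 : (0 < r)%N).
Local Notation q := (p ^ r)%N.
Variables (F : finFieldType) (cardF : #|F| = q).
Variables (A : comNzRingType) (iota : {rmorphism 'Z_(p ^ N.+1) -> A}).
Variables (pi : A) (piE : pi ^+ (p - 1) = - p%:R).
Variable om : F -> A.
Hypotheses (om0 : om 0 = 0) (om1 : om 1 = 1) (omM : {morph om : x y / x * y}).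
Hypothesis omD : forall x y, exists c, om (x + y) = om x + om y + p%:R * c.
Variables (d : nat) (d_odd : odd d) (d_gt1 : (1 < d)%N) (d_cop : coprime (q - 1) d).
Let p0 := prime_gt0 p_pr.
Let p1 := prime_gt1 p_pr.

Lemma om_period x m : x != 0 -> om x^-1 ^+ m = om x^-1 ^+ (m %% (q - 1)).
Proof.
move=> x0; rewrite {1}(divn_eq m (q - 1)) exprD mulnC exprM (om_exp om1 omM _ (q - 1)).
by rewrite (fermat p_pr cardF) ?invr_eq0 // om1 expr1n mul1r.
Qed.

Lemma jacobi_gamma j : (0 < j < q - 1)%N -> exists k0, forall k, (k0 <= k)%N ->
  p%:R ^+ (d.-1 * r) * jacobi om d j =
  (-1) ^+ carries p r d j * p%:R ^+ (d.-1 * r + carries p r d j) *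
  iota (ngamma p r N (jmul p r d j) k * (ngamma p r N j k)^-1 ^+ d).
Proof.
move=> hj; have hj' := jmul_bound d_cop hj; set j' := jmul p r d j in hj' *.
have [k1 h1] := gauss_gamma p_pr p_odd r_gt0 cardF iota piE om1 omM omD hj.
have [k2 h2] := gauss_gamma p_pr p_odd r_gt0 cardF iota piE om1 omM omD hj'.
exists (k1 + k2)%N => k lek.
have [s [es hs]] := digit_sum_exists p_pr hj k.
have [s' [es' hs']] := digit_sum_exists p_pr hj' k.
have e1 := h1 k (leq_trans (leq_addr _ _) lek) s es.
have e2 := h2 k (leq_trans (leq_addl _ _) lek) s' es'.
have hd := carries_sum hj hs hs'; have les' := digit_sum_le hj' hs'.
set E := carries p r d j in hd *.
have cancel := om_cancel p_pr iota om1 omM omD.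
have psiD' := psiD p_pr r_gt0 cardF iota piE om1 omM omD.
have psi0' := psi0 p_pr r iota pi om0.
have ec := exp_neq1 p_pr r_gt0 cardF (ndvd_mul d_cop hj).
have := jacobi_gsum om1 omM cancel psi0' psiD' ec.
have -> : gsum om (psi r iota pi om) (d * j) = gauss r iota pi om j'.
  by rewrite /gsum /gauss; apply: eq_bigr => x x0; rewrite (om_period (d * j)%N x0).
rewrite -[gsum om _ j]/(gauss r iota pi om j) e1 e2 !exprMn -!exprM => h.
(* As d is odd and q - 1 even, j' has the parity of j. *)
have par : (-1) ^+ ((j + r).+1 * d) = (-1) ^+ (j' + r).+1 :> A.
  have oj : odd j' = odd j.
    have /(congr1 odd) := divn_eq (d * j) (q - 1).
    rewrite oddD !oddM d_odd /= oddB ?expn_gt0 ?p0 // oddX p_odd orbT /= andbF /= => ->.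
    by [].
  by rewrite -signr_odd oddM d_odd andbT /= oddD -oj -oddD -[~~ _]/(odd (j' + r).+1) signr_odd.
have ug : ngamma p r N j' k \is a GRing.unit by apply: rpred_prod => i _; apply: gn_unit.
have h3 : jacobi om d j * pi ^+ s' = pi ^+ (s * d) *
    iota (ngamma p r N j' k * (ngamma p r N j k)^-1 ^+ d).
  have sg : (-1) ^+ (j' + r).+1 * (-1) ^+ (j' + r).+1 = 1 :> A by rewrite -exprMn mulrN1 opprK expr1n.
  have ig : iota (ngamma p r N j' k)^-1 * iota (ngamma p r N j' k) = 1 by rewrite -rmorphM mulVr // rmorph1.
  rewrite par in h; move/(congr1 (fun x => (-1) ^+ (j' + r).+1 * iota (ngamma p r N j' k) * x)): h => h.
  transitivity (((-1) ^+ (j' + r).+1 * (-1) ^+ (j' + r).+1) *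
     (iota (ngamma p r N j' k)^-1 * iota (ngamma p r N j' k)) * (jacobi om d j * pi ^+ s')).
    by rewrite sg ig !mul1r.
  transitivity ((-1) ^+ (j' + r).+1 * iota (ngamma p r N j' k) *
    (jacobi om d j * ((-1) ^+ (j' + r).+1 * pi ^+ s' * iota (ngamma p r N j' k)^-1))); first by ring.
  rewrite h rmorphM rmorphXn /=.
  transitivity (((-1) ^+ (j' + r).+1 * (-1) ^+ (j' + r).+1) * (pi ^+ (s * d) *
    (iota (ngamma p r N j' k) * iota (ngamma p r N j k)^-1 ^+ d))); first by ring.
  by rewrite sg mul1r.
(* pi^s' cannot be cancelled in A. Multiplying by pi^((p - 1) r - s') turns it into (- p)^r instead,
   and the scaling p^((d - 1) r) has room for this factor since d > 1. *)
have h4 : jacobi om d j * (- p%:R) ^+ r = (- p%:R) ^+ (E + r) *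
    iota (ngamma p r N j' k * (ngamma p r N j k)^-1 ^+ d).
  rewrite -piE -!exprM -(subnKC les') exprD mulrA h3 mulrAC -exprD; congr (pi ^+ _ * _).
  by rewrite [(s * d)%N]mulnC hd mulnDr -addnA subnKC.
have sr : (-1) ^+ r * (-1) ^+ r = 1 :> A by rewrite -exprMn mulrN1 opprK expr1n.
have ed : (d.-1 * r = (d - 2) * r + r)%N by rewrite -mulSnr; congr (_ * _)%N; lia.
move: h4; rewrite exprNn [(- p%:R) ^+ _]exprNn => h4.
have h5 : jacobi om d j * p%:R ^+ r = (-1) ^+ E * p%:R ^+ (E + r) *
    iota (ngamma p r N j' k * (ngamma p r N j k)^-1 ^+ d).
  move/(congr1 (fun x => (-1) ^+ r * x)): h4 => h4.
  transitivity (((-1) ^+ r * (-1) ^+ r) * (jacobi om d j * p%:R ^+ r)); first by rewrite sr mul1r.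
  transitivity ((-1) ^+ r * (jacobi om d j * ((-1) ^+ r * p%:R ^+ r))); first by ring.
  rewrite h4 exprD.
  transitivity (((-1) ^+ r * (-1) ^+ r) * ((-1) ^+ E * p%:R ^+ (E + r) *
    iota (ngamma p r N j' k * (ngamma p r N j k)^-1 ^+ d))); first by ring.
  by rewrite sr mul1r.
transitivity (p%:R ^+ ((d - 2) * r) * (jacobi om d j * p%:R ^+ r)); first by rewrite ed exprD; ring.
by rewrite h5 ed -addnA [(r + E)%N]addnC [p%:R ^+ (_ + (E + r))]exprD; ring.
Qed.

End JacobiGamma.

Lemma floor_unique (x : rat) (m : int) : m%:~R <= x -> x < (m + 1)%:~R -> Num.floor x = m.
Proof. by move=> h1 h2; apply: floor_def; rewrite h1 h2. Qed.

Lemma fracq_unique (x y : rat) (z : int) : x = z%:~R + y -> 0 <= y -> y < 1 -> Defs.fracq x = y.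
Proof.
move=> -> y0 y1; rewrite /Defs.fracq (@floor_unique _ z) ?lerDl // ?intrD ?ltrD2l //.
by rewrite addrAC subrr add0r.
Qed.

(** * McCarthy's coefficients *)

Section McFactor.
Variables (p : nat) (p_pr : prime p) (p_odd : odd p) (r N : nat) (r_gt0 : (0 < r)%N).
Local Notation q := (p ^ r)%N.
Local Notation Z := 'Z_(p ^ N.+1).
Local Notation G := (gammap p N).
Variables (d : nat) (d_pr : prime d) (d_odd : odd d) (pd : p != d) (d_cop : coprime (q - 1) d).
Variable j : nat.
Hypothesis j_bound : (0 < j < q - 1)%N.
Let p0 := prime_gt0 p_pr.
Let p1 := prime_gt1 p_pr.
Let d0 := prime_gt0 d_pr.
Let q0 : (0 < q)%N. Proof. by rewrite expn_gt0 p0. Qed.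
Let q10 : (0 < q - 1)%N. Proof. by case/andP: j_bound => _; apply: leq_trans. Qed.
Let dnz : (d%:R : rat) != 0. Proof. by rewrite pnatr_eq0 -lt0n. Qed.
Let qnz : ((q - 1)%:R : rat) != 0. Proof. by rewrite pnatr_eq0 -lt0n. Qed.
Let pnz : (p%:R : rat) != 0. Proof. by rewrite pnatr_eq0 -lt0n. Qed.
Let j'_bound := jmul_bound d_cop j_bound.
Local Notation j' := (jmul p r d j).

Let Xl l : rat := (drot p r j l)%:R / (q - 1)%:R.
(** The fractional part of m / d - Xl for m < d: a correction by 1 occurs exactly for m <= carry,
    because d Xl lies strictly between carry and carry + 1. *)
Let fr l m : rat := m%:R / d%:R - Xl l + (m <= carry p r d j l)%N%:R.

Lemma carry_lt l : (carry p r d j l < d)%N.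
Proof. by rewrite /carry ltn_divLR // ltn_pmul2l // drot_lt. Qed.

Lemma drot_jmul_bound l : (0 < drot p r j' l < q - 1)%N.
Proof. by rewrite drot_gt0 // drot_lt. Qed.

Lemma Xl_carry l : d%:R * Xl l = (carry p r d j l)%:R + (drot p r j' l)%:R / (q - 1)%:R.
Proof.
have := carryE p r d j l; move/(congr1 (fun n : nat => n%:R : rat)).
rewrite natrD !natrM /Xl => e; apply: (mulIf qnz).
transitivity (d%:R * (drot p r j l)%:R : rat); first by field.
by rewrite e; field.
Qed.

Let Xl01 l : 0 < Xl l < 1.
Proof.
have q1r : 0 < ((q - 1)%:R : rat) by rewrite ltr0n.
by rewrite /Xl divr_gt0 ?ltr0n ?drot_gt0 //= ltr_pdivrMr // mul1r ltr_nat drot_lt.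
Qed.

Let Yl l : rat := 1 - (drot p r j' l)%:R / (q - 1)%:R.

Let Yl01 l : 0 < Yl l < 1.
Proof.
have q1r : 0 < ((q - 1)%:R : rat) by rewrite ltr0n.
have /andP[y0 y1] := drot_jmul_bound l.
rewrite /Yl subr_gt0 ltr_pdivrMr // mul1r ltr_nat y1 /= gtrBl divr_gt0 ?ltr0n //.
Qed.

(** The natural number added to [Yl l] is m - carry - 1 modulo d, so it runs through 0, ..., d - 1
    along with m. The arguments thus form the progression of Gauss's multiplication formula. *)
Lemma frE l m : (m < d)%N ->
  fr l m = (Yl l + (if (m <= carry p r d j l)%N then m + d - (carry p r d j l).+1
            else m - (carry p r d j l).+1)%N%:R) / d%:R.
Proof.
move=> md; have Dd := carry_lt l; have e := Xl_carry l.
apply: (mulIf dnz); rewrite divfK // /fr /Yl.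
have -> : (m%:R / d%:R - Xl l + (m <= carry p r d j l)%N%:R) * d%:R =
   m%:R - d%:R * Xl l + d%:R * (m <= carry p r d j l)%N%:R by field.
rewrite e; case: leqP => h.
  have -> : ((m + d - (carry p r d j l).+1)%N%:R : rat) = m%:R + d%:R - ((carry p r d j l)%:R + 1).
    by rewrite natrB ?natrD ?natr1 //; lia.
  by rewrite mulr1; ring.
have -> : ((m - (carry p r d j l).+1)%N%:R : rat) = m%:R - ((carry p r d j l)%:R + 1).
  by rewrite natrB ?natr1.
by rewrite mulr0; ring.
Qed.

Lemma fr01 l m : (m < d)%N -> 0 <= fr l m < 1.
Proof.
move=> md; have Dd := carry_lt l; have /andP[Y0 Y1] := Yl01 l.
have dp : 0 < (d%:R : rat) by rewrite ltr0n.
rewrite frE //; set t := (if _ then _ else _)%N.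
have td : (t.+1 <= d)%N by rewrite /t; case: (leqP m); lia.
apply/andP; split; first by rewrite divr_ge0 ?ler0n // addr_ge0 ?ler0n // ltW.
rewrite ltr_pdivrMr // mul1r.
apply: lt_le_trans (_ : 1 + t%:R <= _); first by rewrite ltrD2r.
by rewrite addrC natr1 ler_nat.
Qed.

(** The integer part of j p^l / (q - 1) cancels between the two floors; the exponent left is 0 or 1,
    and the further 1 is the scaling built into [mc_factor]. *)
Lemma mc_factorE i l : let m := ((i.+1 * p ^ l) %% d)%N in
  mc_factor p r N (i.+1%:R / d%:R) 0 j l =
  (-1) ^+ (m <= carry p r d j l)%N * p%:R ^+ (m <= carry p r d j l)%N.+1 *
  (G (fr l m) / G (m%:R / d%:R)) * G (Xl l).
Proof.
move=> m; have md : (m < d)%N by rewrite ltn_mod.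
have dp : 0 < (d%:R : rat) by rewrite ltr0n.
pose m1 := ((i.+1 * p ^ l) %/ d)%N; pose A := ((j * p ^ l) %/ (q - 1))%N.
have e1 : (i.+1%:R / d%:R * (p ^ l)%:R : rat) = m1%:R + m%:R / d%:R.
  apply: (mulIf dnz); rewrite mulrDl divfK // -natrM -natrD -divn_eq natrM.
  by rewrite mulrAC divfK.
have e2 : (j%:R * (p ^ l)%:R / (q - 1)%:R : rat) = A%:R + Xl l.
  by apply: (mulIf qnz); rewrite mulrDl /Xl !divfK // -!natrM -natrD -divn_eq.
have /andP[f0 f1] := fr01 l md; have /andP[x0 x1] := Xl01 l.
have fr1 : Defs.fracq (i.+1%:R / d%:R * (p ^ l)%:R) = m%:R / d%:R.
  apply: (@fracq_unique _ _ m1%:Z); first by rewrite e1.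
  - by rewrite divr_ge0 ?ler0n.
  by rewrite ltr_pdivrMr // mul1r ltr_nat.
have fr2 : Defs.fracq (- 0 * (p ^ l)%:R) = 0.
  by apply: (@fracq_unique _ _ 0); rewrite ?oppr0 ?mul0r ?addr0.
have fr3 : Defs.fracq ((i.+1%:R / d%:R - j%:R / (q - 1)%:R) * (p ^ l)%:R) = fr l m.
  apply: (@fracq_unique _ _ (m1%:Z - A%:Z - (m <= carry p r d j l)%N%:Z)) => //.
  by rewrite mulrBl e1 mulrAC e2 /fr !intrB -!pmulrn; ring.
have fr4 : Defs.fracq ((- 0 + j%:R / (q - 1)%:R) * (p ^ l)%:R) = Xl l.
  apply: (@fracq_unique _ _ A%:Z) => //; last exact: ltW.
  by rewrite oppr0 add0r mulrAC e2.
rewrite /mc_factor -subn1 fr1 fr2 fr3 fr4 e2 add0r (gammap0 p_pr p_odd) divr1.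
have -> : Num.floor (A%:R + Xl l) = A%:Z.
  by apply: floor_unique; [rewrite lerDl ltW | rewrite intrD ltrD2l].
have -> : Num.floor (m%:R / d%:R - (A%:R + Xl l)) = - A%:Z - (m <= carry p r d j l)%N%:Z.
  move: f0 f1; rewrite /fr => f0 f1.
  by apply: floor_unique; rewrite ?intrD ?rmorphN /= -?pmulrn; lra.
have -> : - (- A%:Z - (m <= carry p r d j l)%N%:Z) - A%:Z = (m <= carry p r d j l)%N%:Z by ring.
by case: leqP.
Qed.

Let pnd : ~~ (p %| d)%N.
Proof. by rewrite dvdn_prime2 // (negPf pd). Qed.

Let pnq : ~~ (p %| q - 1)%N.
Proof. by rewrite -prime_coprime // coprime_sym -[p]expn1 (coprime_q1 p_pr j_bound). Qed.

Let pdV : pint p d%:R^-1. Proof. exact: pintV. Qed.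
Let pqV : pint p (q - 1)%:R^-1. Proof. exact: pintV. Qed.

Let pXl l : pint p (Xl l). Proof. by apply: pintM; rewrite ?pint_natr. Qed.
Let pYl l : pint p (Yl l).
Proof. by apply: pintB; rewrite ?pint1 //; apply: pintM; rewrite ?pint_natr. Qed.

(** Multiplication by p^l permutes the nonzero residues modulo the prime d, which differs from p. *)
Lemma prod_mul_mod (h : nat -> Z) l :
  \prod_(i < d.-1) h ((i.+1 * p ^ l) %% d)%N = \prod_(1 <= m < d) h m.
Proof.
have cop : coprime d (p ^ l) by rewrite coprimeXr // prime_coprime // dvdn_prime2 // eq_sym (negPf pd).
have ne0 (i : 'I_d.-1) : (0 < (i.+1 * p ^ l) %% d)%N.
  rewrite lt0n; apply/negP => hd; have : (d %| i.+1 * p ^ l)%N by [].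
  rewrite Gauss_dvdl // => /dvdn_leq => /(_ isT); have := ltn_ord i; lia.
have lt (i : 'I_d.-1) : (((i.+1 * p ^ l) %% d).-1 < d.-1)%N.
  by have := ne0 i; have := ltn_pmod (i.+1 * p ^ l) d0; lia.
pose f (i : 'I_d.-1) := Ordinal (lt i).
have finj : injective f.
  move=> i1 i2 [] e; have := ne0 i1; have := ne0 i2 => h2 h1.
  have /eqP e2 : ((i1.+1 * p ^ l) %% d = (i2.+1 * p ^ l) %% d)%N by lia.
  apply/val_inj => /=; wlog le : i1 i2 e2 {h1 h2 e} / (i1 <= i2)%N => [hw|].
    by case: (leqP i1 i2) => [|/ltnW] le; [apply: hw|apply/esym/hw; rewrite // eq_sym].
  move: e2; rewrite eq_sym eqn_mod_dvd ?leq_mul2r ?ltnS ?le ?orbT // -mulnBl Gauss_dvdl //.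
  rewrite subSS => /dvdnP[[|c] ec]; first by lia.
  by have := ltn_ord i2; nia.
transitivity (\prod_(i < d.-1) h i.+1).
  rewrite [RHS](reindex_inj finj); apply: eq_bigr => i _ /=.
  by rewrite (prednK (ne0 i)).
have -> : \prod_(1 <= m < d) h m = \prod_(0.+1 <= m < d.-1.+1) h m by rewrite prednK.
by rewrite big_add1 /= big_mkord.
Qed.

Lemma prod_fr l : \prod_(m < d) G (fr l m) = \prod_(i < d) G ((Yl l + i%:R) / d%:R).
Proof.
have Dd := carry_lt l; set D := carry p r d j l in Dd *.
rewrite (eq_bigr (fun m : 'I_d => G ((Yl l + (if (m <= D)%N then m + d - D.+1
            else m - D.+1)%N%:R) / d%:R))); last by move=> m _; rewrite frE.
rewrite -(big_mkord xpredT (fun m => G ((Yl l + (if (m <= D)%N then m + d - D.+1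
            else m - D.+1)%N%:R) / d%:R))).
rewrite -(big_mkord xpredT (fun i => G ((Yl l + i%:R) / d%:R))).
rewrite (big_cat_nat (n := D.+1)) //= mulrC [RHS](big_cat_nat (n := (d - D.+1)%N)) ?leq_subr //=.
congr (_ * _).
  rewrite -{1}[D.+1]add0n big_addn; apply: eq_big_nat => i _.
  have -> : (i + D.+1 <= D)%N = false by lia.
  by rewrite addnK.
rewrite -{1}[(d - D.+1)%N]add0n big_addn subKn //; apply: eq_big_nat => i /andP[_ lti].
by rewrite -ltnS lti; congr (G ((_ + _%:R) / _)); lia.
Qed.

Variables (k : nat) (k_big : (N.+1 <= k)%N).

Let near_nn a i : (0 < a < q - 1)%N -> (i <= r)%N ->
  pcong p N (1 - (drot p r a (r - i))%:R / (q - 1)%:R) (nn p r a k i).+1%:R.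
Proof.
move=> ha le; have h := nn_rot p_pr ha k le; rewrite /pcong.
have leN : (N.+1 <= r * k.+1 - i)%N.
  have : (k <= r * k)%N by rewrite leq_pmull.
  by rewrite mulnS; move: (r * k)%N k_big le; clear; lia.
move/(congr1 (fun n : nat => n%:R : rat)): h; rewrite natrD !natrM -(subnK leN) expnD natrM [(p ^ N.+1)%:R]natrX => h.
have -> : (1 - (drot p r a (r - i))%:R / (q - 1)%:R - (nn p r a k i).+1%:R) / p%:R ^+ N.+1 =
   - (a%:R * (p ^ (r * k.+1 - i - N.+1))%:R * (q - 1)%:R^-1) :> rat.
  rewrite -natr1; apply: (mulIf (expf_neq0 N.+1 pnz)); rewrite divfK ?expf_neq0 //.
  apply: (mulIf qnz).
  transitivity (- ((q - 1)%:R * (nn p r a k i)%:R + (drot p r a (r - i))%:R) : rat); first by field.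
  by rewrite h; field.
by apply: pintN => //; apply: pintM => //; apply: pintM; rewrite ?pint_natr.
Qed.

(** The multiplication formula evaluates the product of all [G (fr l m)]. Its term m = 0, absent
    from McCarthy's product, is the gamma value at 1 - Xl, equal to g, and costs 1/g. By reflection
    the d - 1 factors [G (Xl l)], an even number, become powers of 1/g as well, whence g^(-d). *)
Lemma mc_prod_fixed l i : (i <= r)%N -> drot p r j l = drot p r j (r - i) ->
  \prod_(m < d.-1) mc_factor p r N (m.+1%:R / d%:R) 0 j l =
  (-1) ^+ carry p r d j l * p%:R ^+ (carry p r d j l + d.-1) *
  (gn p N (nn p r j' k i).+1 * (gn p N (nn p r j k i).+1)^-1 ^+ d *
   d%:R^-1 ^+ (nn p r j' k i - nn p r j' k i.+1)).
Proof.
move=> le el; set D := carry p r d j l.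
have el' : drot p r j' l = drot p r j' (r - i).
  by have := carryE p r d j l; have := carryE p r d j (r - i); rewrite /carry el; lia.
have Dd := carry_lt l; rewrite -/D in Dd.
rewrite (eq_bigr (fun m : 'I_d.-1 => (fun n => (-1) ^+ (n <= D)%N * p%:R ^+ (n <= D)%N.+1 *
  (G (fr l n) / G (n%:R / d%:R)) * G (Xl l)) ((m.+1 * p ^ l) %% d)%N)); last by move=> m _; rewrite mc_factorE.
rewrite (prod_mul_mod (fun n => (-1) ^+ (n <= D)%N * p%:R ^+ (n <= D)%N.+1 *
  (G (fr l n) / G (n%:R / d%:R)) * G (Xl l))) !big_split /=.
have cnt : (\sum_(1 <= n < d) (n <= D)%N = D)%N.
  rewrite (big_cat_nat (n := D.+1)) //= [X in (_ + X)%N]big_nat_cond [X in (_ + X)%N]big1 ?addn0; last first.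
    by move=> n; rewrite andbT => /andP[h _]; rewrite leqNgt h.
  rewrite (eq_big_nat _ _ (F2 := fun _ => 1%N)); last by move=> n /andP[_]; rewrite ltnS => ->.
  by rewrite sum_nat_const_nat muln1 subn1.
rewrite !prodrXr cnt prodr_const_nat subn1.
have -> : (\sum_(1 <= n < d) (n <= D)%N.+1 = D + d.-1)%N.
  under eq_bigr do rewrite -addn1.
  by rewrite big_split /= cnt sum_nat_const_nat muln1 subn1.
set Q := \prod_(1 <= n < d) (G (n%:R / d%:R))^-1.
have ugm n : G (n%:R / d%:R) \is a GRing.unit.
  by apply: gammap_unit => //; apply: pintM; rewrite ?pint_natr.
have pfr n : pint p (fr l n).
  by apply: pintD; rewrite ?pint_natr //; apply: pintB => //; apply: pintM; rewrite ?pint_natr.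
have G1X : G (fr l 0) = gn p N (nn p r j k i).+1.
  have -> : fr l 0 = 1 - Xl l by rewrite /fr leq0n mul0r add0r addrC.
  apply: gammapE => //; have := near_nn j_bound le; rewrite -el.
  exact.
set g := gn p N (nn p r j k i).+1 in G1X *.
have ug : g \is a GRing.unit by apply: gn_unit.
have h1 : \prod_(m < d) G (fr l m) = g * \prod_(1 <= n < d) G (fr l n).
  by rewrite -(big_mkord xpredT (fun m => G (fr l m))) big_ltn // G1X.
have h2 : \prod_(m < d) G (fr l m) = \prod_(n < d) G (((nn p r j' k i).+1 + n)%N%:R / d%:R).
  rewrite prod_fr; apply: eq_bigr => n _; apply: gammap_cong => //.
    by apply: pintM => //; apply: pintD; rewrite ?pint_natr.
  have := near_nn j'_bound le; rewrite -el' -/(Yl l) natrD => hy.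
  rewrite !(mulrC _ d%:R^-1); apply: pcongM => //.
  by rewrite !(addrC _ n%:R); apply: pcongDl.
have h3 := gammap_mult p_pr p_odd N pnd (nn p r j' k i).+1; rewrite -h2 pcountS // -nnS in h3.
have h4 : \prod_(n < d) G (n%:R / d%:R) * Q = 1.
  rewrite -(big_mkord xpredT (fun n => G (n%:R / d%:R))) big_ltn // mul0r gammap0 // mul1r.
  by rewrite /Q prodrV // mulrV //; apply: rpred_prod.
have h5 : G (nn p r j' k i).+1%:R = gn p N (nn p r j' k i).+1.
  by apply: gammapE; rewrite ?subrr ?mul0r ?pint0.
have ud : (d%:R : Z) \is a GRing.unit by apply: unit_Zpn.
set e := (_ - _)%N in h3 *.
have h6 : \prod_(1 <= n < d) G (fr l n) * Q = gn p N (nn p r j' k i).+1 * d%:R^-1 ^+ e * g^-1.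
  have ude : (d%:R : Z) ^+ e \is a GRing.unit by apply: unitrX.
  apply: (mulIr ude); apply: (mulIr ug).
  transitivity (\prod_(m < d) G (fr l m) * d%:R ^+ e * Q); first by rewrite h1; ring.
  rewrite h3 -mulrA h4 h5 mulr1.
  transitivity (gn p N (nn p r j' k i).+1 * (d%:R^-1 * d%:R) ^+ e * (g^-1 * g)).
    by rewrite !mulVr // expr1n !mulr1.
  by rewrite exprMn; ring.
have h7 : G (Xl l) ^+ d.-1 = g^-1 ^+ d.-1.
  have := gammap_reflect p_pr p_odd N (pXl l).
  have -> : 1 - Xl l = fr l 0 by rewrite /fr leq0n mul0r add0r addrC.
  rewrite G1X exprMn => hg.
  have hs : G (Xl l) ^+ 2 = g^-1 ^+ 2.
    by rewrite exprVn; apply: (mulIr (unitrX 2 ug)); rewrite mulVr // unitrX.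
  have -> : d.-1 = (2 * d.-1./2)%N.
    by rewrite mul2n -[LHS]odd_double_half -[odd _]negbK -oddS (prednK d0) d_odd.
  by rewrite !exprM hs.
have -> : g^-1 ^+ d = g^-1 * g^-1 ^+ d.-1 by rewrite -exprS prednK.
by rewrite h7 h6; ring.
Qed.

Lemma mc_prod :
  \prod_(m < d.-1) \prod_(l < r) mc_factor p r N (m.+1%:R / d%:R) 0 j l =
  (-1) ^+ carries p r d j * p%:R ^+ (d.-1 * r + carries p r d j) *
  (ngamma p r N j' k * (ngamma p r N j k)^-1 ^+ d) * d%:R^-1 ^+ (j' * q ^ k).
Proof.
rewrite exchange_big /=.
pose V i : Z := gn p N (nn p r j' k i).+1 * (gn p N (nn p r j k i).+1)^-1 ^+ d *
   d%:R^-1 ^+ (nn p r j' k i - nn p r j' k i.+1).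
pose W l : Z := (-1) ^+ carry p r d j l * p%:R ^+ (carry p r d j l + d.-1).
(* Rotation by l > 0 is matched with i = r - l. Rotation by 0 equals rotation by r and is matched
   with i = 0, so that i covers 0, ..., r - 1 as in [ngamma]. *)
have dr0 : drot p r j 0 = drot p r j (r - 0).
  by rewrite subn0 (drot_r p_pr j_bound) /drot expn0 muln1 modn_small //; case/andP: j_bound.
have e l : (0 < l)%N -> (l <= r)%N -> drot p r j l = drot p r j (r - (r - l)) by move=> _ h; rewrite subKn.
have hl (l : 'I_r) : \prod_(m < d.-1) mc_factor p r N (m.+1%:R / d%:R) 0 j l =
    W l * (if l == 0%N :> nat then V 0%N else V (r - l)%N).
  case: eqP => [el|/eqP l0]; first by rewrite el (mc_prod_fixed (leq0n _) dr0).
  by rewrite (@mc_prod_fixed _ (r - l)%N) ?leq_subr // e // ?lt0n // ltnW.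
rewrite (eq_bigr _ (fun l _ => hl l)) big_split /=.
have -> : \prod_(l < r) (if l == 0%N :> nat then V 0%N else V (r - l)%N) = \prod_(i < r) V i.
  case: r r_gt0 V {W hl dr0 e} => // r' _ V; rewrite !big_ord_recl /=; congr (_ * _).
  rewrite [RHS](reindex_inj rev_ord_inj) /=; apply: eq_bigr => i _; rewrite /bump !leq0n !add1n /=.
  by congr V; have := ltn_ord i; lia.
have -> : \prod_(l < r) W l = (-1) ^+ carries p r d j * p%:R ^+ (d.-1 * r + carries p r d j).
  rewrite big_split !prodrXr big_split /= sum_nat_const card_ord -/(carries p r d j).
  by rewrite addnC mulnC.
rewrite -mulrA; congr (_ * _); rewrite /V !big_split /= !prodrXr !prodrXl.
rewrite prodrV => [|i _]; last exact: gn_unit.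
rewrite -/(ngamma p r N j k) -/(ngamma p r N j' k); congr (_ * _ ^+ _).
(* The exponents of d telescope to [nn p r j' k 0 - nn p r j' k r], which is j' q^k. *)
have h1 : (\sum_(i < r) nn p r j' k i = \sum_(i < r) (nn p r j' k i - nn p r j' k i.+1) + \sum_(i < r) nn p r j' k i.+1)%N.
  by rewrite -big_split /=; apply: eq_bigr => i _; rewrite subnK // nnS leq_div.
have h2 : (\sum_(i < r) nn p r j' k i + nn p r j' k r = nn p r j' k 0 + \sum_(i < r) nn p r j' k i.+1)%N.
  transitivity (\sum_(i < r.+1) nn p r j' k i)%N; first by rewrite big_ord_recr.
  by rewrite big_ord_recl.
have := nn_diff p_pr j'_bound k; have := nn_le p_pr j'_bound k.
move: h1 h2; move: (\sum_(i < r) nn p r j' k i)%N (\sum_(i < r) nn p r j' k i.+1)%N.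
by move: (\sum_(i < r) (nn p r j' k i - nn p r j' k i.+1))%N (nn p r j' k 0) (nn p r j' k r); clear; lia.
Qed.

End McFactor.

Lemma natr_card0 (F : finFieldType) : (#|F|%:R : F) = 0.
Proof.
have e : \sum_(x : F) x = \sum_(x : F) (x + 1) by rewrite (reindex_inj (addIr 1)).
rewrite big_split /= sumr_const in e.
by apply: (addrI (\sum_(x : F) x)); rewrite addr0.
Qed.

Lemma natr_neq0_finField (F : finFieldType) p r d : prime p -> #|F| = (p ^ r)%N ->
  ~~ (p %| d)%N -> (d%:R : F) != 0.
Proof.
move=> p_pr cF; have := natr_card0 F; rewrite cF natrX => /eqP; rewrite expf_eq0 => /andP[_ p0].
have pc : p \in [pchar F] by rewrite inE p_pr.
by rewrite (dvdn_pcharf pc).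
Qed.

(** X^p - Y^p is X - Y times a sum of p terms congruent to Y^(p-1) modulo p, so each p-th power
    gains a factor p. *)
Lemma expr_lift (A : comNzRingType) p (x y c : A) m : prime p -> x = y + p%:R * c ->
  exists c', x ^+ (p ^ m) = y ^+ (p ^ m) + p%:R ^+ m.+1 * c'.
Proof.
move=> p_pr e; have p0 := prime_gt0 p_pr; elim: m => [|m [c' IHm]]; first by exists c; rewrite expn0 !expr1.
move: (x ^+ (p ^ m)) (y ^+ (p ^ m)) IHm (esym (exprM x (p ^ m) p)) (esym (exprM y (p ^ m) p)).
rewrite -expnSr => X Y IHm <- <-.
have hX i : exists b, X ^+ i = Y ^+ i + p%:R * b.
  elim: i => [|i [b IHi]]; first by exists 0; rewrite !expr0 mulr0 addr0.
  exists (X * b + p%:R ^+ m * c' * Y ^+ i).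
  rewrite [X ^+ i.+1]exprS IHi mulrDr {1}IHm [Y ^+ i.+1]exprS [p%:R ^+ m.+1]exprS.
  by ring.
have hs n : (n <= p)%N ->
    exists b, \sum_(i < n) X ^+ (p.-1 - i) * Y ^+ i = n%:R * Y ^+ p.-1 + p%:R * b.
  elim: n => [|n IHn] le; first by exists 0; rewrite big_ord0 mul0r mulr0 addr0.
  have [b hb] := IHn (ltnW le); have [b' hb'] := hX (p.-1 - n)%N.
  exists (b + b' * Y ^+ n); rewrite big_ord_recr /= hb hb' mulrDl -exprD subnK; last by lia.
  by rewrite -natr1; ring.
have [b hb] := hs p (leqnn _).
exists (c' * (Y ^+ p.-1 + b)); apply/eqP; rewrite addrC -subr_eq subrXX hb {1}IHm.
apply/eqP; rewrite [p%:R ^+ m.+2]exprS; ring.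
Qed.

(** * McCarthy's coefficients as Jacobi sums *)

Section Coefficient.
Variables (p : nat) (p_pr : prime p) (p_odd : odd p) (r N : nat) (r_gt0 : (0 < r)%N).
Local Notation q := (p ^ r)%N.
Variables (F : finFieldType) (cardF : #|F| = q).
Variables (A : comNzRingType) (iota : {rmorphism 'Z_(p ^ N.+1) -> A}).
Variables (pi : A) (piE : pi ^+ (p - 1) = - p%:R).
Variable om : F -> A.
Hypotheses (om0 : om 0 = 0) (om1 : om 1 = 1) (omM : {morph om : x y / x * y}).
Hypothesis omD : forall x y, exists c, om (x + y) = om x + om y + p%:R * c.
Variables (d : nat) (d_pr : prime d) (d_odd : odd d) (pd : p != d) (d_cop : coprime (q - 1) d).
Let p0 := prime_gt0 p_pr.
Let p1 := prime_gt1 p_pr.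

Lemma om_natr n : exists c, om n%:R = n%:R + p%:R * c.
Proof.
elim: n => [|n [c IHn]]; first by exists 0; rewrite om0 mulr0 addr0.
have [c' hc'] := omD n%:R 1; exists (c + c'); rewrite -natr1 hc' IHn om1 -natr1; ring.
Qed.

(** The limit formula for Teichmueller lifts. It turns the power of d left by the multiplication
    formula into a character value at d, the contribution of d^d in the equation of the cone. *)
Lemma natr_teich n k : (N <= k)%N -> (n%:R : A) ^+ (q ^ k) = om n%:R.
Proof.
move=> le; have [c hc] := om_natr n; have [c' hc'] := expr_lift (r * k) p_pr hc.
have leN : (N.+1 <= (r * k).+1)%N by rewrite ltnS (leq_trans le) // leq_pmull.
have xq x : om x ^+ (q ^ k) = om x.
  elim: k {le c' hc' leN} => [|k IHk]; first by rewrite expn0 expr1.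
  by rewrite expnSr exprM IHk (om_exp om1 omM) -cardF expf_card.
rewrite -(subnK leN) exprD (A_p0 p_pr iota) mulr0 mul0r addr0 expnM xq in hc'.
exact: esym.
Qed.

Lemma coefficient_identity j : (0 < j < q - 1)%N ->
  iota (\prod_(m < d.-1) \prod_(l < r) mc_factor p r N (m.+1%:R / d%:R) 0 j l) =
  p%:R ^+ (d.-1 * r) * jacobi om d j * om d%:R^-1 ^+ (d * j).
Proof.
move=> hj; have d1 := prime_gt1 d_pr.
have [k0 hk] := jacobi_gamma p_pr p_odd r_gt0 cardF iota piE om0 om1 omM omD d_odd d1 d_cop hj.
pose k := (k0 + N.+1)%N; rewrite (hk k (leq_addr _ _)).
have kN : (N.+1 <= k)%N by rewrite leq_addl.
rewrite (mc_prod p_pr p_odd r_gt0 d_pr d_odd pd d_cop hj kN).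
have nd : ~~ (p %| d)%N by rewrite dvdn_prime2 // (negPf pd).
have dF := natr_neq0_finField p_pr cardF nd.
rewrite (om_period p_pr cardF om1 omM _ dF) -/(jmul p r d j).
rewrite !rmorphM !rmorphXn /= rmorphN1 rmorph_nat; congr (_ * _).
have e1 : iota d%:R^-1 ^+ (jmul p r d j * q ^ k) * om d%:R ^+ jmul p r d j = 1.
  rewrite -(@natr_teich d k) ?(ltnW kN) // mulnC exprM -exprMn -exprMn.
  have -> : iota d%:R^-1 * (d%:R : A) = 1.
    by rewrite -(rmorph_nat iota) -rmorphM mulVr ?rmorph1 // unit_Zpn.
  by rewrite !expr1n.
have e2 : om d%:R ^+ jmul p r d j * om d%:R^-1 ^+ jmul p r d j = 1.
  by rewrite -exprMn -omM mulfV // om1 expr1n.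
by rewrite -[LHS]mulr1 -e2 mulrA e1 mul1r.
Qed.

End Coefficient.

(** * Counting points *)

Section Counting.
Variable F : finFieldType.
Local Notation q := #|F|.

Definition fcons d (x : F) (y : {ffun 'I_d -> F}) : {ffun 'I_d.+1 -> F} :=
  [ffun i => if unlift ord0 i is Some k then y k else x].

Definition ftail d (y : {ffun 'I_d.+1 -> F}) : {ffun 'I_d -> F} := [ffun k => y (lift ord0 k)].

Lemma fcons0 d x (y : {ffun 'I_d -> F}) : fcons x y ord0 = x.
Proof. by rewrite ffunE unlift_none. Qed.

Lemma fconsS d x (y : {ffun 'I_d -> F}) k : fcons x y (lift ord0 k) = y k.
Proof. by rewrite ffunE liftK. Qed.

Lemma sum_fcons (T : nmodType) d (G : {ffun 'I_d.+1 -> F} -> T) :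
  \sum_y G y = \sum_x \sum_y G (fcons x y).
Proof.
rewrite pair_big /=.
rewrite (reindex (fun xy : F * {ffun 'I_d -> F} => fcons xy.1 xy.2)) //=.
exists (fun y : {ffun 'I_d.+1 -> F} => (y ord0, ftail y)) => [[x y] _|y _] /=.
  by rewrite fcons0; congr (_, _); apply/ffunP => k; rewrite ffunE fconsS.
apply/ffunP => i; case: (unliftP ord0 i) => [k|] ->; last by rewrite fcons0.
by rewrite fconsS ffunE.
Qed.

Lemma sum_fcons_val d x (y : {ffun 'I_d -> F}) : \sum_i fcons x y i = x + \sum_i y i.
Proof. by rewrite big_ord_recl fcons0; congr (_ + _); apply: eq_bigr => i _; rewrite fconsS. Qed.

Lemma nonzero_fcons d x (y : {ffun 'I_d -> F}) : nonzero (fcons x y) = (x != 0) && nonzero y.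
Proof.
apply/forallP/andP => [h|[x0 /forallP h] i].
  split; first by have := h ord0; rewrite fcons0.
  by apply/forallP => k; have := h (lift ord0 k); rewrite fconsS.
by case: (unliftP ord0 i) => [k|] ->; rewrite ?fconsS ?fcons0.
Qed.

Definition nzcount d s : int := \sum_(y : {ffun 'I_d -> F} | nonzero y && (\sum_i y i == s)) 1.

Lemma nzcountS d s : nzcount d.+1 s = (\sum_x nzcount d x) - nzcount d s.
Proof.
rewrite /nzcount big_mkcond sum_fcons.
have -> : \sum_x \sum_(y : {ffun 'I_d -> F})
    (if nonzero (fcons x y) && (\sum_i fcons x y i == s) then 1 else 0) =
   \sum_(x | x != 0) nzcount d (s - x).
  rewrite [RHS]big_mkcond /=; apply: eq_bigr => x _; case: (boolP (x != 0)) => x0.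
    rewrite /nzcount [RHS]big_mkcond; apply: eq_bigr => y _.
    by rewrite nonzero_fcons x0 sum_fcons_val /= [_ == s - x]eq_sym subr_eq eq_sym addrC.
  by rewrite big1 // => y _; rewrite nonzero_fcons (negPf x0).
have -> : \sum_x nzcount d x = \sum_x nzcount d (s - x).
  by rewrite (reindex_inj (can_inj (subKr s))).
by rewrite [X in _ = X - _](bigD1 0) //= subr0 addrAC subrr add0r.
Qed.

Lemma nzcount_diff d s : s != 0 -> nzcount d 0 - nzcount d s = (-1) ^+ d.
Proof.
move=> s0; elim: d => [|d IHd].
  rewrite /nzcount (eq_bigl xpredT) => [|y]; last first.
    by rewrite big_ord0 eqxx andbT; apply/forallP; case.
  rewrite [X in _ - X]big1 => [|y]; last by rewrite big_ord0 eq_sym (negPf s0) andbF.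
  by rewrite sumr_const card_ffun card_ord expn0 subr0.
by rewrite !nzcountS exprS -IHd; ring.
Qed.

Lemma card_hyperplane d : #|[set y : {ffun 'I_d.+1 -> F} | \sum_i y i == 0]| = (q ^ d)%N.
Proof.
rewrite -sum1_card big_mkcond /= (sum_fcons (fun y => if y \in _ then 1%N else 0%N)) exchange_big /=.
rewrite (eq_bigr (fun _ => 1%N)) => [|y _]; first by rewrite sum1_card card_ffun card_ord.
rewrite (bigD1 (- \sum_i y i)) //= inE sum_fcons_val addNr eqxx big1 ?addn0 // => x hx.
by rewrite inE sum_fcons_val addr_eq0 (negPf hx).
Qed.

Variables (d : nat) (d_gt0 : (0 < d)%N) (d_cop : coprime (q - 1) d).

Lemma fpow_inj : injective (fun x : F => x ^+ d).
Proof.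
have q1 : (1 < q)%N := finNzRing_gt1 F.
(* Bezout gives an exponent inverse to d modulo q - 1; it is nonzero because the gcd is 1. *)
have [[|a] b e _] := egcdnP (q - 1) d_gt0.
  by move: e; rewrite mul0n gcdnC (eqP d_cop) addn1.
rewrite gcdnC (eqP d_cop) in e.
have h (x : F) : x ^+ d ^+ a.+1 = x.
  rewrite -exprM mulnC e addn1 exprSr mulnC exprM.
  have [->|x0] := eqVneq x 0; first by rewrite mulr0.
  suff -> : x ^+ (q - 1) = 1 by rewrite expr1n mul1r.
  by apply: (mulfI x0); rewrite -exprS subn1 prednK ?expf_card ?mulr1 // ltnW.
by move=> x y /(congr1 (fun z => z ^+ a.+1)); rewrite !h.
Qed.

Definition affine (lam : F) : {set {ffun 'I_d -> F}} :=
  [set x : {ffun 'I_d -> F} | (x != 0) &&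
     (\sum_(i < d) x i ^+ d == d%:R * lam * \prod_(i < d) x i)].

Definition cone (k : F) : {set {ffun 'I_d -> F}} :=
  [set y : {ffun 'I_d -> F} | (\sum_i y i) ^+ d == k * \prod_i y i].

(** Coordinatewise d-th powers are injective, both on points and on the two sides of the equation.
    The extra 1 is the origin, which lies on the cone but not in [affine]. *)
Lemma card_affine lam : (#|affine lam|.+1 = #|cone ((d%:R * lam) ^+ d)|)%N.
Proof.
pose g (x : {ffun 'I_d -> F}) : {ffun 'I_d -> F} := [ffun i => x i ^+ d].
have ginj : injective g.
  by move=> x y /ffunP e; apply/ffunP => i; have := e i; rewrite !ffunE; apply: fpow_inj.
have d0' : d != 0%N by rewrite -lt0n.
have -> : cone ((d%:R * lam) ^+ d) = g @: ((0 : {ffun 'I_d -> F}) |: affine lam).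
  apply/setP => y; rewrite -[y](f_finv ginj) mem_imset // !inE.
  move: (finv g y) => x.
  have -> : \sum_i g x i = \sum_i x i ^+ d by apply: eq_bigr => i _; rewrite ffunE.
  have -> : \prod_i g x i = (\prod_i x i) ^+ d by rewrite -prodrXl; apply: eq_bigr => i _; rewrite ffunE.
  rewrite -exprMn (inj_eq fpow_inj); case: (eqVneq x 0) => //= ->.
  rewrite big1 => [|i _]; last by rewrite ffunE expr0n (negPf d0').
  by rewrite (bigD1 (Ordinal d_gt0)) //= ffunE mul0r mulr0 eqxx.
by rewrite card_imset // cardsU1 inE eqxx.
Qed.

Definition bcount (k : F) : int :=
  \sum_(y : {ffun 'I_d -> F} | nonzero y && (\sum_i y i == 1) && (k * \prod_i y i == 1)) 1.

Lemma nonzero_prod (y : {ffun 'I_d -> F}) : nonzero y = (\prod_i y i != 0).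
Proof. by apply/forallP/prodf_neq0 => [h i _|h i]; apply: h. Qed.

(** A tuple with a zero coordinate lies on the cone exactly when its sum is 0, so these cancel. A
    tuple of nonzero entries on the cone has nonzero sum; the equation being homogeneous of degree
    d, it rescales to sum 1, whence the factor q - 1. *)
Lemma card_cone (k : F) : k != 0 ->
  #|[set y : {ffun 'I_d -> F} | \sum_i y i == 0]|%:Z - #|cone k|%:Z =
  nzcount d 0 - (q - 1)%:Z * bcount k.
Proof.
move=> k0; have d0' : (d == 0)%N = false by apply/negbTE; rewrite -lt0n.
have cz (S : {set {ffun 'I_d -> F}}) : #|S|%:Z = \sum_(y in S) 1 by rewrite sumr_const natz.
rewrite !cz (bigID (@nonzero F d)) [X in _ - X](bigID (@nonzero F d)) /=.
have -> : \sum_(y in cone k | ~~ nonzero y) (1 : int) =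
   \sum_(y in [set y : {ffun 'I_d -> F} | \sum_i y i == 0] | ~~ nonzero y) 1.
  apply: eq_bigl => y; rewrite !inE nonzero_prod negbK andbC [RHS]andbC.
  by case: eqP => //= ->; rewrite mulr0 expf_eq0 d_gt0.
rewrite opprD addrACA subrr addr0; congr (_ - _).
  by apply: eq_bigl => y; rewrite inE andbC.
rewrite (partition_big (fun y : {ffun 'I_d -> F} => \sum_i y i) (fun s => s != 0)) /=; last first.
  move=> y /andP[]; rewrite inE nonzero_prod => /eqP e y0; apply/negP => /eqP s0.
  by move/eqP: e; rewrite s0 expr0n d0' eq_sym mulf_eq0 (negPf k0) (negPf y0).
rewrite (eq_bigr (fun _ => bcount k)) => [|s s0].
  rewrite sumr_const -mulr_natl; congr (_ * _).
  by rewrite natz subn1 -(cardC1 (0 : F)); congr Posz; apply: eq_card => x; rewrite !inE.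
rewrite (reindex_inj (can_inj (@dilateK F d s s0))) /=; apply: eq_bigl => y.
rewrite !inE nonzero_dilate // sum_dilate prod_dilate.
have -> : (s * \sum_i y i == s) = (\sum_i y i == 1) by rewrite -{2}[s]mulr1 (inj_eq (mulfI s0)).
case: (nonzero y); rewrite ?andbF //= ?andbT.
case: (eqVneq (\sum_i y i) 1) => [->|_]; rewrite ?andbF //= !andbT.
by rewrite mulr1 mulrCA -{1}[s ^+ d]mulr1 (inj_eq (mulfI (expf_neq0 d s0))) eq_sym.
Qed.

Definition points (lam : F) : {set {set {ffun 'I_d -> F}}} :=
  [set [set ([ffun i => c * x i] : {ffun 'I_d -> F}) | c : F in [set c : F | c != 0]]
     | x : {ffun 'I_d -> F} in affine lam].

(** Nonzero scalars act freely on nonzero vectors, so every projective point is an orbit of q - 1 of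
    them. *)
Lemma card_points lam : (#|points lam| * (q - 1) = #|affine lam|)%N.
Proof.
pose orb (x : {ffun 'I_d -> F}) := [set dilate c x | c : F in [set c : F | c != 0]].
have e : points lam = orb @: affine lam by [].
have orbP x y : reflect (exists2 c, c != 0 & y = dilate c x) (y \in orb x).
  by apply: (iffP imsetP) => [[c]|[c c0 ->]]; [rewrite inE; exists c | exists c; rewrite ?inE].
have affd c x : c != 0 -> (dilate c x \in affine lam) = (x \in affine lam).
  move=> c0; rewrite !inE; congr (_ && _).
    congr (~~ _); apply/eqP/eqP => [h|->].
      by rewrite -(dilateK c0 x) h; apply/ffunP => i; rewrite !ffunE mulr0.
    by apply/ffunP => i; rewrite !ffunE mulr0.
  have -> : \sum_i dilate c x i ^+ d = c ^+ d * \sum_i x i ^+ d.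
    by rewrite mulr_sumr; apply: eq_bigr => i _; rewrite ffunE exprMn.
  by rewrite prod_dilate mulrCA (inj_eq (mulfI (expf_neq0 d c0))).
have dM (a b : F) (x : {ffun 'I_d -> F}) : dilate a (dilate b x) = dilate (a * b) x.
  by apply/ffunP => i; rewrite !ffunE mulrA.
have orb_eq c x : c != 0 -> orb (dilate c x) = orb x.
  move=> c0; apply/setP => y; apply/orbP/orbP => [[b b0 ->]|[b b0 ->]].
    by exists (b * c); rewrite ?mulf_neq0 // dM.
  by exists (b / c); rewrite ?mulf_neq0 ?invr_eq0 // dM divfK.
have orb_id x : x \in orb x by apply/orbP; exists 1; rewrite ?oner_eq0 //; apply/ffunP => i; rewrite ffunE mul1r.
have corb x : x != 0 -> #|orb x| = (q - 1)%N.
  move=> x0; have [i xi] : exists i, x i != 0.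
    apply/existsP; apply: contraNT x0 => /existsPn h; apply/eqP/ffunP => i.
    by have := h i; rewrite negbK ffunE => /eqP.
  rewrite card_in_imset => [|a b _ _ /ffunP /(_ i)]; last by rewrite !ffunE; apply: mulIf.
  by rewrite subn1 -(cardC1 (0 : F)); apply: eq_card => c; rewrite !inE.
rewrite e -[RHS]sum1_card (partition_big_imset orb) /= -sum_nat_const.
apply: eq_bigr => O /imsetP[x xa ->]; rewrite -(corb x); last by move: xa; rewrite inE => /andP[].
rewrite sum1dep_card; apply: eq_card => y; rewrite in_set.
apply/idP/andP => [/orbP[c c0 ->]|[_ /eqP <-]]; last exact: orb_id.
by rewrite orb_eq // affd // xa.
Qed.

End Counting.

Lemma mc_factor_j0 p r N m d l : prime p -> odd p -> ~~ (p %| d)%N ->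
  mc_factor p r N (m%:R / d%:R) 0 0 l = p%:R.
Proof.
move=> p_pr p_odd pd; have d0 : (0 < d)%N by rewrite lt0n; apply: contraNneq pd => ->; rewrite dvdn0.
have dnz : (d%:R : rat) != 0 by rewrite pnatr_eq0 -lt0n.
rewrite /mc_factor !mul0r !subr0.
have fr0 : Defs.fracq 0 = 0 by rewrite (@fracq_unique 0 0 0) ?addr0.
have fr1 : Defs.fracq (m%:R / d%:R * (p ^ l)%:R) = ((m * p ^ l) %% d)%N%:R / d%:R.
  apply: (@fracq_unique _ _ ((m * p ^ l) %/ d)%N%:Z).
  - rewrite -pmulrn; apply: (mulIf dnz); rewrite mulrDl divfK // -natrM -natrD -divn_eq natrM.
    by rewrite mulrAC divfK.
  - by rewrite divr_ge0 ?ler0n.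
  by rewrite ltr_pdivrMr ?ltr0n // mul1r ltr_nat ltn_mod.
rewrite fr0 fr1 (gammap0 p_pr p_odd) divr1.
have -> : Num.floor (((m * p ^ l) %% d)%N%:R / d%:R : rat) = 0.
  apply: floor_unique; first by rewrite divr_ge0 ?ler0n.
  by rewrite ltr_pdivrMr ?ltr0n // mul1r ltr_nat ltn_mod.
rewrite oppr0 add0r expr0z mul1r expr1 !divrr ?mulr1 //.
apply: gammap_unit => //; apply: pintM; rewrite ?pint_natr //; exact: pintV.
Qed.

(** * The point count as a sum over characters *)

Section Assembly.
Variables (p : nat) (p_pr : prime p) (p_odd : odd p) (r N : nat) (r_gt0 : (0 < r)%N).
Local Notation q := (p ^ r)%N.
Variables (F : finFieldType) (cardF : #|F| = q).
Variables (B : comNzRingType) (iota : {rmorphism 'Z_(p ^ N.+1) -> B}).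
Variable om : F -> B.
Hypotheses (om0 : om 0 = 0) (om1 : om 1 = 1) (omM : {morph om : x y / x * y}).
Hypothesis omD : forall x y, exists c, om (x + y) = om x + om y + p%:R * c.
Variables (d : nat) (d_pr : prime d) (d_odd : odd d) (pd : p != d) (d_cop : coprime (q - 1) d).
Let p0 := prime_gt0 p_pr.
Let p1 := prime_gt1 p_pr.
Let q0 : (0 < q)%N. Proof. by rewrite expn_gt0 p0. Qed.
Let q1 : (1 < q)%N. Proof. by rewrite -(expn0 p) ltn_exp2l. Qed.

Definition mcprod j := \prod_(m < d.-1) \prod_(l < r) mc_factor p r N (m.+1%:R / d%:R) 0 j l.

Hypothesis coef : forall j, (0 < j < q - 1)%N ->
  iota (mcprod j) = p%:R ^+ (d.-1 * r) * jacobi om d j * om d%:R^-1 ^+ (d * j).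

Lemma character_orthogonality u : u != 0 ->
  \sum_(j < q - 1) om u ^+ j = if u == 1 then (q - 1)%:R else 0.
Proof.
move=> u0; case: eqVneq => [->|u1].
  rewrite (eq_bigr (fun _ => 1)) => [|j _]; last by rewrite om1 expr1n.
  by rewrite sumr_const card_ord.
apply: (om_cancel p_pr iota om1 omM omD u1).
by rewrite -subrX1 (om_exp om1 omM) (fermat p_pr cardF u0) om1 subrr.
Qed.

Lemma bcount_jacobi k : k != 0 ->
  (q - 1)%:R * (bcount d k)%:~R = \sum_(j < q - 1) om k^-1 ^+ j * jacobi om d j.
Proof.
move=> k0; rewrite /jacobi /bcount.
rewrite (eq_bigr (fun j : 'I_(q - 1) => \sum_(y : {ffun 'I_d -> F} | nonzero y && (\sum_i y i == 1))
    om (k * \prod_i y i)^-1 ^+ j)) => [|j _]; last first.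
  by rewrite mulr_sumr; apply: eq_bigr => y _; rewrite -exprMn -omM -invfM.
rewrite exchange_big /= -[(\sum_(y | _) _)%:~R]/(intr _) rmorph_sum mulr_sumr /=.
rewrite big_mkcondr /=; apply: eq_bigr => y /andP[ny _].
rewrite character_orthogonality; last by rewrite invr_eq0 mulf_neq0 // -nonzero_prod.
by rewrite invr_eq1; case: ifP; rewrite ?mulr1.
Qed.

Lemma jacobi_0 : jacobi om d 0 = (nzcount d (1 : F))%:~R.
Proof.
rewrite -[RHS]/(intr _) /nzcount rmorph_sum; apply: eq_bigr => y _.
by rewrite expr0 /= rmorph1.
Qed.

Lemma mcprod0 : mcprod 0 = p%:R ^+ (d.-1 * r).
Proof.
have nd : ~~ (p %| d)%N by rewrite dvdn_prime2 // (negPf pd).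
rewrite /mcprod (eq_bigr (fun _ => p%:R ^+ r)) => [|m _].
  by rewrite prodr_const card_ord mulnC exprM.
rewrite (eq_bigr (fun _ => p%:R)) => [|l _]; last by rewrite mc_factor_j0.
by rewrite prodr_const card_ord.
Qed.

(** The value to be proved for McCarthy's function. *)
Definition zcount (lam : F) : int :=
  ((q ^ d.-1).-1 %/ q.-1)%:Z - #|points d lam|%:Z.

Lemma zcountE lam : (q - 1)%:Z * zcount lam =
  #|[set y : {ffun 'I_d -> F} | \sum_i y i == 0]|%:Z - #|cone d ((d%:R * lam) ^+ d)|%:Z.
Proof.
have d0 := prime_gt0 d_pr.
have cop : coprime (#|F| - 1) d by rewrite cardF.
have := card_affine d0 cop lam; have := card_points d lam; rewrite cardF => e1 e2.
have e3 := card_hyperplane F d.-1; rewrite (prednK d0) cardF in e3.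
have e4 : ((q - 1) * ((q ^ d.-1).-1 %/ q.-1) = q ^ d.-1 - 1)%N.
  by rewrite (predn_exp q) subn1 mulKn -?(predn_exp q) ?subn1 //; lia.
have h1 : (0 < q ^ d.-1)%N by rewrite expn_gt0 q0.
rewrite /zcount mulrBr -!PoszM e4 [(_ * #|_|)%N]mulnC e1 e3 -e2; lia.
Qed.

(** At 0 every character vanishes, even the trivial one, and so does McCarthy's sum. On the
    geometric side the cone degenerates to the hyperplane. *)
Lemma zcount0 : zcount 0 = 0.
Proof.
have d0 := prime_gt0 d_pr.
have : (q - 1)%:Z * zcount 0 = 0.
  rewrite zcountE mulr0 expr0n -[d == 0%N]negbK -lt0n d0 /=; apply/eqP; rewrite subr_eq0; apply/eqP.
  by congr Posz; apply: eq_card => y; rewrite !inE mul0r expf_eq0 d0.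
by move/eqP; rewrite mulf_eq0 => /orP[/eqP|/eqP //] h; have := q1; lia.
Qed.

Lemma zcount_sum lam : lam != 0 ->
  (q - 1)%:R * (p%:R ^+ (d.-1 * r) * (zcount lam)%:~R) =
  - \sum_(j < q - 1) iota (mcprod j) * om (lam ^+ d)^-1 ^+ j.
Proof.
move=> l0; have d0 := prime_gt0 d_pr.
have nd : ~~ (p %| d)%N by rewrite dvdn_prime2 // (negPf pd).
have dF := natr_neq0_finField p_pr cardF nd.
set k := (d%:R * lam) ^+ d; have k0 : k != 0 by rewrite expf_neq0 // mulf_neq0.
have cop : coprime (#|F| - 1) d by rewrite cardF.
have h := zcountE lam; rewrite (card_cone d0 k0) cardF in h.
have e1 := nzcount_diff d (oner_neq0 F).
rewrite -signr_odd d_odd expr1 in e1.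
(* The Jacobi sum for j = 0 is [nzcount d 1]; subtracted from [nzcount d 0] it leaves (-1)^d = -1.
   This matches the coefficient j = 0 of McCarthy's function, as [mcprod 0] is the bare scaling
   factor. *)
have h2 : (q - 1)%:R * (zcount lam)%:~R = -1 - \sum_(1 <= j < q - 1) om k^-1 ^+ j * jacobi om d j :> B.
  have := bcount_jacobi k0; rewrite -(big_mkord xpredT (fun j => om k^-1 ^+ j * jacobi om d j)).
  rewrite big_ltn; last by lia.
  rewrite expr0 mul1r jacobi_0 => h3.
  have : ((q - 1)%:Z * zcount lam)%:~R = (nzcount d (0 : F) - (q - 1)%:Z * bcount d k)%:~R :> B by rewrite h.
  rewrite intrB !intrM -!pmulrn h3 => ->.
  have -> : nzcount d (0 : F) = nzcount d (1 : F) - 1 by rewrite -e1; ring.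
  by rewrite intrB; ring.
rewrite mulrCA h2 -(big_mkord xpredT (fun j => iota (mcprod j) * om (lam ^+ d)^-1 ^+ j)).
rewrite [in RHS]big_ltn; last by lia.
rewrite mcprod0 rmorphXn /= rmorph_nat expr0 mulr1 mulrBr mulrN1 opprD; congr (_ - _).
rewrite mulr_sumr; apply: eq_big_nat => j hj; rewrite coef //.
have -> : om k^-1 ^+ j = om d%:R^-1 ^+ (d * j) * om (lam ^+ d)^-1 ^+ j.
  by rewrite exprM -exprMn (om_exp om1 omM _ d) -omM /k exprMn invfM exprVn.
by ring.
Qed.

End Assembly.

(** * The rings Z/p^(N+1) and Z_q/p^(N+1) *)

Section Teichmuller.
Variables (p : nat) (p_pr : prime p) (r N : nat) (r_gt0 : (0 < r)%N).
Local Notation q := (p ^ r)%N.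
Variables (F : finFieldType) (cardF : #|F| = q).
Variables (B : comNzRingType) (B_p0 : (p%:R : B) ^+ N.+1 = 0) (rd : {rmorphism B -> F}).
Hypothesis rd_surj : forall t, exists x, rd x = t.
Hypothesis rd_ker : forall x, rd x = 0 -> exists y, x = p%:R * y.
Let p0 := prime_gt0 p_pr.
Let q0 : (0 < q)%N. Proof. by rewrite expn_gt0 p0. Qed.

Definition is_teich (t : F) (y : B) := (y ^+ q.-1 == 1) && (rd y == t).

(** By [expr_lift], enough p-th powers turn a congruence modulo p into an equality. Thus x^(q^N)
    depends only on the residue of x, which gives existence and uniqueness of Teichmueller lifts. *)
Lemma rd_cong_pow x y : rd x = rd y -> x ^+ (q ^ N) = y ^+ (q ^ N).
Proof.
move=> e; have [c hc] : exists c, x - y = p%:R * c by apply: rd_ker; rewrite rmorphB e subrr.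
have hx : x = y + p%:R * c by rewrite -hc addrC subrK.
have [c' hc'] := expr_lift (r * N) p_pr hx.
have leN : (N.+1 <= (r * N).+1)%N by rewrite ltnS leq_pmull.
by rewrite -expnM hc' -(subnK leN) exprD B_p0 mulr0 mul0r addr0.
Qed.

Lemma is_teich_exists t : t != 0 -> exists y, is_teich t y.
Proof.
move=> t0; have [x hx] := rd_surj t; exists (x ^+ (q ^ N)); apply/andP; split; apply/eqP.
  rewrite exprAC (@rd_cong_pow _ 1) ?expr1n // rmorphXn /= hx rmorph1 -subn1.
  exact: (fermat p_pr cardF t0).
rewrite rmorphXn /= hx; elim: N => [|m IHm]; first by rewrite expn0 expr1.
by rewrite expnSr exprM IHm -cardF expf_card.
Qed.

Lemma is_teich_uniq t y1 y2 : is_teich t y1 -> is_teich t y2 -> y1 = y2.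
Proof.
move=> /andP[/eqP h1 /eqP e1] /andP[/eqP h2 /eqP e2].
have fix_ (y : B) : y ^+ q.-1 = 1 -> y ^+ (q ^ N) = y.
  move=> h; elim: N => [|m IHm]; first by rewrite expn0 expr1.
  by rewrite expnSr exprM IHm -(prednK q0) exprS h mulr1.
by rewrite -(fix_ _ h1) -(fix_ _ h2); apply: rd_cong_pow; rewrite e1 e2.
Qed.

Lemma is_teichM s t x y : is_teich s x -> is_teich t y -> is_teich (s * t) (x * y).
Proof.
move=> /andP[/eqP h1 /eqP e1] /andP[/eqP h2 /eqP e2].
by rewrite /is_teich exprMn h1 h2 mulr1 rmorphM /= e1 e2 !eqxx.
Qed.

Lemma is_teich1 : is_teich 1 1.
Proof. by rewrite /is_teich expr1n rmorph1 !eqxx. Qed.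

Variable om : F -> B.
Hypothesis om0 : om 0 = 0.
Hypothesis omP : forall t, t != 0 -> is_teich t (om t).

Lemma teich_om1 : om 1 = 1.
Proof. exact: is_teich_uniq (omP (oner_neq0 F)) is_teich1. Qed.

Lemma teich_omM : {morph om : x y / x * y}.
Proof.
move=> x y; have [->|x0] := eqVneq x 0; first by rewrite !(mul0r, om0).
have [->|y0] := eqVneq y 0; first by rewrite !(mulr0, om0).
by apply: is_teich_uniq (omP (mulf_neq0 x0 y0)) (is_teichM (omP x0) (omP y0)).
Qed.

Lemma rd_om x : rd (om x) = x.
Proof.
by have [->|/omP /andP[_ /eqP]] := eqVneq x 0; rewrite ?om0 ?rmorph0.
Qed.

Lemma teich_omD x y : exists c, om (x + y) = om x + om y + p%:R * c.
Proof.
have [c hc] : exists c, om (x + y) - (om x + om y) = p%:R * c.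
  by apply: rd_ker; rewrite rmorphB rmorphD /= !rd_om subrr.
by exists c; rewrite -hc [RHS]addrC subrK.
Qed.

End Teichmuller.

Section CoefficientDescent.
Variables (p : nat) (p_pr : prime p) (p_odd : odd p) (r N : nat) (r_gt0 : (0 < r)%N).
Local Notation q := (p ^ r)%N.
Variables (F : finFieldType) (cardF : #|F| = q).
Variables (B : comNzRingType) (iota : {rmorphism 'Z_(p ^ N.+1) -> B}).
Variable om : F -> B.
Hypotheses (om0 : om 0 = 0) (om1 : om 1 = 1) (omM : {morph om : x y / x * y}).
Hypothesis omD : forall x y, exists c, om (x + y) = om x + om y + p%:R * c.
Variables (d : nat) (d_pr : prime d) (d_odd : odd d) (pd : p != d) (d_cop : coprime (q - 1) d).

(* The ring A containing pi is obtained as B[X]/(X^(p-1) + p), into which B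
   embeds. *)
Lemma coefficient_identity_base j : (0 < j < q - 1)%N ->
  iota (mcprod p r N d j) = p%:R ^+ (d.-1 * r) * jacobi om d j * om d%:R^-1 ^+ (d * j).
Proof.
move=> hj; have p1 := prime_gt1 p_pr.
pose h : {poly B} := 'X^(p - 1) + (p%:R)%:P.
have p12 : (0 < p - 1)%N by rewrite subn_gt0.
have hsz : size h = (p - 1).+1 by rewrite size_polyDl size_polyXn // (leq_ltn_trans (size_polyC_leq1 _)).
have hmon : h \is monic.
  by rewrite monicE lead_coefDl ?lead_coefXn // size_polyXn (leq_ltn_trans (size_polyC_leq1 _)).
pose A : comNzRingType := {poly %/ h}.
pose kap : {rmorphism B -> A} := qpolyC h.
have kap_inj : injective kap by move=> x y /(congr1 (fun z : {poly %/ h} => z : {poly B})); rewrite !qpolyCE => /polyC_inj.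
have piE : (in_qpoly h 'X : A) ^+ (p - 1) = - p%:R.
  have : in_qpoly h h = 0.
    by apply/val_inj => /=; rewrite /mk_monic hsz ltnS p12 hmon Pdiv.RingMonic.rmodpp.
  have e g : g = 'X^(p - 1) + p%:R -> in_qpoly h g = in_qpoly h 'X ^+ (p - 1) + p%:R.
    by move=> ->; rewrite rmorphD rmorphXn rmorph_nat.
  by rewrite e ?/h ?polyC_natr // => /eqP; rewrite addr_eq0 => /eqP.
have omD' x y : exists c, kap (om (x + y)) = kap (om x) + kap (om y) + p%:R * c.
  by have [c ->] := omD x y; exists (kap c); rewrite !rmorphD rmorphM rmorph_nat.
have om0' : kap (om 0) = 0 by rewrite om0 rmorph0.
have om1' : kap (om 1) = 1 by rewrite om1 rmorph1.
have omM' : {morph (fun x => kap (om x)) : x y / x * y} by move=> x y; rewrite omM rmorphM.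
have h1 := @coefficient_identity p p_pr p_odd r N r_gt0 F cardF A (kap \o iota) _ piE
  (fun x => kap (om x)) om0' om1' omM' omD' d d_pr d_odd pd d_cop j hj.
apply: kap_inj; rewrite [LHS]h1 !rmorphM !rmorphXn rmorph_nat; congr (_ * _ * _).
by rewrite /jacobi rmorph_sum; apply: eq_bigr => y _; rewrite rmorphXn.
Qed.
End CoefficientDescent.

(** The primality proof is an argument so that the ring morphism structure, which depends on it, can
    be attached to this constant. *)
Definition modp_red p of prime p := fun N (c : 'Z_(p ^ N.+1)) => (nat_of_ord c)%:R : 'F_p.

Section ModpRed.
Variables (p : nat) (p_pr : prime p) (N : nat).
Local Notation rho := (@modp_red p p_pr N).

Lemma modp_red_natr n : rho n%:R = n%:R.
Proof.
rewrite /modp_red val_Zp_nat ?modulus_gt1 //.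
have e : (p %| p ^ N.+1)%N by apply: dvdn_exp.
rewrite [in RHS](divn_eq n (p ^ N.+1)) natrD natrM.
by case/dvdnP: e => k ->; rewrite [in RHS]natrM pchar_Fp_0 // !mulr0 add0r.
Qed.

Lemma modp_red_zmod_morphism : zmod_morphism rho.
Proof.
move=> x y; have addM a b : rho (a + b) = rho a + rho b.
  rewrite -[a]natr_Zp -[b]natr_Zp -natrD !modp_red_natr; exact: natrD.
by apply/eqP; rewrite eq_sym subr_eq -addM subrK.
Qed.

Lemma modp_red_monoid_morphism : monoid_morphism rho.
Proof.
split; first exact: (modp_red_natr 1).
by move=> a b; rewrite -[a]natr_Zp -[b]natr_Zp -natrM !modp_red_natr; exact: natrM.
Qed.

HB.instance Definition _ := GRing.isZmodMorphism.Build _ _ rho modp_red_zmod_morphism.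
HB.instance Definition _ := GRing.isMonoidMorphism.Build _ _ rho modp_red_monoid_morphism.

Lemma modp_red_eq0 c : rho c = 0 -> c = p%:R * (nat_of_ord c %/ p)%:R.
Proof.
move=> h; have : (p %| nat_of_ord c)%N by rewrite (dvdn_pcharf (pchar_Fp p_pr)); apply/eqP.
by move=> d; rewrite -natrM mulnC divnK // natr_Zp.
Qed.

End ModpRed.

Section ConcreteRing.
Variables (p : nat) (p_pr : prime p) (r : nat) (f : {poly int}) (N : nat) (r_gt0 : (0 < r)%N).
Hypotheses (f_monic : f \is monic) (f_size : size f = r.+1).
Local Notation Z := 'Z_(p ^ N.+1).
Local Notation rho := (@modp_red p p_pr N).

Lemma map_int_monic (R : comNzRingType) :
  (map_poly (fun c : int => c%:~R : R) f \is monic) /\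
  size (map_poly (fun c : int => c%:~R : R) f) = r.+1.
Proof.
have e : map_poly (fun c : int => c%:~R : R) f = map_poly (intr : {rmorphism int -> R}) f by [].
rewrite e; split; first exact: monic_map.
by rewrite size_map_poly_id0 // (monicP f_monic) rmorph1 oner_neq0.
Qed.

(** [mk_monic] substitutes a default for a polynomial that is not monic of positive degree; here it
    leaves the modulus unchanged. *)
Lemma mk_monic_fbar : mk_monic (fbar p f) = fbar p f.
Proof. by have [m s] := map_int_monic 'F_p; rewrite /mk_monic /fbar s m ltnS r_gt0. Qed.

Lemma mk_monic_fN : mk_monic (fN p f N) = fN p f N.
Proof. by have [m s] := map_int_monic Z; rewrite /mk_monic /fN s m ltnS r_gt0. Qed.

Lemma size_fbar : size (fbar p f) = r.+1. Proof. by have [] := map_int_monic 'F_p. Qed.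
Lemma size_fN : size (fN p f N) = r.+1. Proof. by have [] := map_int_monic Z. Qed.

Lemma map_fN : map_poly rho (fN p f N) = fbar p f.
Proof.
apply/polyP => i; rewrite coef_map /fN /fbar !coef_map_id0 //.
exact: (rmorph_int rho).
Qed.

Lemma in_fbar0 : in_qpoly (fbar p f) (fbar p f) = 0.
Proof.
apply/val_inj => /=; rewrite mk_monic_fbar; apply: Pdiv.RingMonic.rmodpp.
by have [] := map_int_monic 'F_p.
Qed.

Lemma redE (x : GR p f N) : red x = in_qpoly (fbar p f) (map_poly rho x).
Proof. by []. Qed.

Lemma red_zmod_morphism : zmod_morphism (@red p f N).
Proof. by move=> x y; rewrite !redE !raddfB. Qed.

Lemma red_monoid_morphism : monoid_morphism (@red p f N).
Proof.
split.
  have e : ((1 : GR p f N) : {poly Z}) = 1 by [].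
  by rewrite redE e rmorph1 rmorph1.
move=> x y; rewrite !redE poly_of_qpolyM.
have mN := monic_mk_monic (fN p f N).
have eN : map_poly rho (mk_monic (fN p f N)) = fbar p f by rewrite mk_monic_fN map_fN.
(* Division by f over Z/p^(N+1) is reduced modulo p, where the multiple of f becomes 0. *)
have := Pdiv.RingMonic.rdivp_eq mN ((x : {poly Z}) * (y : {poly Z})).
move: (Pdiv.CommonRing.rdivp _ _) (Pdiv.CommonRing.rmodp _ _) => Q R e.
rewrite -[RHS]rmorphM -rmorphM /= e rmorphD rmorphM /= eN [RHS]rmorphD rmorphM /= in_fbar0.
by rewrite mulr0 add0r.
Qed.

Lemma size_Fq (t : Fq p f) : (size (t : {poly 'F_p}) <= r)%N.
Proof. by apply: leq_trans (size_npoly t) _; rewrite mk_monic_fbar size_fbar. Qed.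

Lemma size_GR (x : GR p f N) : (size (x : {poly Z}) <= r)%N.
Proof. by apply: leq_trans (size_npoly x) _; rewrite mk_monic_fN size_fN. Qed.

Lemma polyn_GR (P : {poly Z}) : (size P <= r)%N -> exists x : GR p f N, (x : {poly Z}) = P.
Proof.
move=> sz; have sz' : (size P <= (size (mk_monic (fN p f N))).-1)%N by rewrite mk_monic_fN size_fN.
by exists (@NPoly _ _ P sz').
Qed.

Lemma val_red (x : GR p f N) : (red x : {poly 'F_p}) = map_poly rho x.
Proof.
rewrite redE in_qpoly_small // mk_monic_fbar size_fbar ltnS.
exact: leq_trans (size_poly _ _) (size_GR x).
Qed.

Lemma red_surj (t : Fq p f) : exists x : GR p f N, red x = t.
Proof.
have [x ex] := @polyn_GR (\poly_(i < r) ((nat_of_ord (t : {poly 'F_p})`_i)%:R : Z)) (size_poly _ _).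
exists x; apply/val_inj; rewrite [LHS](val_red x) ex; apply/polyP => i.
rewrite coef_map /= coef_poly; case: ltnP => le.
  by rewrite modp_red_natr natr_Zp.
by rewrite raddf0 nth_default // (leq_trans (size_Fq t)).
Qed.

Lemma red_ker (x : GR p f N) : red x = 0 -> exists y : GR p f N, x = p%:R * y.
Proof.
move=> h.
have [y ey] := @polyn_GR (\poly_(i < r) ((nat_of_ord (x : {poly Z})`_i %/ p)%:R : Z)) (size_poly _ _).
have e : p%:R * y = p%:R *: y :> GR p f N by rewrite mulr_natl scaler_nat.
exists y; apply/val_inj; rewrite e [RHS]poly_of_qpolyZ ey; apply/polyP => i.
rewrite coefZ coef_poly; case: ltnP => le; last by rewrite mulr0 nth_default // (leq_trans (size_GR x)).
apply: (modp_red_eq0 (p_pr := p_pr)).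
have := congr1 (fun z : Fq p f => (z : {poly 'F_p})`_i) h.
by rewrite val_red coef_map coef0.
Qed.

Lemma GR_p0 : (p%:R : GR p f N) ^+ N.+1 = 0.
Proof.
have -> : (p%:R : GR p f N) = GRing.in_alg (GR p f N) p%:R by rewrite rmorph_nat.
by rewrite -rmorphXn Zpn_p0 // rmorph0.
Qed.

End ConcreteRing.

Theorem theorem1p3 (d p r : nat) (f : {poly int}) (lam : Fq p f) :
  prime d -> odd d -> prime p -> odd p -> p != d -> (0 < r)%N ->
  ((p ^ r) %% d != 1)%N ->
  f \is monic -> size f = r.+1 -> irreducible_poly (fbar p f) ->
  mcG_eq r (fun i : 'I_d.-1 => (i.+1)%:R / d%:R) (fun _ => 0) (lam ^+ d)
    ((((p ^ r) ^ d.-1).-1 %/ (p ^ r).-1)%:Z - (#|dwork_points d lam|)%:Z).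
Proof.
move=> d_pr d_odd p_pr p_odd pd r0 qd fm fs firr N.
have [m s] := map_int_monic fm fs 'F_p.
pose hI : monic_irreducible_poly (fbar p f) := (firr, m).
(* The carrier is that of [Fq p f], now with the field structure coming from irreducibility, so both
   views are convertible. *)
pose F : finFieldType := {poly %/ fbar p f with hI}.
have d0 := prime_gt0 d_pr; have d1 := prime_gt1 d_pr; have p0 := prime_gt0 p_pr.
have q0 : (0 < p ^ r)%N by rewrite expn_gt0 p0.
have cardF : #|F| = (p ^ r)%N by rewrite card_qfpoly [size _]s /= card_Fp.
have d_cop : coprime (p ^ r - 1) d.
  rewrite coprime_sym prime_coprime //; apply: contra qd => /dvdnP[c ec].
  by rewrite -(subnK q0) ec modnMDl modn_small.
pose B : comNzRingType := GR p f N.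
pose iota : {rmorphism 'Z_(p ^ N.+1) -> B} := GRing.in_alg (GR p f N).
pose rd : {rmorphism B -> F} := HB.pack (@red p f N : B -> F)
  (GRing.isZmodMorphism.Build _ _ (@red p f N : B -> F) (@red_zmod_morphism p p_pr f N))
  (GRing.isMonoidMorphism.Build _ _ (@red p f N : B -> F) (@red_monoid_morphism p p_pr r f N r0 fm fs)).
have surj (t : F) : exists x : B, rd x = t := red_surj p_pr N r0 fm fs t.
have ker (x : B) : rd x = 0 -> exists y : B, x = p%:R * y.
  exact: (red_ker p_pr r0 fm fs).
have Bp0 : (p%:R : B) ^+ N.+1 = 0 := GR_p0 p_pr f N.
pose om : F -> B := fun t => teich r N t.
have om0 : om 0 = 0 by rewrite /om /teich eqxx.
have omP (t : F) : t != 0 -> is_teich p r rd t (om t).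
  move=> t0; rewrite /om /teich (negPf t0); case: pickP => [y //|h].
  by have [y] := is_teich_exists p_pr r0 cardF Bp0 surj ker t0; rewrite /is_teich [_ && _]h.
have om1 := teich_om1 p_pr r0 Bp0 ker omP.
have omM := teich_omM p_pr r0 Bp0 ker om0 omP.
have omD := teich_omD ker om0 omP.
have coef := coefficient_identity_base p_pr p_odd r0 cardF iota om0 om1 omM omD d_pr d_odd pd d_cop.
have ez : (((p ^ r) ^ d.-1).-1 %/ (p ^ r).-1)%:Z - #|dwork_points d lam|%:Z = zcount p r d (lam : F) by [].
rewrite ez {ez} /mcG_scaled.
have [->|l0] := eqVneq (lam : F) 0.
  rewrite (zcount0 p_pr p_odd r0 cardF d_pr d_odd pd d_cop) mulr0 big1 // => j _.
  by rewrite /teichbar_pow expr0n -[d == 0%N]negbK -lt0n d0 /= eqxx scaler0.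
have t0 : (lam : F) ^+ d != 0 by rewrite expf_neq0.
(* [teichbar] picks some left inverse of the lift; inverses being unique, it is the lift of the
   inverse. *)
have tb j : teichbar_pow r N j (lam ^+ d) = om ((lam : F) ^+ d)^-1 ^+ j.
  rewrite /teichbar_pow [_ == 0](negPf t0); congr (_ ^+ j); rewrite /teichbar [_ == 0](negPf t0).
  have inv : om ((lam : F) ^+ d)^-1 * om ((lam : F) ^+ d) = 1 by rewrite -omM mulVf.
  case: pickP => [y /= /eqP hy|/(_ (om ((lam : F) ^+ d)^-1))]; last by rewrite [_ * _]inv eqxx.
  have hy' : (y : B) * om ((lam : F) ^+ d) = 1 := hy.
  by rewrite -[LHS](mulr1 (y : B)) -inv [X in _ * X]mulrC mulrA hy' mul1r.
have zs := zcount_sum p_pr p_odd r0 cardF om1 omM omD d_pr d_odd pd d_cop coef l0.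
have ndq : ~~ (p %| p ^ r - 1)%N.
  apply/negP => h; have : (p %| p ^ r - (p ^ r - 1))%N by rewrite dvdn_sub // dvdn_exp.
  by rewrite subKn // dvdn1 => /eqP p1; have := prime_gt1 p_pr; rewrite p1.
have uq := unit_Zpn p_pr N ndq.
have iq : iota (p ^ r - 1)%:R^-1 * (p ^ r - 1)%:R = 1.
  by rewrite -(rmorph_nat iota) -rmorphM mulVr // rmorph1.
have -> : ((p ^ (d.-1 * r))%:Z * zcount p r d (lam : F))%:~R = p%:R ^+ (d.-1 * r) * (zcount p r d (lam : F))%:~R :> B.
  by rewrite intrM -pmulrn natrX.
set z := p%:R ^+ (d.-1 * r) * (zcount p r d (lam : F))%:~R in zs *.
have -> : z = iota (p ^ r - 1)%:R^-1 * ((p ^ r - 1)%:R * z) by rewrite mulrA iq mul1r.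
rewrite zs mulrN -mulNr -rmorphN mulr_sumr subn1.
apply: (@eq_bigr B) => j _; rewrite tb -mulr_algl -[_%:A]/(iota _) mulrA -rmorphM; congr (iota _ * _).
(* McCarthy's sign is trivial since d - 1 is even. *)
have -> : (-1 : 'Z_(p ^ N.+1)) ^+ (j * d.-1) = 1.
  by rewrite -signr_odd oddM -[odd d.-1]negbK -oddS prednK // d_odd andbF.
by rewrite mulr1 /mcprod.
Qed.
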